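(* Let $0<q<1$ and let $\alpha=(a,b,c,d)$ be generic complex parameters with $\mathrm{Re}(a)>0$. The polynomial Askey-Wilson transform $\mathbb{F}=\mathbb{F}(\alpha;q)$ defines a linear bijection $$\mathbb{F}:\mathcal{A}\,G^{-1}\rightarrow\bigl(\mathcal{A}\,G^{\sigma\tau}\bigr)|_{\mathcal{S}}\subset\mathcal{F}(\mathcal{S}),$$ with inverse $\mathbb{I}:\bigl(\mathcal{A}\,G^{\sigma\tau}\bigr)|_{\mathcal{S}}\rightarrow\mathcal{A}\,G^{-1}$. Explicitly, for $s\in\mathcal{S}^\tau=\mathcal{S}^{\sigma\tau}$, $$\mathbb{F}\bigl(E_s^{\tau}G^{-1}\bigr)=\frac{(bc,bc,d/a,ad,q/ad,bd,cd;q)_{\infty}}{(abcd;q)_{\infty}}\,G^{\tau\sigma\tau}(s)\,E_s^{\sigma\tau}G^{\sigma\tau},$$ $$\mathbb{I}\bigl(E_s^{\sigma\tau}G^{\sigma\tau}\bigr)=\frac{(abcd;q)_{\infty}}{(bc,bc,d/a,ad,q/ad,bd,cd;q)_{\infty}}\,G^{\tau\sigma\tau}(s)^{-1}\,E_s^{\tau}G^{-1}.$$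
   Context: Notation. $0<q<1$; $\mathbb{Z}_+=\{0,1,2,\dots\}$; $\mathbb{C}^\times=\mathbb{C}\setminus\{0\}$; $(x;q)_k=\prod_{i=0}^{k-1}(1-xq^i)$ for $k\in\mathbb{Z}_+\cup\{\infty\}$, $(x_1,\dots,x_r;q)_k=\prod_i(x_i;q)_k$; ${}_4\phi_3\left(\begin{matrix}a_1,\dots,a_4\\ b_1,b_2,b_3\end{matrix};q,z\right)=\sum_{k\ge0}\frac{(a_1,\dots,a_4;q)_k}{(q,b_1,b_2,b_3;q)_k}z^k$. The square root is the branch positive on $\mathbb{R}_{>0}$ with cut along $(-\infty,0)$. ''Generic'' means that the parameters avoid the exceptional proper subvarieties on which some expression involved is ill-defined (vanishing denominators, non-existence of the contours below, etc.). Involutions on parameters: $\alpha_\sigma=(\tilde a,\tilde b,\tilde c,\tilde d)$ with $\tilde a=\sqrt{q^{-1}abcd}$, $\tilde b=ab/\tilde a$, $\tilde c=ac/\tilde a$, $\tilde d=ad/\tilde a$; $\alpha_\tau=(a,b,c,q/d)$. Compositions are read left to right: $\alpha_{\sigma\tau}=(\alpha_\sigma)_\tau=(\tilde a,\tilde b,\tilde c,q/\tilde d)$, etc. For an object $H=H(\alpha)$, $H^{\sigma\tau}$ etc. denotes $H(\alpha_{\sigma\tau})$. Askey-Wilson polynomials: $\mathcal{S}=\mathcal{S}(\alpha;q)=\{s_m=\tilde aq^m : m\in\mathbb{Z}_+\}$ and $E_{s_n}(x)=E_{s_n}(x;\alpha;q)={}_4\phi_3\left(\begin{matrix}q^{-n},q^{n-1}abcd,ax,a/x\\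 ab,ac,ad\end{matrix};q,q\right)$. One has $\mathcal{S}^\tau=\mathcal{S}^{\sigma\tau}$ with $s_m^\tau=s_m^{\sigma\tau}=q^m\sqrt{abc/d}$. Gaussian: $G(x)=G(x;\alpha;q)=(dx,d/x;q)_\infty^{-1}$. $\mathcal{A}=\mathbb{C}[x+x^{-1}]$ is the space of inversion-invariant Laurent polynomials; $\mathcal{A}G^{-1}=\{pG^{-1}:p\in\mathcal{A}\}$; $(\mathcal{A}G^{\sigma\tau})|_{\mathcal{S}}$ is the space of restrictions to $\mathcal{S}$ of functions $pG^{\sigma\tau}$, $p\in\mathcal{A}$; $\mathcal{F}(\mathcal{S})$ is the space of all functions $\mathcal{S}\to\mathbb{C}$. Transforms: for an inversion-invariant analytic function $f$ on $\mathbb{C}^\times$ (i.e. $f(x^{-1})=f(x)$) and $s\in\mathcal{S}$, $$(\mathbb{F}f)(s)=\frac{1}{4\pi iN}\int_{\mathcal{T}}f(x)E_s(x)\Delta(x)\frac{dx}{x},\qquad \Delta(x)=\frac{(x^2,1/x^2;q)_\infty}{(ax,a/x,bx,b/x,cx,c/x,dx,d/x;q)_\infty},$$ where $\mathcal{T}$ is a closed counterclockwise contour with the sequences $eq^{\mathbb{Z}_+}$ in its interior and $e^{-1}q^{-\mathbb{Z}_+}$ in its exterior for $e=a,b,c,d$, and $N=\frac{1}{4\pi i}\int_{\mathcal{T}}\Delta(x)\frac{dx}{x}=\frac{(abcd;q)_\infty}{(q,ab,ac,ad,bc,bd,cd;q)_\infty}$. Conversely, for $g:\mathcal{S}\to\mathbb{C}$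 such that the series converges (absolutely and uniformly for $x$ in compacta of $\mathbb{C}^\times$), $$(\mathbb{I}g)(x)=\sum_{s\in\mathcal{S}}g(s)E_s(x)\widetilde h(s),\qquad \widetilde h(s_m)=\frac{(1-q^{2m-1}abcd)(q^{-1}abcd,ab,ac,ad;q)_m}{(1-q^{-1}abcd)(q,bc,bd,cd;q)_m}a^{-2m}.$$ *)

(* Defs.v *)
From Stdlib Require Import Reals List ClassicalEpsilon.
From Coquelicot Require Import Coquelicot.
Import ListNotations.
Open Scope C_scope.

(** * Limits, series and square root in C *)

Definition Clim (u : nat -> C) : C :=
  (real (Lim_seq (fun n => Re (u n))), real (Lim_seq (fun n => Im (u n)))).

Definition CSeries (u : nat -> C) : C :=
  (Series (fun n => Re (u n)), Series (fun n => Im (u n))).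

(** Principal branch.  On the cut itself, where the branch is a matter of
    convention, the value is the root with positive imaginary part. *)
Definition csqrt (z : C) : C :=
  let u := sqrt ((Cmod z + Re z) / 2) in
  let v := sqrt ((Cmod z - Re z) / 2) in
  if Rlt_dec (Im z) 0 then (u, (- v)%R) else (u, v).

(** * q-shifted factorials and the 4phi3 series *)

Fixpoint qpoch (q x : C) (k : nat) : C :=
  match k with
  | O => 1
  | S j => qpoch q x j * (1 - x * q ^ j)
  end.

Definition qpoch_inf (q x : C) : C := Clim (qpoch q x).

Definition qpochs (q : C) (xs : list C) (k : nat) : C :=
  fold_right (fun x r => qpoch q x k * r) 1 xs.

Definition qpochs_inf (q : C) (xs : list C) : C :=
  fold_right (fun x r => qpoch_inf q x * r) 1 xs.

Definition phi43 (q a1 a2 a3 a4 b1 b2 b3 z : C) : C :=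
  CSeries (fun k =>
    qpochs q [a1; a2; a3; a4] k / qpochs q [q; b1; b2; b3] k * z ^ k).

(** * Parameters and their involutions *)

Record params := Params { pa : C; pb : C; pc : C; pd : C }.

Definition ptilde (q : C) (al : params) : C :=
  csqrt (/ q * pa al * pb al * pc al * pd al).

Definition alpha_sigma (q : C) (al : params) : params :=
  let ta := ptilde q al in
  Params ta (pa al * pb al / ta) (pa al * pc al / ta) (pa al * pd al / ta).

Definition alpha_tau (q : C) (al : params) : params :=
  Params (pa al) (pb al) (pc al) (q / pd al).

(** * Spectrum, Askey-Wilson polynomials, Gaussian *)

Definition spec_pt (q : C) (al : params) (m : nat) : C := ptilde q al * q ^ m.

Definition spectrum (q : C) (al : params) (s : C) : Prop :=
  exists m, s = spec_pt q al m.

(** The points [spec_pt q al m] are pairwise distinct when [0 < q < 1] and the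
    parameters are nonzero, so this is the [m] with [s = spec_pt q al m]. *)
Definition spec_index (q : C) (al : params) (s : C) : nat :=
  epsilon (inhabits O) (fun m => s = spec_pt q al m).

Definition AWpoly (q : C) (al : params) (n : nat) (x : C) : C :=
  let (a, b, c, d) := al in
  phi43 q (/ q ^ n) (q ^ n / q * a * b * c * d) (a * x) (a / x)
          (a * b) (a * c) (a * d) q.

Definition AWE (q : C) (al : params) (s x : C) : C :=
  AWpoly q al (spec_index q al s) x.

(** Since [/ 0 = 0] for [Cinv], [/ gauss q al x] is [(d x, d / x; q)_oo] also
    at the poles of the Gaussian. *)
Definition gauss (q : C) (al : params) (x : C) : C :=
  / qpochs_inf q [pd al * x; pd al / x].

(** * Contours *)

Record contour := Contour {
  path : R -> C;
  dpath : R -> C;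
  path_derive : forall t : R, (0 <= t <= 1)%R ->
    @is_derive R_AbsRing C_R_NormedModule path t (dpath t);
  dpath_continuous : forall t : R, (0 <= t <= 1)%R ->
    @continuous R_UniformSpace C_UniformSpace dpath t;
  path_closed : path 0%R = path 1%R;
  path_simple : forall s t : R, (0 <= s < 1)%R -> (0 <= t < 1)%R ->
    path s = path t -> s = t
}.

Definition cint (T : contour) (f : C -> C) : C :=
  @RInt C_R_CompleteNormedModule (fun t => f (path T t) * dpath T t) 0 1.

Definition avoids (T : contour) (p : C) : Prop :=
  forall t : R, (0 <= t <= 1)%R -> path T t <> p.

Definition winding (T : contour) (p : C) : C :=
  / (2 * RtoC PI * Ci) * cint T (fun z => / (z - p)).

(** Winding number 1 (rather than -1) makes the curve counterclockwise. *)
Definition interior (T : contour) (p : C) : Prop :=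
  avoids T p /\ winding T p = 1.

Definition exterior (T : contour) (p : C) : Prop :=
  avoids T p /\ winding T p = 0.

Definition plist (al : params) : list C := [pa al; pb al; pc al; pd al].

Definition AWcontour (q : C) (al : params) (T : contour) : Prop :=
  avoids T 0 /\
  forall e, In e (plist al) -> forall k : nat,
    interior T (e * q ^ k) /\ exterior T (/ e * / q ^ k).

(** * The transforms *)

Definition AWweight (q : C) (al : params) (x : C) : C :=
  let (a, b, c, d) := al in
  qpochs_inf q [x ^ 2; / x ^ 2] /
  qpochs_inf q [a * x; a / x; b * x; b / x; c * x; c / x; d * x; d / x].

Definition AWnorm (q : C) (al : params) (T : contour) : C :=
  / (4 * RtoC PI * Ci) * cint T (fun x => AWweight q al x / x).

Definition AWF (q : C) (al : params) (T : contour) (f : C -> C) (s : C) : C :=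
  / (4 * RtoC PI * Ci * AWnorm q al T) *
  cint T (fun x => f x * AWE q al s x * AWweight q al x / x).

Definition htilde (q : C) (al : params) (m : nat) : C :=
  let (a, b, c, d) := al in
  ((1 - q ^ (2 * m) / q * a * b * c * d) *
   qpochs q [/ q * a * b * c * d; a * b; a * c; a * d] m) /
  ((1 - / q * a * b * c * d) * qpochs q [q; b * c; b * d; c * d] m)
  * / a ^ (2 * m).

Definition AWI_term (q : C) (al : params) (g : C -> C) (m : nat) (x : C) : C :=
  let s := spec_pt q al m in g s * AWE q al s x * htilde q al m.

Definition AWI (q : C) (al : params) (g : C -> C) (x : C) : C :=
  CSeries (fun m => AWI_term q al g m x).

Definition Cstar (x : C) : Prop := x <> 0.

Definition compact_in_Cstar (K : C -> Prop) : Prop :=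
  @closed C_UniformSpace K /\
  (exists M : R, forall x, K x -> (Cmod x <= M)%R) /\
  (forall x, K x -> Cstar x).

(** Absolute and uniform convergence of [sum_m u m x] on compacta of C^*,
    as a uniform Cauchy criterion for [sum_m |u m x|]. *)
Definition abs_unif_convergent (u : nat -> C -> C) : Prop :=
  forall K, compact_in_Cstar K -> forall eps : posreal,
  exists M : nat, forall n m : nat, (M <= n)%nat -> forall x, K x ->
    (sum_n_m (fun k => Cmod (u k x)) n m < eps)%R.

(** * Function spaces

    Functions on a subset [X] of C are represented by functions [C -> C]
    compared on [X]. *)

Definition eq_on (X : C -> Prop) (f g : C -> C) : Prop :=
  forall x, X x -> f x = g x.

Definition spaceA (p : C -> C) : Prop :=
  exists (n : nat) (c : nat -> C),
    eq_on Cstar p (fun x => sum_n (fun k => c k * (x + / x) ^ k) n).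

Definition spaceAGinv (q : C) (al : params) (f : C -> C) : Prop :=
  exists p, spaceA p /\ eq_on Cstar f (fun x => p x * / gauss q al x).

Definition spaceAGst (q : C) (al : params) (g : C -> C) : Prop :=
  exists p, spaceA p /\
    eq_on (spectrum q al) g
      (fun s => p s * gauss q (alpha_tau q (alpha_sigma q al)) s).

(** [F] is a linear bijection, with inverse [I], from the space [V] of
    functions on [X] onto the space [W] of functions on [Y]. *)
Record linear_bijection_with_inverse
    (X : C -> Prop) (V : (C -> C) -> Prop)
    (Y : C -> Prop) (W : (C -> C) -> Prop)
    (F I : (C -> C) -> C -> C) : Prop := {
  lb_F_ext : forall f1 f2, V f1 -> V f2 -> eq_on X f1 f2 ->
    eq_on Y (F f1) (F f2);
  lb_I_ext : forall g1 g2, W g1 -> W g2 -> eq_on Y g1 g2 ->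
    eq_on X (I g1) (I g2);
  lb_F_maps : forall f, V f -> W (F f);
  lb_I_maps : forall g, W g -> V (I g);
  lb_F_linear : forall (k1 k2 : C) f1 f2, V f1 -> V f2 ->
    eq_on Y (F (fun x => k1 * f1 x + k2 * f2 x))
            (fun y => k1 * F f1 y + k2 * F f2 y);
  lb_IF : forall f, V f -> eq_on X (I (F f)) f;
  lb_FI : forall g, W g -> eq_on Y (F (I g)) g
}.

(** * Genericity

    [gen_pairs] is the nonvanishing of all [(e e'; q)_oo], and (including the
    case [e' = e]) the condition for a contour as in [AWcontour] to exist.
    With it, [gen_ad], [gen_da] and [gen_da_inv] say that [ad] and [d/a] are not
    integral powers of [q]; this makes the Gaussians on the spectra finite and
    the constant in the explicit formulas finite and nonzero.  [gen_abcd] is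
    the nonvanishing of [(abcd/q; q)_oo], which occurs in the norms attached to
    [al], and [gen_abcd_tau] is the same condition for [alpha_tau q al]: it
    ensures that the polynomial with label [spec_pt q (alpha_tau q al) n] has
    degree exactly [n]. *)
Record generic (q : C) (al : params) : Prop := {
  gen_nonzero : forall e, In e (plist al) -> e <> 0;
  gen_pairs : forall e e', In e (plist al) -> In e' (plist al) ->
    forall k : nat, e * e' * q ^ k <> 1;
  gen_ad : forall k : nat, pa al * pd al <> q ^ S k;
  gen_da : forall k : nat, pd al * q ^ k <> pa al;
  gen_da_inv : forall k : nat, pa al * q ^ k <> pd al;
  gen_abcd : forall k : nat, / q * pa al * pb al * pc al * pd al * q ^ k <> 1;
  gen_abcd_tau : forall k : nat, pa al * pb al * pc al / pd al * q ^ k <> 1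
}.

Definition AWconst (q : C) (al : params) : C :=
  let (a, b, c, d) := al in
  qpochs_inf q [b * c; b * c; d / a; a * d; q / (a * d); b * d; c * d] /
  qpochs_inf q [a * b * c * d].

(* Main.v *)
Require Import Defs.
From Stdlib Require Import Classical Reals List Permutation Arith Lia Lra ClassicalEpsilon.
From Coquelicot Require Import Coquelicot.
Import ListNotations.
Open Scope C_scope.

(** By the three-term recurrence, [(d x, d / x; q)_K] has an explicit finite expansion in the
    Askey-Wilson polynomials.  Letting [K] tend to infinity (Tannery) expands [G^{-1}], and its
    coefficients are those of [I (F G^{-1})].  Multiplication by [x + / x] acts on the coefficients
    of [F (p G^{-1})] by the same recurrence, so Green's identity, with a boundary term of order
    [q ^ (m ^ 2 / 2)], propagates [I (F (p G^{-1})) = p G^{-1}] from [p = 1] to all of [A].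

    For the explicit formula, [G^{-1}] cancels the parameter [d] from the weight.  With one polynomial
    written in the base [a] and the other in the base [b], only integrals of the weight with parameters
    [a q ^ k, b q ^ j, c] occur, and these are related by contiguous relations, which say that the
    integral of a q-difference vanishes.  The double sum that remains is evaluated by two
    q-Chu-Vandermonde sums. *)

(** The contour is known only through its winding numbers about the points [e * q ^ k] and
    [/ e * / q ^ k]. Contour deformation is therefore done algebraically: infinite products are
    truncated to rational functions, partial fractions show that the contour and its dilation by
    [/ q] give these the same integral because no pole changes its winding number, and uniform
    convergence passes to the full products. The contiguous relations come from this. [F] depends on
    the integrals only through the ratio of the one with parameters [a, b, c] to the one with
    [a, b, c, d], but the latter must be nonzero. To see this, all parameters are multiplied by
    [q ^ K] and sent to 0, and the remaining integral is compared with the constant term of a theta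
    function. The coefficients of [I (F G^{-1})] are read off from the explicit formula for [F] at
    degree 0, where the polynomial is 1. Surjectivity of [F] comes from the same formula, since it
    sends one spanning family to nonzero multiples of another; with [I (F f) = f] this gives
    [F (I g) = g]. *)

(** * Finite sums and finite q-shifted factorials *)

Fixpoint csum (f : nat -> C) (n : nat) : C :=
  match n with O => 0 | S k => csum f k + f k end.

Lemma csum_ext (f g : nat -> C) n : (forall k, (k < n)%nat -> f k = g k) -> csum f n = csum g n.
Proof.
  induction n; intros H; simpl; [reflexivity|].
  rewrite IHn, H; auto with arith.
Qed.

Lemma csum_plus (f g : nat -> C) n : csum (fun k => f k + g k) n = csum f n + csum g n.
Proof. induction n; simpl; [ring|rewrite IHn; ring]. Qed.

Lemma csum_scal (c : C) (f : nat -> C) n : csum (fun k => c * f k) n = c * csum f n.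
Proof. induction n; simpl; [ring|rewrite IHn; ring]. Qed.

Lemma csum_zero (f : nat -> C) n : (forall k, (k < n)%nat -> f k = 0) -> csum f n = 0.
Proof.
  induction n; intros H; simpl; [reflexivity|].
  rewrite IHn, H; auto with arith. ring.
Qed.

Lemma csum_extend (f : nat -> C) n m : (n <= m)%nat -> (forall k, (n <= k)%nat -> f k = 0) ->
  csum f m = csum f n.
Proof.
  intros Hnm H; induction Hnm; simpl; [reflexivity|].
  rewrite IHHnm, H by assumption. ring.
Qed.

Lemma csum_swap (f : nat -> nat -> C) n m :
  csum (fun i => csum (f i) m) n = csum (fun j => csum (fun i => f i j) n) m.
Proof.
  induction n; simpl.
  - symmetry; apply csum_zero; reflexivity.
  - rewrite IHn, <- csum_plus. reflexivity.
Qed.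

Lemma csum_telescope (h : nat -> C) n : csum (fun k => h (S k) - h k) n = h n - h O.
Proof. induction n; simpl; [ring|rewrite IHn; ring]. Qed.

Lemma Cinv_neq_0 (x : C) : x <> 0 -> / x <> 0.
Proof. intros H E. apply C1_nz. rewrite <- (Cinv_r x H), E. ring. Qed.

Lemma Cmult_integral_contra (x y : C) : x * y = 0 -> x = 0 \/ y = 0.
Proof.
  intros H. destruct (Ceq_dec x 0) as [|Hx]; [now left|right].
  replace y with (/ x * (x * y)) by (field; assumption). rewrite H; ring.
Qed.

Lemma Cneq_sub (x y : C) : x <> y -> y - x <> 0.
Proof. intros H E. apply H. replace x with (y - (y - x)) by ring. rewrite E. ring. Qed.

Lemma qpoch_shift (q x : C) k : qpoch q x (S k) = (1 - x) * qpoch q (x * q) k.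
Proof.
  induction k; [simpl; ring|].
  change (qpoch q x (S (S k))) with (qpoch q x (S k) * (1 - x * q ^ S k)).
  rewrite IHk. simpl. ring.
Qed.

Lemma qpoch_add (q x : C) j k : qpoch q x (j + k) = qpoch q x j * qpoch q (x * q ^ j) k.
Proof.
  induction k; [rewrite Nat.add_0_r; simpl; ring|].
  rewrite Nat.add_succ_r. simpl. rewrite IHk, Cpow_add_r. ring.
Qed.

Lemma qpoch_neq_0 (q x : C) n : (forall k, (k < n)%nat -> 1 - x * q ^ k <> 0) -> qpoch q x n <> 0.
Proof.
  induction n; intros H; simpl; [apply C1_nz|].
  apply Cmult_neq_0; auto with arith.
Qed.

Lemma qpoch_eq_0 (q x : C) n k : (k < n)%nat -> x * q ^ k = 1 -> qpoch q x n = 0.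
Proof.
  intros Hk Hx; induction Hk; simpl; [rewrite Hx; ring|rewrite IHHk; ring].
Qed.

(** * Askey-Wilson polynomials and their recurrence *)

(** The summand of the 4phi3 is factored so that only [awU] depends on the degree and only [awphi]
    on [x]. Comparing coefficients of neighbouring degrees then leaves [awR] as a common factor. *)
Definition awU (q a b c d : C) (n k : nat) : C :=
  qpoch q (/ q ^ n) k * qpoch q (q ^ n / q * a * b * c * d) k.

Definition awR (q a b c d : C) (k : nat) : C :=
  q ^ k / (qpoch q q k * qpoch q (a * b) k * qpoch q (a * c) k * qpoch q (a * d) k).

Definition awphi (q a x : C) (k : nat) : C := qpoch q (a * x) k * qpoch q (a / x) k.

Definition awE (q a b c d : C) (n : nat) (x : C) : C :=
  csum (fun k => awU q a b c d n k * awR q a b c d k * awphi q a x k) (S n).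

Definition awA (q a b c d : C) (n : nat) : C :=
  (1 - a * b * q ^ n) * (1 - a * c * q ^ n) * (1 - a * d * q ^ n) *
  (1 - q ^ n / q * a * b * c * d) /
  (a * (1 - q ^ (2 * n) / q * a * b * c * d) * (1 - q ^ (2 * n) * a * b * c * d)).

Definition awC (q a b c d : C) (n : nat) : C :=
  a * (1 - q ^ n) * (1 - b * c * q ^ n / q) * (1 - b * d * q ^ n / q) *
  (1 - c * d * q ^ n / q) /
  ((1 - q ^ (2 * n) / q / q * a * b * c * d) * (1 - q ^ (2 * n) / q * a * b * c * d)).

(** At [x = a] every polynomial equals 1, since [awphi q a a k] vanishes for [k > 0]. This forces
    the three coefficients of the recurrence to sum to [a + / a]. *)
Definition awB (q a b c d : C) (n : nat) : C :=
  a + / a - awA q a b c d n - awC q a b c d n.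

(** Only pairs containing the base [a] occur in the denominators. The record can thus be
    instantiated with [b] as base and with the parameters after [tau] and [sigma tau], some of whose
    other pairs genericity does not control. *)
Record awok (q a b c d : C) : Prop := {
  ok_q : q <> 0;
  ok_qn : forall k, 1 - q ^ S k <> 0;
  ok_a : a <> 0;
  ok_ab : forall k, 1 - a * b * q ^ k <> 0;
  ok_ac : forall k, 1 - a * c * q ^ k <> 0;
  ok_ad : forall k, 1 - a * d * q ^ k <> 0;
  ok_M : forall k, 1 - q ^ k / q * a * b * c * d <> 0
}.

Lemma qpoch_q_neq_0 (q : C) : (forall k, 1 - q ^ S k <> 0) -> forall n, qpoch q q n <> 0.
Proof. intros H n. apply qpoch_neq_0. intros k _. exact (H k). Qed.

Lemma awU_trunc (q a b c d : C) n k : q <> 0 -> (n < k)%nat -> awU q a b c d n k = 0.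
Proof.
  intros Hq Hk. unfold awU. rewrite (qpoch_eq_0 q (/ q ^ n) k n); [ring|assumption|].
  apply Cinv_l, Cpow_nz, Hq.
Qed.

Lemma awE_extend (q a b c d : C) n N x : q <> 0 -> (n < N)%nat ->
  awE q a b c d n x = csum (fun k => awU q a b c d n k * awR q a b c d k * awphi q a x k) N.
Proof.
  intros Hq HN. unfold awE. symmetry. apply csum_extend; [lia|].
  intros k Hk. rewrite awU_trunc by (assumption || lia). ring.
Qed.

(** The factor added at step [k] is affine in [x + / x], hence a combination of [awphi q a x 1] and
    a constant; the constant is its value at [x = a]. *)
Lemma awphi_S (q a x : C) k : x <> 0 ->
  awphi q a x (S k) = awphi q a x k * (q ^ k * awphi q a x 1 + (1 - q ^ k) * (1 - a * a * q ^ k)).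
Proof. intros Hx. unfold awphi. simpl. field. assumption. Qed.

(** Clears [x <> 0] goals that equal a hypothesis [y <> 0] up to powers of nonzero atoms. *)
Ltac nzero_ring :=
  match goal with
  | H : ?y <> ?z |- ?x <> _ =>
      let E := fresh in intro E; apply H;
      first [ transitivity x; [ring | exact E] | transitivity (- x); [ring | rewrite E; ring] ]
  end.

Ltac nzero_field :=
  match goal with
  | Hq : ?q <> _ |- _ => is_var q;
      match goal with
      | H : ?y <> ?z |- ?x <> _ =>
          let E := fresh in intro E; apply H;
          first
          [ transitivity (x / q); [field; repeat split; assumption | rewrite E; field; assumption]
          | transitivity (- x / q); [field; repeat split; assumption | rewrite E; field; assumption]
          | transitivity (x / q / q); [field; repeat split; assumption | rewrite E; field; assumption] ]
      end
  end.

Ltac nzero :=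
  repeat match goal with |- _ /\ _ => split end;
  try assumption; first [ solve [nzero_ring] | nzero_field
  | match goal with
    | H : ?y <> ?z |- ?x <> _ =>
      let E := fresh in intro E; apply H;
      first [ transitivity x; [field; repeat split; assumption | exact E]
            | transitivity (- x); [field; repeat split; assumption | rewrite E; ring] ]
    end ].

(** The coefficient recurrence with [Q = q ^ n], [J = q ^ j] and two shifted factorials [P], [S] as
    independent variables; in this form it is a rational identity. *)
Lemma aw_step_identity (a b c d q Q J P S : C) :
  a <> 0 -> q <> 0 -> Q <> 0 -> J <> 0 -> 1 - Q <> 0 ->
  1 - Q / q * a * b * c * d * J <> 0 ->
  1 - Q * Q / q * a * b * c * d <> 0 -> 1 - Q * Q * a * b * c * d <> 0 ->
  1 - Q * Q / q / q * a * b * c * d <> 0 ->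
  1 - q * J <> 0 -> 1 - a * b * J <> 0 -> 1 - a * c * J <> 0 -> 1 - a * d * J <> 0 ->
  let A := (1 - a * b * Q) * (1 - a * c * Q) * (1 - a * d * Q) * (1 - Q / q * a * b * c * d) /
     (a * (1 - Q * Q / q * a * b * c * d) * (1 - Q * Q * a * b * c * d)) in
  let B := a * (1 - Q) * (1 - b * c * Q / q) * (1 - b * d * Q / q) * (1 - c * d * Q / q) /
     ((1 - Q * Q / q / q * a * b * c * d) * (1 - Q * Q / q * a * b * c * d)) in
  let S' := S * (1 - Q / q * a * b * c * d) / (1 - Q / q * a * b * c * d * J) in
  let P' := P * (1 - J / Q) / (1 - / Q) in
  let r := q / ((1 - q * J) * (1 - a * b * J) * (1 - a * c * J) * (1 - a * d * J)) in
  let U1 := P * (1 - J / Q) * ((1 - Q / q * a * b * c * d) * S) in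
  - / a * (P * S' / J - U1 * r / (q * J) * ((1 - q * J) * (1 - a * a * (q * J)))) =
  A * ((1 - / (q * Q)) * P * (S * (1 - Q * a * b * c * d * J)) - U1) * r +
  B * (P' * (1 - q / Q * J) * ((1 - Q / q / q * a * b * c * d) * S') - U1) * r.
Proof.
  intros Ha Hq HQ HJ H1 H2 H3 H4 H5 H6 H7 H8 H9 A B S' P' r U1.
  subst A B U1 S' P' r. field.
  nzero.
Qed.

Lemma Cpow_double (q : C) n : q ^ (2 * n) = q ^ n * q ^ n.
Proof. rewrite <- Cpow_add_r. f_equal. lia. Qed.

Lemma awok_even (q a b c d : C) : awok q a b c d -> forall n,
  1 - q ^ n * q ^ n / q * a * b * c * d <> 0 /\
  1 - q ^ n * q ^ n * a * b * c * d <> 0.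
Proof.
  intros H n. split.
  - rewrite <- Cpow_add_r. apply (ok_M _ _ _ _ _ H).
  - pose proof (ok_M _ _ _ _ _ H (S (n + n))) as H1. pose proof (ok_q _ _ _ _ _ H) as Hq.
    intro E. apply H1. rewrite <- E, Cpow_S, Cpow_add_r. field. nzero.
Qed.

Lemma awok_even' (q a b c d : C) : awok q a b c d -> forall n,
  1 - q ^ S n * q ^ S n / q / q * a * b * c * d <> 0.
Proof.
  intros H n. pose proof (ok_M _ _ _ _ _ H (S (n + n))) as H1. pose proof (ok_q _ _ _ _ _ H) as Hq.
  intro E. apply H1. rewrite <- E, !Cpow_S, Cpow_add_r. field. nzero.
Qed.

Lemma one_sub_inv (y : C) : y <> 0 -> 1 - y <> 0 -> 1 - / y <> 0.
Proof.
  intros H0 H E. apply H. replace (1 - y) with (- y * (1 - / y)) by (field; nzero).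
  rewrite E; ring.
Qed.

Lemma awR_S (q a b c d : C) k : awok q a b c d ->
  awR q a b c d (S k) = awR q a b c d k *
    (q / ((1 - q * q ^ k) * (1 - a * b * q ^ k) * (1 - a * c * q ^ k) * (1 - a * d * q ^ k))).
Proof.
  intros H. unfold awR. simpl qpoch. rewrite Cpow_S.
  pose proof (ok_q _ _ _ _ _ H). pose proof (ok_qn _ _ _ _ _ H k).
  pose proof (ok_ab _ _ _ _ _ H k). pose proof (ok_ac _ _ _ _ _ H k).
  pose proof (ok_ad _ _ _ _ _ H k).
  assert (qpoch q q k <> 0) by (apply qpoch_q_neq_0, H).
  assert (qpoch q (a * b) k <> 0) by (apply qpoch_neq_0; intros; apply H).
  assert (qpoch q (a * c) k <> 0) by (apply qpoch_neq_0; intros; apply H).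
  assert (qpoch q (a * d) k <> 0) by (apply qpoch_neq_0; intros; apply H).
  field. repeat split; assumption.
Qed.

Lemma aw_coef_recurrence (q a b c d : C) p j : awok q a b c d ->
  let n := S p in let r := awR q a b c d in let U := awU q a b c d in
  - / a * (U n j * r j / q ^ j -
    U n (S j) * r (S j) / q ^ S j * ((1 - q ^ S j) * (1 - a * a * q ^ S j))) =
  awA q a b c d n * (U (S n) (S j) - U n (S j)) * r (S j) +
  awC q a b c d n * (U p (S j) - U n (S j)) * r (S j).
Proof.
  intros H n r U.
  pose proof (ok_q _ _ _ _ _ H) as Hq.
  pose proof (ok_a _ _ _ _ _ H) as Ha.
  set (P := qpoch q (/ q ^ n) j). set (S0 := qpoch q (q ^ n * a * b * c * d) j).
  assert (HQ : q ^ n <> 0) by (apply Cpow_nz, Hq).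
  assert (HJ : q ^ j <> 0) by (apply Cpow_nz, Hq).
  pose proof (ok_qn _ _ _ _ _ H p) as Hn. fold n in Hn.
  pose proof (ok_qn _ _ _ _ _ H j) as Hj. rewrite Cpow_S in Hj.
  pose proof (awok_even _ _ _ _ _ H n) as [He1 He2].
  pose proof (awok_even' _ _ _ _ _ H p) as He3. fold n in He3.
  assert (Hnp : q ^ n = q * q ^ p) by reflexivity. clearbody n.
  assert (HM : 1 - q ^ n / q * a * b * c * d * q ^ j <> 0).
  { pose proof (ok_M _ _ _ _ _ H (n + j)) as E. rewrite Cpow_add_r in E.
    intro E1. apply E. rewrite <- E1. field. nzero. }
  (* The bases for the degrees [n - 1], [n], [n + 1] differ by factors [q], and a shifted factorial
     of length [S j] splits at either end. So everything can be expressed through [P] and [S0]. *)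
  assert (E1 : qpoch q (q ^ n / q * a * b * c * d) j =
               S0 * (1 - q ^ n / q * a * b * c * d) / (1 - q ^ n / q * a * b * c * d * q ^ j)).
  { pose proof (qpoch_shift q (q ^ n / q * a * b * c * d) j) as E.
    simpl in E.
    replace (q ^ n / q * a * b * c * d * q) with (q ^ n * a * b * c * d) in E by (field; nzero).
    fold S0 in E. rewrite Cmult_comm in E.
    apply (f_equal (fun z => z / (1 - q ^ n / q * a * b * c * d * q ^ j))) in E.
    transitivity ((1 - q ^ n / q * a * b * c * d * q ^ j) * qpoch q (q ^ n / q * a * b * c * d) j
      / (1 - q ^ n / q * a * b * c * d * q ^ j)); [field; nzero|].
    rewrite E. field. nzero. }
  assert (Hn' := one_sub_inv _ HQ Hn).
  assert (E2 : qpoch q (/ q ^ p) j = P * (1 - q ^ j / q ^ n) / (1 - / q ^ n)).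
  { pose proof (qpoch_shift q (/ q ^ n) j) as E. simpl qpoch in E.
    replace (/ q ^ n * q) with (/ q ^ p) in E
      by (rewrite Hnp; field; split; [apply Cpow_nz|]; assumption).
    fold P in E.
    transitivity ((1 - / q ^ n) * qpoch q (/ q ^ p) j / (1 - / q ^ n)); [field; nzero|].
    rewrite <- E. field. nzero. }
  assert (U0 : U n j = P * (S0 * (1 - q ^ n / q * a * b * c * d) / (1 - q ^ n / q * a * b * c * d * q ^ j)))
    by (unfold U, awU; rewrite E1; reflexivity).
  assert (U1 : U n (S j) = P * (1 - q ^ j / q ^ n) * ((1 - q ^ n / q * a * b * c * d) * S0)).
  { unfold U, awU. rewrite (qpoch_shift _ (q ^ n / q * a * b * c * d)).
    replace (q ^ n / q * a * b * c * d * q) with (q ^ n * a * b * c * d) by (field; nzero).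
    simpl qpoch. fold P S0. field. nzero. }
  assert (U2 : U (S n) (S j) = (1 - / (q * q ^ n)) * P * (S0 * (1 - q ^ n * a * b * c * d * q ^ j))).
  { unfold U, awU. rewrite (qpoch_shift _ (/ q ^ S n)). rewrite (Cpow_S q n).
    replace (/ (q * q ^ n) * q) with (/ q ^ n) by (field; nzero).
    replace (q * q ^ n / q * a * b * c * d) with (q ^ n * a * b * c * d) by (field; nzero).
    simpl qpoch. fold P S0. ring. }
  assert (U3 : U p (S j) = P * (1 - q ^ j / q ^ n) / (1 - / q ^ n) * (1 - q / q ^ n * q ^ j) *
     ((1 - q ^ n / q / q * a * b * c * d) *
      (S0 * (1 - q ^ n / q * a * b * c * d) / (1 - q ^ n / q * a * b * c * d * q ^ j)))).
  { assert (Hp : q ^ p = q ^ n / q) by (rewrite Hnp; field; nzero).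
    unfold U, awU. rewrite (qpoch_shift _ (q ^ p / q * a * b * c * d)).
    replace (q ^ p / q * a * b * c * d * q) with (q ^ n / q * a * b * c * d) by (rewrite Hp; field; nzero).
    simpl qpoch. rewrite E1, E2, Hp. replace (/ (q ^ n / q)) with (q / q ^ n) by (field; nzero). ring. }
  unfold awA, awC. rewrite !Cpow_double, U0, U1, U2, U3. unfold r. rewrite (awR_S _ _ _ _ _ j H).
  rewrite (Cpow_S q j).
  pose proof (aw_step_identity a b c d q (q ^ n) (q ^ j) P S0 Ha Hq HQ HJ Hn HM He1 He2 He3 Hj
     (ok_ab _ _ _ _ _ H j) (ok_ac _ _ _ _ _ H j) (ok_ad _ _ _ _ _ H j)) as K.
  cbv zeta in K.
  match type of K with ?l = ?rr =>
    transitivity (awR q a b c d j * l); [|rewrite K] end.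
  - unfold Cdiv. ring.
  - unfold Cdiv. ring.
Qed.

(** Compares coefficients in the basis [awphi], on which [x + / x] acts by [awphi_S]. *)
Lemma awE_recurrence (q a b c d : C) n (x : C) : awok q a b c d -> x <> 0 ->
  (x + / x) * awE q a b c d n x =
  awA q a b c d n * awE q a b c d (S n) x + awB q a b c d n * awE q a b c d n x +
  awC q a b c d n * awE q a b c d (pred n) x.
Proof.
  intros H Hx.
  pose proof (ok_q _ _ _ _ _ H) as Hq.
  pose proof (ok_a _ _ _ _ _ H) as Ha.
  (* Since [- / a * awphi q a x 1] is [x + / x - a - / a], the choice of [awB] turns the recurrence
     into one between differences of neighbouring polynomials. *)
  cut (- / a * awphi q a x 1 * awE q a b c d n x =
    awA q a b c d n * (awE q a b c d (S n) x - awE q a b c d n x) +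
    awC q a b c d n * (awE q a b c d (pred n) x - awE q a b c d n x)).
  { intros E. unfold awB.
    replace (- / a * awphi q a x 1) with (x + / x - a - / a) in E.
    2:{ unfold awphi; simpl. field. nzero. }
    transitivity ((x + / x - a - / a) * awE q a b c d n x + (a + / a) * awE q a b c d n x); [ring|].
    rewrite E. ring. }
  destruct n as [|p].
  (* Here [pred 0 = 0] names a spurious neighbour, harmless because its coefficient [awC] vanishes
     at 0. *)
  - unfold awC. replace (1 - q ^ 0) with (RtoC 0) by (simpl; ring).
    rewrite Cmult_0_r, !Cmult_0_l. unfold Cdiv. rewrite !Cmult_0_l, Cplus_0_r.
    unfold awE, awA, awU, awR. simpl.
    pose proof (ok_qn _ _ _ _ _ H 0). pose proof (ok_ab _ _ _ _ _ H 0).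
    pose proof (ok_ac _ _ _ _ _ H 0). pose proof (ok_ad _ _ _ _ _ H 0).
    pose proof (ok_M _ _ _ _ _ H 0). pose proof (ok_M _ _ _ _ _ H 1). simpl in *.
    unfold awphi; simpl.
    assert (1 - q <> 0) by nzero.
    assert (1 - a * b <> 0) by nzero. assert (1 - a * c <> 0) by nzero.
    assert (1 - a * d <> 0) by nzero.
    assert (1 - a * b * c * d <> 0) by nzero.
    assert (q - a * b * c * d <> 0) by nzero.
    field. nzero.
  - set (n := S p). simpl pred.
    set (U := awU q a b c d). set (r := awR q a b c d). set (f := awphi q a x).
    (* Multiplication by [f 1] raises the basis index by one, so a partial sum leaves a boundary
       term in [f (S j)]. It disappears at [j = S n], where [U n (S n) = 0]. *)
    assert (K : forall j, csum (fun k => - / a * f 1%nat * (U n k * r k * f k)) (S j) =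
       csum (fun k => (awA q a b c d n * (U (S n) k - U n k) * r k +
              awC q a b c d n * (U p k - U n k) * r k) * f k) (S j)
       + - / a * (U n j * r j / q ^ j) * f (S j)).
    { induction j.
      - simpl csum. unfold U, awU, f, awphi. simpl qpoch. change (q ^ 0) with (RtoC 1). field. nzero.
      - change (csum ?g (S (S j))) with (csum g (S j) + g (S j)). cbv beta.
        rewrite IHj. pose proof (aw_coef_recurrence q a b c d p j H) as K0.
        cbv zeta in K0. fold n U r in K0. rewrite <- K0.
        assert (E : f 1%nat * f (S j) = / q ^ S j * (f (S (S j)) - (1 - q ^ S j) * (1 - a * a * q ^ S j) * f (S j))).
        { unfold f. rewrite (awphi_S q a x (S j) Hx). field. apply Cpow_nz, Hq. }
        transitivity (csum
          (fun k : nat =>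
           (awA q a b c d n * (U (S n) k - U n k) * r k + awC q a b c d n * (U p k - U n k) * r k) * f k)
          (S j) + - / a * (U n j * r j / q ^ j) * f (S j) +
           - / a * (U n (S j) * r (S j)) * (f 1%nat * f (S j))); [ring|].
        rewrite E. unfold Cdiv. ring. }
    specialize (K (S n)).
    assert (Z : U n (S n) = 0) by (apply awU_trunc; [assumption|lia]).
    rewrite Z in K.
    rewrite !(awE_extend q a b c d _ (S (S n))) by (assumption || unfold n; lia).
    fold U r f. change (awphi q a x 1) with (f 1%nat). rewrite csum_scal in K. rewrite K.
    unfold Cdiv. rewrite !Cmult_0_l, Cmult_0_r, Cmult_0_l, Cplus_0_r.
    transitivity (awA q a b c d n * (csum (fun k => U (S n) k * r k * f k + - (1) * (U n k * r k * f k)) (S (S n)))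
       + awC q a b c d n * (csum (fun k => U p k * r k * f k + - (1) * (U n k * r k * f k)) (S (S n)))).
    + rewrite <- !csum_scal, <- csum_plus. apply csum_ext. intros; ring.
    + rewrite !csum_plus, !csum_scal. ring.
Qed.

Lemma awB_identity (a b c d q Q : C) :
  a <> 0 -> b <> 0 -> q <> 0 ->
  1 - Q * Q / q * a * b * c * d <> 0 -> 1 - Q * Q * a * b * c * d <> 0 ->
  1 - Q * Q / q / q * a * b * c * d <> 0 ->
  a + / a - (1 - a * b * Q) * (1 - a * c * Q) * (1 - a * d * Q) * (1 - Q / q * a * b * c * d) /
     (a * (1 - Q * Q / q * a * b * c * d) * (1 - Q * Q * a * b * c * d))
   - a * (1 - Q) * (1 - b * c * Q / q) * (1 - b * d * Q / q) * (1 - c * d * Q / q) /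
     ((1 - Q * Q / q / q * a * b * c * d) * (1 - Q * Q / q * a * b * c * d)) =
  b + / b - (1 - b * a * Q) * (1 - b * c * Q) * (1 - b * d * Q) * (1 - Q / q * b * a * c * d) /
     (b * (1 - Q * Q / q * b * a * c * d) * (1 - Q * Q * b * a * c * d))
   - b * (1 - Q) * (1 - a * c * Q / q) * (1 - a * d * Q / q) * (1 - c * d * Q / q) /
     ((1 - Q * Q / q / q * b * a * c * d) * (1 - Q * Q / q * b * a * c * d)).
Proof. intros Ha Hb Hq H1 H2 H3. field. nzero. Qed.

Lemma awB_identity_0 (a b c d q : C) :
  a <> 0 -> b <> 0 -> q <> 0 ->
  1 - / q * a * b * c * d <> 0 -> 1 - a * b * c * d <> 0 ->
  a + / a - (1 - a * b) * (1 - a * c) * (1 - a * d) / (a * (1 - a * b * c * d)) =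
  b + / b - (1 - b * a) * (1 - b * c) * (1 - b * d) / (b * (1 - b * a * c * d)).
Proof. intros Ha Hb Hq H1 H2. field. nzero. Qed.

Lemma awC_0 (q a b c d : C) : awC q a b c d 0 = 0.
Proof. unfold awC. replace (1 - q ^ 0) with (RtoC 0) by (simpl; ring). unfold Cdiv. ring. Qed.

Lemma awA_0 (q a b c d : C) : awok q a b c d ->
  awA q a b c d 0 = (1 - a * b) * (1 - a * c) * (1 - a * d) / (a * (1 - a * b * c * d)).
Proof.
  intros H.
  pose proof (ok_q _ _ _ _ _ H) as Hq. pose proof (ok_a _ _ _ _ _ H) as Ha.
  destruct (awok_even _ _ _ _ _ H 0) as [H1 H2]. simpl in H1, H2.
  assert (1 - a * b * c * d <> 0) by nzero.
  assert (1 - / q * a * b * c * d <> 0) by nzero.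
  unfold awA. simpl. field. nzero.
Qed.

Lemma awB_sym (q a b c d : C) n : awok q a b c d -> awok q b a c d ->
  awB q a b c d n = awB q b a c d n.
Proof.
  intros H H'.
  pose proof (ok_q _ _ _ _ _ H) as Hq. pose proof (ok_a _ _ _ _ _ H) as Ha.
  pose proof (ok_a _ _ _ _ _ H') as Hb.
  destruct (awok_even _ _ _ _ _ H n) as [H1 H2].
  unfold awB. destruct n as [|p].
  - rewrite !awC_0, (awA_0 _ _ _ _ _ H), (awA_0 _ _ _ _ _ H').
    pose proof (awB_identity_0 a b c d q) as E. simpl in H1, H2.
    assert (E0 : forall z : C, z - 0 = z) by (intros; ring). rewrite !E0.
    apply E; try assumption; nzero.
  - unfold awA, awC. rewrite !Cpow_double. apply awB_identity; try assumption.
    apply awok_even'. assumption.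
Qed.

(** The value at [x = b] of the polynomial that is normalised to 1 at [x = a]. *)
Definition awkap (q a b c d : C) (n : nat) : C :=
  qpoch q (b * c) n * qpoch q (b * d) n / (qpoch q (a * c) n * qpoch q (a * d) n) * (a / b) ^ n.

Lemma awA_neq_0 (q a b c d : C) n : awok q a b c d -> awA q a b c d n <> 0.
Proof.
  intros H. destruct (awok_even _ _ _ _ _ H n) as [H1 H2]. destruct H as [Hq _ Ha Hab Hac Had HM].
  unfold awA, Cdiv. rewrite Cpow_double.
  apply Cmult_neq_0; [|apply Cinv_neq_0]; repeat apply Cmult_neq_0; auto.
  apply HM.
Qed.

Lemma awkap_S (q a b c d : C) n : awok q a b c d -> b <> 0 ->
  awkap q a b c d (S n) = awkap q a b c d n *
  ((1 - b * c * q ^ n) * (1 - b * d * q ^ n) * a / ((1 - a * c * q ^ n) * (1 - a * d * q ^ n) * b)).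
Proof.
  intros H Hb. unfold awkap. simpl.
  pose proof (ok_ac _ _ _ _ _ H n). pose proof (ok_ad _ _ _ _ _ H n).
  assert (qpoch q (a * c) n <> 0) by (apply qpoch_neq_0; intros; apply H).
  assert (qpoch q (a * d) n <> 0) by (apply qpoch_neq_0; intros; apply H).
  field. nzero.
Qed.

Lemma awE_0 (q a b c d x : C) : awE q a b c d 0 x = 1.
Proof. unfold awE, awU, awR, awphi. simpl. field. Qed.

(** A case of Sears' transformation. Both sides solve the same three-term recurrence: [awB] is
    symmetric in [a] and [b], and [awkap] carries [awA] and [awC] from one base to the other. The
    induction keeps two consecutive degrees. *)
Lemma awE_sym (q a b c d : C) n (x : C) : awok q a b c d -> awok q b a c d -> x <> 0 ->
  awE q a b c d n x = awkap q a b c d n * awE q b a c d n x.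
Proof.
  intros H H' Hx.
  pose proof (ok_q _ _ _ _ _ H) as Hq. pose proof (ok_a _ _ _ _ _ H) as Ha.
  pose proof (ok_a _ _ _ _ _ H') as Hb.
  cut (awE q a b c d n x = awkap q a b c d n * awE q b a c d n x /\
       awE q a b c d (pred n) x = awkap q a b c d (pred n) * awE q b a c d (pred n) x).
  { intros [E _]; exact E. }
  induction n as [|n [IH1 IH2]].
  - simpl pred. rewrite !awE_0. unfold awkap. simpl. split; field.
  - split; [|exact IH1].
    pose proof (awE_recurrence q a b c d n x H Hx) as R1.
    pose proof (awE_recurrence q b a c d n x H' Hx) as R2.
    pose proof (awA_neq_0 q a b c d n H) as HA.
    rewrite IH1, IH2, (awB_sym q a b c d n H H') in R1.
    assert (EA : awA q a b c d n * awkap q a b c d (S n) = awkap q a b c d n * awA q b a c d n).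
    { rewrite (awkap_S _ _ _ _ _ n H Hb). unfold awA. rewrite !Cpow_double.
      destruct (awok_even _ _ _ _ _ H n) as [H1 H2].
      destruct (awok_even _ _ _ _ _ H' n) as [H3 H4].
      pose proof (ok_ac _ _ _ _ _ H n). pose proof (ok_ad _ _ _ _ _ H n).
      field. nzero. }
    assert (EC : awC q a b c d n * awkap q a b c d (pred n) = awkap q a b c d n * awC q b a c d n).
    { destruct n as [|p]; [rewrite !awC_0; ring|]. simpl pred.
      rewrite (awkap_S _ _ _ _ _ p H Hb). unfold awC. rewrite !Cpow_double.
      destruct (awok_even _ _ _ _ _ H (S p)) as [H1 H2].
      destruct (awok_even _ _ _ _ _ H' (S p)) as [H3 H4].
      pose proof (awok_even' _ _ _ _ _ H p) as H5.
      pose proof (awok_even' _ _ _ _ _ H' p) as H6.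
      pose proof (ok_ac _ _ _ _ _ H p). pose proof (ok_ad _ _ _ _ _ H p).
      rewrite (Cpow_S q p) in *.
      field. nzero. }
    assert (E : awA q a b c d n * awE q a b c d (S n) x =
                awA q a b c d n * (awkap q a b c d (S n) * awE q b a c d (S n) x)).
    { transitivity (awkap q a b c d n * (awA q b a c d n * awE q b a c d (S n) x)).
      - transitivity ((x + / x) * (awkap q a b c d n * awE q b a c d n x) -
           awB q b a c d n * (awkap q a b c d n * awE q b a c d n x) -
           awC q a b c d n * awkap q a b c d (pred n) * awE q b a c d (pred n) x); [rewrite R1; ring|].
        rewrite EC. transitivity (awkap q a b c d n * ((x + / x) * awE q b a c d n x -
           awB q b a c d n * awE q b a c d n x - awC q b a c d n * awE q b a c d (pred n) x)); [ring|].
        rewrite R2. ring.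
      - rewrite !Cmult_assoc, EA. reflexivity. }
    transitivity (/ awA q a b c d n * (awA q a b c d n * awE q a b c d (S n) x)); [field; assumption|].
    rewrite E. field. assumption.
Qed.

(** * Summation formulas *)

(** Newton interpolation basis at the nodes [1, q, q ^ 2, ...]. At [y = q ^ k] it is [(q^{-k}; q)_i]
    up to a power of [q], so expansions terminate, while [y = 0] remains meaningful and gives the
    limit for large [k]. *)
Fixpoint newton (q y : C) (i : nat) : C :=
  match i with O => 1 | S j => newton q y j * (y - q ^ j) end.

Lemma newton_eq_0 (q : C) k i : (k < i)%nat -> newton q (q ^ k) i = 0.
Proof. intros H; induction H; simpl; [ring|rewrite IHle; ring]. Qed.

Lemma newton_shift (q y : C) i :
  newton q (q * y) (S i) = (q * y - 1) * q ^ i * newton q y i.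
Proof.
  induction i; [simpl; ring|].
  change (newton q (q * y) (S (S i))) with (newton q (q * y) (S i) * (q * y - q ^ S i)).
  rewrite IHi. simpl. ring.
Qed.

Lemma newton_diag (q : C) n : q <> 0 ->
  newton q (q ^ n) n = qpoch q q n * ((-(1)) ^ n * q ^ (n * (n - 1) / 2)).
Proof.
  intros Hq. induction n; [simpl; ring|].
  rewrite (Cpow_S q n), newton_shift, IHn.
  replace (S n * (S n - 1) / 2)%nat with (n * (n - 1) / 2 + n)%nat.
  - rewrite Cpow_add_r. simpl. ring.
  - replace (S n * (S n - 1))%nat with (n * (n - 1) + n * 2)%nat by (destruct n; simpl; lia).
    rewrite Nat.div_add by lia. reflexivity.
Qed.

(** A two-variable form of the q-Chu-Vandermonde sum, symmetric in [j] and [k]. *)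
Lemma qpoch_add_newton (q c : C) j k B :
  (forall i, 1 - q ^ S i <> 0) -> (forall i, 1 - c * q ^ i <> 0) -> c <> 0 -> (k < B)%nat ->
  qpoch q c (j + k) = qpoch q c j * qpoch q c k *
    csum (fun i => c ^ i / (qpoch q q i * qpoch q c i) * newton q (q ^ j) i * newton q (q ^ k) i) B.
Proof.
  intros Hq Hc Hc0 HB.
  assert (Pq : forall i, qpoch q q i <> 0) by (apply qpoch_q_neq_0, Hq).
  assert (Pc : forall i, qpoch q c i <> 0) by (intros; apply qpoch_neq_0; auto).
  set (y := q ^ j). set (W := fun i => c ^ i / (qpoch q q i * qpoch q c i)).
  rewrite qpoch_add. fold y.
  assert (WS : forall i, W i * c = W (S i) * ((1 - q * q ^ i) * (1 - c * q ^ i))).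
  { intros i. unfold W. simpl. pose proof (Hq i). pose proof (Hc i). pose proof (Pq i). pose proof (Pc i).
    simpl in *. field. repeat split; assumption. }
  cut (qpoch q (c * y) k = qpoch q c k *
    csum (fun i => W i * newton q y i * newton q (q ^ k) i) B).
  { intros E. rewrite E. unfold W. ring. }
  assert (W0 : W O = 1) by (unfold W; simpl; field).
  (* From here on [y] is arbitrary; the sum terminates because of [q ^ k] alone. *)
  clearbody y W. revert HB. induction k; intros HB.
  - rewrite (csum_extend _ 1 B) by (lia || (intros i Hi; rewrite (newton_eq_0 q 0 i) by lia; ring)).
    simpl. rewrite W0. ring.
  - simpl qpoch. rewrite IHk by lia. rewrite <- !Cmult_assoc. f_equal.
    rewrite (Cmult_comm (csum _ _)), <- !csum_scal.
    set (z := q ^ k). change (q ^ S k) with (q * z).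
    (* The two sums of the induction step differ by a telescoping sum, whose boundary term contains
       [newton q (q ^ k) m] and vanishes as [k < m]. *)
    assert (T : forall m, csum (fun i => (1 - c * y * z) * (W i * newton q y i * newton q z i)) (S m) =
       csum (fun i => (1 - c * z) * (W i * newton q y i * newton q (q * z) i)) (S m)
       - c * z * W m * newton q y (S m) * newton q z m).
    { induction m.
      - simpl. ring.
      - change (csum ?g (S (S m))) with (csum g (S m) + g (S m)). cbv beta. rewrite IHm.
        rewrite newton_shift.
        transitivity (csum (fun i : nat => (1 - c * z) * (W i * newton q y i * newton q (q * z) i)) (S m) -
           z * (W m * c) * newton q y (S m) * newton q z m +
           (1 - c * y * z) * (W (S m) * newton q y (S m) * newton q z (S m))); [ring|].
        rewrite WS. simpl. ring. }
    rewrite (Cmult_assoc c y z). destruct B as [|m]; [lia|]. rewrite T.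
    unfold z. rewrite (newton_eq_0 q k m) by lia. ring.
Qed.

(** [u] encodes the quotient [D / Q] of the usual summation formula: reversing the factors turns
    [qpoch q (D / Q) n] into a multiple of [qpoch q u n]. *)
Lemma vandermonde_newton_step (q Q D u : C) n i :
  q <> 0 -> (forall k, 1 - q ^ S k <> 0) -> D <> 0 -> (forall k, 1 - D * q ^ k <> 0) ->
  Q = D * q ^ n / q * u ->
  let S0 := fun i => csum (fun k => qpoch q (/ q ^ n) k * qpoch q Q k /
      (qpoch q q k * qpoch q D k) * q ^ k * newton q (q ^ k) i) (S n) in
  S0 (S i) * (1 - u * q ^ i) = q / D * (1 - / q ^ n * q ^ i) * (1 - Q * q ^ i) * S0 i.
Proof.
  intros Hq Hqn HD HDn HQ S0.
  assert (Pq : forall i, qpoch q q i <> 0) by (apply qpoch_q_neq_0, Hqn).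
  assert (Pc : forall i, qpoch q D i <> 0) by (intros; apply qpoch_neq_0; auto).
  set (t := fun k => qpoch q (/ q ^ n) k * qpoch q Q k / (qpoch q q k * qpoch q D k) * q ^ k * newton q (q ^ k) i).
  (* A telescoping certificate. It vanishes at [S n] through [qpoch q (/ q ^ n)], and at 0 through
     [q ^ 0 - q ^ i] if [i = 0] and through the Newton factor otherwise. *)
  set (h := fun k => q / D * t k * (1 - D * q ^ k / q) * (q ^ k - q ^ i) / q ^ k).
  assert (E : S0 (S i) * (1 - u * q ^ i) - q / D * (1 - / q ^ n * q ^ i) * (1 - Q * q ^ i) * S0 i =
     csum (fun k => h (S k) - h k) (S n)).
  { assert (ES : S0 (S i) = csum (fun k => t k * (q ^ k - q ^ i)) (S n))
      by (apply csum_ext; intros k _; unfold t; simpl newton; ring).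
    assert (E0 : S0 i = csum t (S n)) by reflexivity.
    rewrite ES, E0.
    transitivity (csum (fun k => (1 - u * q ^ i) * (t k * (q ^ k - q ^ i)) +
       - (q / D * (1 - / q ^ n * q ^ i) * (1 - Q * q ^ i)) * t k) (S n)).
    { rewrite csum_plus, !csum_scal. ring. }
    apply csum_ext. intros k _.
    assert (HS : t (S k) * (1 - D * q ^ S k / q) * (q ^ S k - q ^ i) =
       - (t k * (1 - / q ^ n * q ^ k) * (1 - Q * q ^ k) * q * q ^ i)).
    { unfold t. simpl qpoch. rewrite (Cpow_S q k).
      assert (E1 : newton q (q * q ^ k) i * (q * q ^ k - q ^ i) = (q * q ^ k - 1) * q ^ i * newton q (q ^ k) i)
        by (rewrite <- newton_shift; reflexivity).
      pose proof (Hqn k) as H1. rewrite Cpow_S in H1. pose proof (HDn k) as H2.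
      pose proof (Pq k). pose proof (Pc k).
      assert (q ^ n <> 0) by (apply Cpow_nz, Hq).
      transitivity (qpoch q (/ q ^ n) k * (1 - / q ^ n * q ^ k) * (qpoch q Q k * (1 - Q * q ^ k)) /
       (qpoch q q k * (1 - q * q ^ k) * (qpoch q D k * (1 - D * q ^ k))) * (q * q ^ k) *
       (1 - D * (q * q ^ k) / q) * (newton q (q * q ^ k) i * (q * q ^ k - q ^ i))); [ring|].
      rewrite E1. field. repeat split; assumption. }
    assert (h (S k) = q / D / q ^ S k * (t (S k) * (1 - D * q ^ S k / q) * (q ^ S k - q ^ i))) as ->
      by (unfold h, Cdiv; ring).
    rewrite HS. unfold h. rewrite (Cpow_S q k), HQ.
    assert (q ^ n <> 0) by (apply Cpow_nz, Hq). assert (q ^ k <> 0) by (apply Cpow_nz, Hq).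
    field. repeat split; assumption. }
  rewrite csum_telescope in E.
  assert (h (S n) = 0) as Z1.
  { unfold h, t. simpl (qpoch q (/ q ^ n) (S n)). rewrite Cinv_l by (apply Cpow_nz, Hq). unfold Cdiv; ring. }
  assert (h O = 0) as Z2.
  { unfold h, t. destruct i as [|i'].
    - replace (q ^ 0 - q ^ 0) with (RtoC 0) by ring. unfold Cdiv; ring.
    - rewrite (newton_eq_0 q 0 (S i')) by lia. unfold Cdiv; ring. }
  rewrite Z1, Z2 in E.
  transitivity (q / D * (1 - / q ^ n * q ^ i) * (1 - Q * q ^ i) * S0 i + (S0 (S i) * (1 - u * q ^ i) - q / D * (1 - / q ^ n * q ^ i) * (1 - Q * q ^ i) * S0 i)); [ring|].
  rewrite E. ring.
Qed.

(** For [i = 0] this is the q-Chu-Vandermonde sum.  Telescoping relates the sums for [i] and [S i],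
    and for [i = n] a single term survives. *)
Lemma vandermonde_newton (q Q D u : C) n i :
  q <> 0 -> (forall k, 1 - q ^ S k <> 0) -> D <> 0 -> (forall k, 1 - D * q ^ k <> 0) ->
  (forall k, 1 - u * q ^ k <> 0) -> (forall k, 1 - Q * q ^ k <> 0) ->
  Q = D * q ^ n / q * u ->
  csum (fun k => qpoch q (/ q ^ n) k * qpoch q Q k /
      (qpoch q q k * qpoch q D k) * q ^ k * newton q (q ^ k) i) (S n) =
  (- D) ^ n * q ^ (n * (n - 1) / 2) * qpoch q u n / qpoch q D n *
  ((q / D) ^ i * qpoch q (/ q ^ n) i * qpoch q Q i / qpoch q u i).
Proof.
  intros Hq Hqn HD HDn Hun HQn HQ.
  pose proof (fun i => vandermonde_newton_step q Q D u n i Hq Hqn HD HDn HQ) as St.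
  cbv zeta beta in St.
  set (S0 := fun i => csum (fun k => qpoch q (/ q ^ n) k * qpoch q Q k /
      (qpoch q q k * qpoch q D k) * q ^ k * newton q (q ^ k) i) (S n)).
  assert (Pq : forall i, qpoch q q i <> 0) by (apply qpoch_q_neq_0, Hqn).
  assert (Pu : forall i, qpoch q u i <> 0) by (intros; apply qpoch_neq_0; auto).
  assert (PQ : forall i, qpoch q Q i <> 0) by (intros; apply qpoch_neq_0; auto).
  assert (PD : forall i, qpoch q D i <> 0) by (intros; apply qpoch_neq_0; auto).
  assert (Hn : q ^ n <> 0) by (apply Cpow_nz, Hq).
  assert (Pn : qpoch q (/ q ^ n) n <> 0).
  { apply qpoch_neq_0. intros k Hk. pose proof (Hqn (n - k - 1)%nat) as H.
    replace (S (n - k - 1)) with (n - k)%nat in H by lia.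
    assert (Ek : q ^ n = q ^ (n - k) * q ^ k) by (rewrite <- Cpow_add_r; f_equal; lia).
    assert (q ^ k <> 0) by (apply Cpow_nz, Hq). assert (q ^ (n - k) <> 0) by (apply Cpow_nz, Hq).
    rewrite Ek. replace (/ (q ^ (n - k) * q ^ k) * q ^ k) with (/ q ^ (n - k)) by (field; split; assumption).
    intro E. apply H. replace (1 - q ^ (n - k)) with (- q ^ (n - k) * (1 - / q ^ (n - k))) by (field; assumption).
    rewrite E; ring. }
  assert (A : forall i, S0 i * qpoch q u i = (q / D) ^ i * qpoch q (/ q ^ n) i * qpoch q Q i * S0 O).
  { induction i0; [simpl; ring|].
    transitivity (S0 (S i0) * (1 - u * q ^ i0) * qpoch q u i0); [simpl; ring|].
    unfold S0 at 1. rewrite St. fold (S0 i0).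
    transitivity (q / D * (1 - / q ^ n * q ^ i0) * (1 - Q * q ^ i0) * (S0 i0 * qpoch q u i0)); [ring|].
    rewrite IHi0. simpl. ring. }
  assert (Top : S0 n = qpoch q (/ q ^ n) n * qpoch q Q n / (qpoch q q n * qpoch q D n) * q ^ n *
       (qpoch q q n * ((-(1)) ^ n * q ^ (n * (n - 1) / 2)))).
  { rewrite <- newton_diag by assumption. unfold S0. simpl csum.
    rewrite csum_zero; [ring|]. intros k Hk. rewrite newton_eq_0 by assumption. ring. }
  assert (S00 : S0 O = (- D) ^ n * q ^ (n * (n - 1) / 2) * qpoch q u n / qpoch q D n).
  { pose proof (A n) as E. rewrite Top in E.
    assert (Hp : (q / D) ^ n <> 0) by (apply Cpow_nz, Cmult_neq_0; [|apply Cinv_neq_0]; assumption).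
    assert (Hd : D ^ n <> 0) by (apply Cpow_nz; assumption).
    transitivity (/ ((q / D) ^ n * qpoch q (/ q ^ n) n * qpoch q Q n) *
       ((q / D) ^ n * qpoch q (/ q ^ n) n * qpoch q Q n * S0 0%nat)); [field; repeat split; auto|].
    rewrite <- E.
    unfold Cdiv. rewrite !Cpow_mult_l, Cpow_inv by assumption.
    replace (- D) with (- (1) * D) by ring. rewrite Cpow_mult_l.
    field. repeat split; auto. }
  fold (S0 i).
  transitivity (S0 i * qpoch q u i / qpoch q u i); [field; auto|].
  rewrite A, S00. field. auto.
Qed.

(** * Expansion in Askey-Wilson polynomials *)

(** Rational content of [awgam_recurrence] after division by [awgam q a b c d K m], with [P = q ^ m]
    and [Y = q ^ K] free; [r1] and [r2] are the successive ratios of coefficients in [m]. *)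
Lemma aw_connection_identity (a b c d q P Y : C) :
  a <> 0 -> q <> 0 ->
  1 - P * P / q * a * b * c * d <> 0 -> 1 - P * P * a * b * c * d <> 0 ->
  1 - P * P * q * a * b * c * d <> 0 -> 1 - P * P * q * q * a * b * c * d <> 0 ->
  1 - P * P * q * q * q * a * b * c * d <> 0 ->
  1 - q * P <> 0 -> 1 - q * q * P <> 0 ->
  1 - b * d * P <> 0 -> 1 - c * d * P <> 0 -> 1 - b * d * (q * P) <> 0 -> 1 - c * d * (q * P) <> 0 ->
  1 - a * b * c * d * Y <> 0 -> 1 - a * b * c * d * Y * P <> 0 -> 1 - a * b * c * d * Y * (q * P) <> 0 ->
  let M := a * b * c * d in
  let g := fun P => (1 - P * P * q * M) * (1 - P / q * M) * (1 - a * b * P) * (1 - a * c * P) * d /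
     ((1 - P * P / q * M) * (1 - q * P) * (1 - b * d * P) * (1 - c * d * P) * a) in
  let A := fun Q => (1 - a * b * Q) * (1 - a * c * Q) * (1 - a * d * Q) * (1 - Q / q * a * b * c * d) /
     (a * (1 - Q * Q / q * a * b * c * d) * (1 - Q * Q * a * b * c * d)) in
  let B := fun Q => a * (1 - Q) * (1 - b * c * Q / q) * (1 - b * d * Q / q) * (1 - c * d * Q / q) /
     ((1 - Q * Q / q / q * a * b * c * d) * (1 - Q * Q / q * a * b * c * d)) in
  let r1 := g P * ((Y - P) / (1 - M * Y * P)) in
  let r2 := g (q * P) * ((Y - q * P) / (1 - M * Y * (q * P))) in
  (1 - a * d * Y) * (1 - b * d * Y) * (1 - c * d * Y) / (1 - M * Y) *
    (g P * ((q * Y - 1) * P) * (1 - M * Y) / ((1 - M * Y * P) * (1 - M * Y * (q * P)))) =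
  (1 - a * d * Y) * (1 - d * Y / a) * r1 -
  d * Y * (A P - (A (q * P) + B (q * P)) * r1 + B (q * (q * P)) * (r1 * r2)).
Proof.
  intros Ha Hq H1 H2 H3 H4 H4b H5 H6 H7 H8 H9 H10 H11 H12 H13 M g A B r1 r2.
  subst r1 r2 g A B M. cbv beta.
  field. nzero.
Qed.

(** Connection coefficients of [awphi q d x K] in the Askey-Wilson polynomials with base [a]. The
    dependence on [K] is confined to the first and the last factor, and each of these has a limit as
    [K] grows. *)
Definition awgam (q a b c d : C) (K m : nat) : C :=
  qpoch q (a * d) K * qpoch q (b * d) K * qpoch q (c * d) K / qpoch q (a * b * c * d) K *
  ((1 - q ^ (2 * m) / q * a * b * c * d) *
   (qpoch q (/ q * a * b * c * d) m * qpoch q (a * b) m * qpoch q (a * c) m) /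
   ((1 - / q * a * b * c * d) * (qpoch q q m * qpoch q (b * d) m * qpoch q (c * d) m)) *
   (d / a) ^ m) *
  (newton q (q ^ K) m / qpoch q (a * b * c * d * q ^ K) m).

Record awok' (q a b c d : C) : Prop := {
  ok'_ok : awok q a b c d;
  ok'_bd : forall k, 1 - b * d * q ^ k <> 0;
  ok'_cd : forall k, 1 - c * d * q ^ k <> 0
}.

Lemma awok_M' (q a b c d : C) : awok q a b c d -> forall k, 1 - a * b * c * d * q ^ k <> 0.
Proof.
  intros H k E. apply (ok_M _ _ _ _ _ H (S k)). rewrite <- E, Cpow_S. field. apply H.
Qed.

Lemma awgam_eq_0 (q a b c d : C) K m : (K < m)%nat -> awgam q a b c d K m = 0.
Proof. intros H. unfold awgam. rewrite newton_eq_0 by assumption. unfold Cdiv; ring. Qed.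

Lemma awgam_S_r (q a b c d : C) K m : awok' q a b c d ->
  awgam q a b c d K (S m) = awgam q a b c d K m *
   ((1 - q ^ m * q ^ m * q * (a * b * c * d)) * (1 - q ^ m / q * (a * b * c * d)) *
    (1 - a * b * q ^ m) * (1 - a * c * q ^ m) * d /
    ((1 - q ^ m * q ^ m / q * (a * b * c * d)) * (1 - q * q ^ m) * (1 - b * d * q ^ m) *
     (1 - c * d * q ^ m) * a) * ((q ^ K - q ^ m) / (1 - a * b * c * d * q ^ K * q ^ m))).
Proof.
  intros [H Hbd Hcd].
  pose proof (awok_M' _ _ _ _ _ H) as HM.
  destruct (awok_even _ _ _ _ _ H m) as [H1 _].
  destruct H as [Hq Hqn Ha Hab Hac Had HM0].
  unfold awgam. rewrite !Cpow_double. simpl qpoch. rewrite !(Cpow_S q m). simpl newton. simpl (Cpow (d / a) _).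
  assert (qpoch q (a * b * c * d) K <> 0) by (apply qpoch_neq_0; auto).
  assert (qpoch q q m <> 0) by (apply qpoch_q_neq_0; auto).
  assert (qpoch q (b * d) m <> 0) by (apply qpoch_neq_0; auto).
  assert (qpoch q (c * d) m <> 0) by (apply qpoch_neq_0; auto).
  assert (HMm : forall k, 1 - a * b * c * d * q ^ K * q ^ k <> 0).
  { intros k. rewrite <- Cmult_assoc, <- Cpow_add_r. apply HM. }
  assert (qpoch q (a * b * c * d * q ^ K) m <> 0) by (apply qpoch_neq_0; auto).
  pose proof (HMm m). pose proof (Hqn m) as Hq7. rewrite Cpow_S in Hq7. pose proof (Hbd m). pose proof (Hcd m).
  pose proof (HM0 O) as HM00. simpl in HM00.
  field. nzero.
Qed.

Lemma awgam_S_l (q a b c d : C) K m : awok' q a b c d ->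
  awgam q a b c d (S K) (S m) = awgam q a b c d K m *
   ((1 - a * d * q ^ K) * (1 - b * d * q ^ K) * (1 - c * d * q ^ K) / (1 - a * b * c * d * q ^ K) *
   (((1 - q ^ m * q ^ m * q * (a * b * c * d)) * (1 - q ^ m / q * (a * b * c * d)) *
    (1 - a * b * q ^ m) * (1 - a * c * q ^ m) * d /
    ((1 - q ^ m * q ^ m / q * (a * b * c * d)) * (1 - q * q ^ m) * (1 - b * d * q ^ m) *
     (1 - c * d * q ^ m) * a)) * ((q * q ^ K - 1) * q ^ m) * (1 - a * b * c * d * q ^ K) /
     ((1 - a * b * c * d * q ^ K * q ^ m) * (1 - a * b * c * d * q ^ K * (q * q ^ m))))).
Proof.
  intros [H Hbd Hcd].
  pose proof (awok_M' _ _ _ _ _ H) as HM.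
  destruct (awok_even _ _ _ _ _ H m) as [H1 _].
  destruct H as [Hq Hqn Ha Hab Hac Had HM0].
  assert (HMm : forall k, 1 - a * b * c * d * q ^ K * q ^ k <> 0).
  { intros k. rewrite <- Cmult_assoc, <- Cpow_add_r. apply HM. }
  assert (E : qpoch q (a * b * c * d * q ^ S K) (S m) =
     qpoch q (a * b * c * d * q ^ K) m * (1 - a * b * c * d * q ^ K * q ^ m) *
     (1 - a * b * c * d * q ^ K * (q * q ^ m)) / (1 - a * b * c * d * q ^ K)).
  { pose proof (qpoch_shift q (a * b * c * d * q ^ K) (S m)) as E.
    replace (a * b * c * d * q ^ K * q) with (a * b * c * d * q ^ S K) in E by (simpl; ring).
    transitivity ((1 - a * b * c * d * q ^ K) * qpoch q (a * b * c * d * q ^ S K) (S m) / (1 - a * b * c * d * q ^ K)).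
    - field. apply HM.
    - rewrite <- E. simpl. field. apply HM. }
  unfold awgam. rewrite E. rewrite (Cpow_S q K), newton_shift, !Cpow_double. simpl qpoch.
  rewrite !(Cpow_S q m). simpl (Cpow (d / a) _).
  assert (qpoch q (a * b * c * d) K <> 0) by (apply qpoch_neq_0; auto).
  assert (qpoch q q m <> 0) by (apply qpoch_q_neq_0; auto).
  assert (qpoch q (b * d) m <> 0) by (apply qpoch_neq_0; auto).
  assert (qpoch q (c * d) m <> 0) by (apply qpoch_neq_0; auto).
  assert (qpoch q (a * b * c * d * q ^ K) m <> 0) by (apply qpoch_neq_0; auto).
  pose proof (HMm m). pose proof (HMm (S m)) as Hq6. rewrite Cpow_S in Hq6.
  pose proof (Hqn m) as Hq7. rewrite Cpow_S in Hq7. pose proof (Hbd m). pose proof (Hcd m). pose proof (HM K).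
  pose proof (HM0 O) as HM00. simpl in HM00.
  field. nzero.
Qed.

(** The factor that leads from [K] to [S K] is its value at [x = a] minus
    [d * q ^ K * (x + / x - a - / a)]; the three-term recurrence distributes the second part over
    neighbouring coefficients. Index 0 has no lower neighbour and is treated separately. *)
Lemma awgam_recurrence (q a b c d : C) K m : awok' q a b c d ->
  awgam q a b c d (S K) (S m) =
  (1 - a * d * q ^ K) * (1 - d * q ^ K / a) * awgam q a b c d K (S m) -
  d * q ^ K * (awA q a b c d m * awgam q a b c d K m -
     (awA q a b c d (S m) + awC q a b c d (S m)) * awgam q a b c d K (S m) +
     awC q a b c d (S (S m)) * awgam q a b c d K (S (S m))).
Proof.
  intros H'. pose proof H' as [H Hbd Hcd].
  rewrite (awgam_S_l _ _ _ _ _ _ _ H'), !(awgam_S_r _ _ _ _ _ _ _ H').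
  pose proof (awok_M' _ _ _ _ _ H) as HM.
  assert (HMm : forall k, 1 - a * b * c * d * q ^ K * q ^ k <> 0).
  { intros k. rewrite <- Cmult_assoc, <- Cpow_add_r. apply HM. }
  destruct H as [Hq Hqn Ha Hab Hac Had HM0].
  assert (Hm : forall k, 1 - q ^ m * q ^ m * q ^ k * a * b * c * d <> 0).
  { intros k. pose proof (HM (m + m + k)%nat) as E. rewrite !Cpow_add_r in E. nzero. }
  pose proof (aw_connection_identity a b c d q (q ^ m) (q ^ K) Ha Hq) as L. cbv zeta in L.
  unfold awA, awC. rewrite !Cpow_double, !(Cpow_S q (S m)), !(Cpow_S q m).
  set (G := awgam q a b c d K m).
  match type of L with _ -> _ -> _ -> _ -> _ -> _ -> _ -> _ -> _ -> _ -> _ -> _ -> _ -> _ -> ?l = ?r =>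
    transitivity (G * l); [ring|rewrite L; [|clear L..]] end.
  - unfold Cdiv. ring.
  - pose proof (HM0 (m + m)%nat) as E. rewrite Cpow_add_r in E. exact E.
  - pose proof (Hm O) as E. simpl in E. nzero.
  - pose proof (Hm 1%nat) as E. simpl in E. nzero.
  - pose proof (Hm 2%nat) as E. simpl in E. nzero.
  - pose proof (Hm 3%nat) as E. simpl in E. nzero.
  - exact (Hqn m).
  - pose proof (Hqn (S m)) as E. simpl in E. nzero.
  - apply Hbd.
  - apply Hcd.
  - exact (Hbd (S m)).
  - exact (Hcd (S m)).
  - apply HM.
  - apply HMm.
  - exact (HMm (S m)).
Qed.

Lemma aw_connection_identity_0 (a b c d q Y : C) :
  a <> 0 -> q <> 0 ->
  1 - 1 / q * (a * b * c * d) <> 0 -> 1 - a * b * c * d <> 0 ->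
  1 - q * (a * b * c * d) <> 0 -> 1 - q * q * (a * b * c * d) <> 0 ->
  1 - q <> 0 -> 1 - b * d <> 0 -> 1 - c * d <> 0 -> 1 - a * b * c * d * Y <> 0 ->
  let M := a * b * c * d in
  (1 - a * d * Y) * (1 - b * d * Y) * (1 - c * d * Y) / (1 - M * Y) =
  (1 - a * d * Y) * (1 - d * Y / a) -
  d * Y * (- ((1 - a * b) * (1 - a * c) * (1 - a * d) / (a * (1 - M))) +
    a * (1 - q) * (1 - b * c) * (1 - b * d) * (1 - c * d) / ((1 - M) * (1 - q * M)) *
    ((1 - q * M) * (1 - 1 / q * M) * (1 - a * b) * (1 - a * c) * d /
    ((1 - 1 / q * M) * (1 - q) * (1 - b * d) * (1 - c * d) * a) * ((Y - 1) / (1 - M * Y)))).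
Proof. intros Ha Hq H1 H2 H3 H4 H5 H6 H7 H8 M. subst M. field. nzero. Qed.

Lemma awgam_0 (q a b c d : C) K : awok q a b c d ->
  awgam q a b c d K 0 = qpoch q (a * d) K * qpoch q (b * d) K * qpoch q (c * d) K / qpoch q (a * b * c * d) K.
Proof.
  intros H. pose proof (awok_M' _ _ _ _ _ H) as HM.
  destruct H as [Hq Hqn Ha Hab Hac Had HM0].
  assert (qpoch q (a * b * c * d) K <> 0) by (apply qpoch_neq_0; auto).
  pose proof (HM0 O) as HM00. simpl in HM00.
  unfold awgam. simpl. field. nzero.
Qed.

Lemma awgam_recurrence_0 (q a b c d : C) K : awok' q a b c d ->
  awgam q a b c d (S K) 0 =
  (1 - a * d * q ^ K) * (1 - d * q ^ K / a) * awgam q a b c d K 0 -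
  d * q ^ K * (- awA q a b c d 0 * awgam q a b c d K 0 +
     awC q a b c d 1 * awgam q a b c d K 1).
Proof.
  intros H'. pose proof H' as [H Hbd Hcd].
  rewrite (awA_0 _ _ _ _ _ H), (awgam_S_r _ _ _ _ _ _ _ H'), !(awgam_0 _ _ _ _ _ _ H).
  pose proof (awok_M' _ _ _ _ _ H) as HM.
  destruct H as [Hq Hqn Ha Hab Hac Had HM0].
  pose proof (aw_connection_identity_0 a b c d q (q ^ K) Ha Hq) as L. cbv zeta in L.
  pose proof (HM O) as K1. pose proof (HM 1%nat) as K2. pose proof (HM 2%nat) as K3.
  pose proof (HM0 O) as K4. pose proof (Hqn O) as K5. pose proof (Hbd O) as K6. pose proof (Hcd O) as K7.
  pose proof (HM K) as K8.
  assert (Kq : qpoch q (a * b * c * d) K <> 0) by (apply qpoch_neq_0; auto).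
  simpl in K1, K2, K3, K4, K5, K6, K7.
  set (G := qpoch q (a * d) K * qpoch q (b * d) K * qpoch q (c * d) K / qpoch q (a * b * c * d) K).
  match type of L with _ -> _ -> _ -> _ -> _ -> _ -> _ -> _ -> ?l = ?r =>
    transitivity (G * l); [|rewrite L; [|nzero..]] end.
  - unfold G. simpl. field. nzero.
  - unfold awC. replace (1 - q ^ (2 * 1) / q / q * a * b * c * d) with (1 - a * b * c * d) by (simpl; field; assumption).
    replace (1 - q ^ (2 * 1) / q * a * b * c * d) with (1 - q * (a * b * c * d)) by (simpl; field; assumption).
    replace (b * c * q ^ 1 / q) with (b * c) by (simpl; field; assumption).
    replace (b * d * q ^ 1 / q) with (b * d) by (simpl; field; assumption).
    replace (c * d * q ^ 1 / q) with (c * d) by (simpl; field; assumption).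
    simpl Cpow. unfold Cdiv. rewrite ?Cmult_1_r, ?Cmult_1_l. ring.
Qed.

Lemma awphi_expansion (q a b c d : C) K (x : C) : awok' q a b c d -> x <> 0 ->
  awphi q d x K = csum (fun m => awgam q a b c d K m * awE q a b c d m x) (S K).
Proof.
  intros H' Hx. pose proof H' as [H Hbd Hcd].
  pose proof (ok_a _ _ _ _ _ H) as Ha.
  induction K.
  - simpl csum. rewrite awE_0, (awgam_0 _ _ _ _ _ _ H). unfold awphi. simpl. field.
  - set (Y := q ^ K).
    assert (E : awphi q d x (S K) = awphi q d x K * (1 + d * d * Y * Y - d * Y * (x + / x))).
    { unfold awphi. simpl. fold Y. field. assumption. }
    rewrite E, IHK.
    rewrite <- (csum_extend _ (S K) (S (S K))) by (lia || (intros k Hk; rewrite awgam_eq_0 by lia; ring)).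
    rewrite Cmult_comm, <- csum_scal.
    set (e := fun m => awE q a b c d m x).
    set (g := awgam q a b c d K). set (g' := awgam q a b c d (S K)).
    set (A := awA q a b c d). set (B := awC q a b c d).
    (* The recurrence reaches both neighbours, so a partial sum has two boundary terms. At [j = S K]
       both vanish, because the coefficients with index above [K] do. *)
    assert (T : forall j, csum (fun m => (1 + d * d * Y * Y - d * Y * (x + / x)) * (g m * e m)) (S j) =
      csum (fun m => g' m * e m) (S j) - d * Y * A j * g j * e (S j) + d * Y * B (S j) * g (S j) * e j).
    { assert (TT : forall m, (1 + d * d * Y * Y - d * Y * (x + / x)) * (g m * e m) =
          (1 - a * d * Y) * (1 - d * Y / a) * g m * e m - d * Y * g m *
            (A m * e (S m) - (A m + B m) * e m + B m * e (pred m))).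
      { intros m. pose proof (awE_recurrence q a b c d m x H Hx) as R. unfold awB in R.
        fold A B in R. change (awE q a b c d m x) with (e m) in R.
        change (awE q a b c d (S m) x) with (e (S m)) in R.
        change (awE q a b c d (pred m) x) with (e (pred m)) in R.
        transitivity ((1 + d * d * Y * Y) * g m * e m - d * Y * g m * ((x + / x) * e m)); [ring|].
        rewrite R. field. assumption. }
      pose proof (awgam_recurrence_0 q a b c d K H') as R0.
      pose proof (fun m => awgam_recurrence q a b c d K m H') as R1.
      fold g g' Y A B in R0. cbv beta in R1.
      assert (R2 : forall m, g' (S m) = (1 - a * d * Y) * (1 - d * Y / a) * g (S m) -
         d * Y * (A m * g m - (A (S m) + B (S m)) * g (S m) + B (S (S m)) * g (S (S m)))) by exact R1.
      induction j.
      - simpl csum. rewrite TT, R0. replace (B O) with (RtoC 0) by (symmetry; apply awC_0). simpl pred. ring.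
      - change (csum ?f (S (S j))) with (csum f (S j) + f (S j)). cbv beta. rewrite IHj, TT, R2.
        simpl pred. ring. }
    rewrite T.
    assert (Z1 : g (S K) = 0) by (apply awgam_eq_0; lia).
    assert (Z2 : g (S (S K)) = 0) by (apply awgam_eq_0; lia).
    rewrite Z1, Z2. unfold g', e. ring.
Qed.

Lemma csum_mult_sums (f g : nat -> C) n m :
  csum (fun i => csum (fun j => f i * g j) m) n = csum f n * csum g m.
Proof.
  rewrite (csum_ext _ (fun i => csum g m * f i)).
  - rewrite csum_scal. ring.
  - intros i _. rewrite csum_scal. ring.
Qed.

(** [qpoch_add_newton] separates the two summations, each of which is then a
    [vandermonde_newton] sum. *)
Lemma aw_double_sum (q C0 D1 D2 u1 u2 Q1 Q2 : C) n m :
  q <> 0 -> (forall k, 1 - q ^ S k <> 0) -> C0 <> 0 -> D1 <> 0 -> D2 <> 0 ->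
  (forall k, 1 - C0 * q ^ k <> 0) -> (forall k, 1 - D1 * q ^ k <> 0) -> (forall k, 1 - D2 * q ^ k <> 0) ->
  (forall k, 1 - u1 * q ^ k <> 0) -> (forall k, 1 - u2 * q ^ k <> 0) ->
  (forall k, 1 - Q1 * q ^ k <> 0) -> (forall k, 1 - Q2 * q ^ k <> 0) ->
  Q1 = D1 * q ^ n / q * u1 -> Q2 = D2 * q ^ m / q * u2 -> D1 * D2 = C0 * q ->
  csum (fun k => csum (fun j =>
     qpoch q (/ q ^ n) k * qpoch q Q1 k / (qpoch q q k * qpoch q D1 k) * q ^ k *
     (qpoch q (/ q ^ m) j * qpoch q Q2 j / (qpoch q q j * qpoch q D2 j) * q ^ j) *
     (qpoch q C0 (j + k) / (qpoch q C0 j * qpoch q C0 k))) (S m)) (S n) =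
  (- D1) ^ n * q ^ (n * (n - 1) / 2) * qpoch q u1 n / qpoch q D1 n *
  ((- D2) ^ m * q ^ (m * (m - 1) / 2) * qpoch q u2 m / qpoch q D2 m) *
  csum (fun i => qpoch q (/ q ^ n) i * qpoch q Q1 i * (qpoch q Q2 i * qpoch q (/ q ^ m) i) /
     (qpoch q q i * qpoch q C0 i * qpoch q u1 i * qpoch q u2 i) * q ^ i) (S n).
Proof.
  intros Hq Hqn HC HD1 HD2 HCk HD1k HD2k Hu1 Hu2 HQ1 HQ2 EQ1 EQ2 ED.
  assert (Pq : forall i, qpoch q q i <> 0) by (apply qpoch_q_neq_0, Hqn).
  assert (PC : forall i, qpoch q C0 i <> 0) by (intros; apply qpoch_neq_0; auto).
  assert (Pu1 : forall i, qpoch q u1 i <> 0) by (intros; apply qpoch_neq_0; auto).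
  assert (Pu2 : forall i, qpoch q u2 i <> 0) by (intros; apply qpoch_neq_0; auto).
  set (al := fun k => qpoch q (/ q ^ n) k * qpoch q Q1 k / (qpoch q q k * qpoch q D1 k) * q ^ k).
  set (be := fun j => qpoch q (/ q ^ m) j * qpoch q Q2 j / (qpoch q q j * qpoch q D2 j) * q ^ j).
  set (W := fun i => C0 ^ i / (qpoch q q i * qpoch q C0 i)).
  transitivity (csum (fun i => W i *
     (csum (fun k => al k * newton q (q ^ k) i) (S n) *
      csum (fun j => be j * newton q (q ^ j) i) (S m))) (S n)).
  - transitivity (csum (fun k => csum (fun j => csum (fun i =>
       W i * ((al k * newton q (q ^ k) i) * (be j * newton q (q ^ j) i))) (S n)) (S m)) (S n)).
    + apply csum_ext. intros k Hk. apply csum_ext. intros j _.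
      rewrite (qpoch_add_newton q C0 j k (S n) Hqn HCk HC) by assumption.
      fold (al k) (be j).
      transitivity (al k * be j * csum (fun i => W i * newton q (q ^ j) i * newton q (q ^ k) i) (S n)).
      * unfold W. field. split; auto.
      * rewrite <- csum_scal. apply csum_ext. intros; ring.
    + rewrite (csum_ext _ (fun k => csum (fun i => csum (fun j =>
         W i * ((al k * newton q (q ^ k) i) * (be j * newton q (q ^ j) i))) (S m)) (S n)))
        by (intros; apply csum_swap).
      rewrite csum_swap. apply csum_ext. intros i _.
      rewrite <- csum_mult_sums, <- csum_scal. apply csum_ext. intros k _.
      rewrite <- csum_scal. reflexivity.
  - rewrite <- csum_scal. apply csum_ext. intros i _.
    unfold al, be. rewrite (vandermonde_newton q Q1 D1 u1 n i), (vandermonde_newton q Q2 D2 u2 m i) by assumption.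
    (* By [D1 * D2 = C0 * q] the three powers with exponent [i] collapse to [q ^ i], so the
       surviving sum is again a terminating 4phi3 with argument [q]. *)
    assert (EW : W i * ((q / D1) ^ i * (q / D2) ^ i) = q ^ i / (qpoch q q i * qpoch q C0 i)).
    { unfold W. rewrite <- Cpow_mult_l.
      replace (q / D1 * (q / D2)) with (q * / C0).
      - rewrite Cpow_mult_l, Cpow_inv by assumption. pose proof (Cpow_nz C0 i HC).
        field. repeat split; auto.
      - transitivity (q * q / (D1 * D2)); [rewrite ED|]; field; auto. }
    transitivity (W i * ((q / D1) ^ i * (q / D2) ^ i) *
      ((- D1) ^ n * q ^ (n * (n - 1) / 2) * qpoch q u1 n / qpoch q D1 n *
       ((- D2) ^ m * q ^ (m * (m - 1) / 2) * qpoch q u2 m / qpoch q D2 m)) *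
      (qpoch q (/ q ^ n) i * qpoch q Q1 i / qpoch q u1 i * (qpoch q (/ q ^ m) i * qpoch q Q2 i / qpoch q u2 i))).
    + unfold Cdiv. ring.
    + rewrite EW. assert (qpoch q D1 n <> 0) by (apply qpoch_neq_0; auto).
      assert (qpoch q D2 m <> 0) by (apply qpoch_neq_0; auto).
      field. repeat split; auto.
Qed.

(** * Convergence and infinite q-products *)

(** [Clim] and [CSeries] are total and return default values where no limit exists. Convergence is
    therefore proved in this relational form and transferred by [cvg_Clim] and [cvg_CSeries]. *)
Definition cvg (u : nat -> C) (l : C) : Prop :=
  forall eps : R, (0 < eps)%R -> exists N : nat, forall n, (N <= n)%nat -> (Cmod (u n - l) < eps)%R.

Lemma im_le_Cmod (z : C) : (Rabs (Im z) <= Cmod z)%R.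
Proof.
  pose proof (Rmax_Cmod z) as H. apply Rle_trans with (2 := H). apply Rmax_r.
Qed.

Lemma cvg_Re (u : nat -> C) (l : C) : cvg u l -> is_lim_seq (fun n => Re (u n)) (Re l).
Proof.
  intros H. apply is_lim_seq_spec. intros eps. destruct (H eps (cond_pos eps)) as [N HN].
  exists N. intros n Hn. apply Rle_lt_trans with (2 := HN n Hn).
  exact (re_le_Cmod (u n - l)).
Qed.

Lemma cvg_Im (u : nat -> C) (l : C) : cvg u l -> is_lim_seq (fun n => Im (u n)) (Im l).
Proof.
  intros H. apply is_lim_seq_spec. intros eps. destruct (H eps (cond_pos eps)) as [N HN].
  exists N. intros n Hn. apply Rle_lt_trans with (2 := HN n Hn).
  exact (im_le_Cmod (u n - l)).
Qed.

Lemma cvg_Clim (u : nat -> C) (l : C) : cvg u l -> Clim u = l.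
Proof.
  intros H. unfold Clim.
  rewrite (is_lim_seq_unique _ _ (cvg_Re u l H)), (is_lim_seq_unique _ _ (cvg_Im u l H)).
  destruct l; reflexivity.
Qed.

Lemma cvg_unique (u : nat -> C) (l l' : C) : cvg u l -> cvg u l' -> l = l'.
Proof. intros H H'. rewrite <- (cvg_Clim u l H). apply cvg_Clim, H'. Qed.

Lemma cvg_ext_loc (u v : nat -> C) (l : C) N :
  (forall n, (N <= n)%nat -> u n = v n) -> cvg u l -> cvg v l.
Proof.
  intros E H eps He. destruct (H eps He) as [N' HN]. exists (max N N').
  intros n Hn. rewrite <- E by lia. apply HN. lia.
Qed.

Lemma cvg_ext (u v : nat -> C) (l : C) : (forall n, u n = v n) -> cvg u l -> cvg v l.
Proof. intros E. apply cvg_ext_loc with O. auto. Qed.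

Lemma cvg_const (c : C) : cvg (fun _ => c) c.
Proof.
  intros eps He. exists O. intros. replace (c - c) with (RtoC 0) by ring. now rewrite Cmod_0.
Qed.

Lemma cvg_plus (u v : nat -> C) (l l' : C) : cvg u l -> cvg v l' -> cvg (fun n => u n + v n) (l + l').
Proof.
  intros H H' eps He. destruct (H (eps / 2)%R) as [N HN]; [lra|].
  destruct (H' (eps / 2)%R) as [N' HN']; [lra|]. exists (max N N'). intros n Hn.
  replace (u n + v n - (l + l')) with ((u n - l) + (v n - l')) by ring.
  eapply Rle_lt_trans; [apply Cmod_triangle|].
  specialize (HN n ltac:(lia)). specialize (HN' n ltac:(lia)). lra.
Qed.

Lemma cvg_bounded (u : nat -> C) (l : C) : cvg u l ->
  exists N B, (0 < B)%R /\ forall n, (N <= n)%nat -> (Cmod (u n) <= B)%R.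
Proof.
  intros H. destruct (H 1%R Rlt_0_1) as [N HN]. exists N, (Cmod l + 1)%R. split.
  - pose proof (Cmod_ge_0 l); lra.
  - intros n Hn. specialize (HN n Hn).
    replace (u n) with (l + (u n - l)) by ring. pose proof (Cmod_triangle l (u n - l)). lra.
Qed.

Lemma cvg_0_mult_bounded (u v : nat -> C) B : cvg u 0 ->
  (forall n, (Cmod (v n) <= B)%R) -> cvg (fun n => u n * v n) 0.
Proof.
  intros H HB eps He. pose proof (Rle_trans _ _ _ (Cmod_ge_0 _) (HB O)) as HB0.
  destruct (H (eps / (B + 1))%R) as [N HN]; [apply Rdiv_lt_0_compat; lra|].
  exists N. intros n Hn. specialize (HN n Hn).
  replace (u n * v n - 0) with ((u n - 0) * v n) by ring. rewrite Cmod_mult.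
  apply Rle_lt_trans with (Cmod (u n - 0) * (B + 1))%R.
  - apply Rmult_le_compat_l; [apply Cmod_ge_0|]. specialize (HB n); lra.
  - apply Rmult_lt_compat_r with (r := (B + 1)%R) in HN; [|lra].
    replace (eps / (B + 1) * (B + 1))%R with eps in HN by (field; lra). exact HN.
Qed.

Lemma cvg_minus_0 (u : nat -> C) (l : C) : cvg u l <-> cvg (fun n => u n - l) 0.
Proof.
  split; intros H eps He; destruct (H eps He) as [N HN]; exists N; intros n Hn; specialize (HN n Hn);
  replace (u n - l - 0) with (u n - l) in * by ring; assumption.
Qed.

Lemma cvg_mult (u v : nat -> C) (l l' : C) : cvg u l -> cvg v l' -> cvg (fun n => u n * v n) (l * l').
Proof.
  intros H H'. destruct (cvg_bounded _ _ H') as (N & B & HB & HBn).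
  apply cvg_minus_0.
  (* The bound on [v] holds from rank [N] on; earlier values are replaced by 0. *)
  apply cvg_ext_loc with (fun n => (u n - l) * (if le_dec N n then v n else 0) + (v n - l') * l) N.
  - intros n Hn. destruct (le_dec N n); [ring|contradiction].
  - cut (cvg (fun n => (u n - l) * (if le_dec N n then v n else 0) + (v n - l') * l) (0 + 0)).
    { rewrite Cplus_0_l. auto. }
    apply cvg_plus.
    + apply cvg_0_mult_bounded with B; [now apply -> cvg_minus_0|].
      intros n. destruct (le_dec N n); [auto|]. rewrite Cmod_0. lra.
    + apply cvg_0_mult_bounded with (Cmod l); [now apply -> cvg_minus_0|]. intros; lra.
Qed.

Lemma cvg_scal (c : C) (u : nat -> C) (l : C) : cvg u l -> cvg (fun n => c * u n) (c * l).
Proof. intros H. apply cvg_mult; [apply cvg_const|exact H]. Qed.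

Lemma cvg_inv (u : nat -> C) (l : C) : l <> 0 -> cvg u l -> cvg (fun n => / u n) (/ l).
Proof.
  intros Hl H. pose proof (proj1 (Cmod_gt_0 l) Hl) as Hl'. intros eps He.
  destruct (H (Rmin (Cmod l / 2) (eps * (Cmod l * Cmod l) / 2))%R) as [N HN].
  { apply Rmin_pos; [lra|]. apply Rdiv_lt_0_compat; [|lra]. repeat apply Rmult_lt_0_compat; lra. }
  exists N. intros n Hn. specialize (HN n Hn).
  pose proof (Rmin_l (Cmod l / 2) (eps * (Cmod l * Cmod l) / 2)) as M1.
  pose proof (Rmin_r (Cmod l / 2) (eps * (Cmod l * Cmod l) / 2)) as M2.
  assert (Hu : (Cmod l / 2 < Cmod (u n))%R).
  { pose proof (Cmod_triangle (u n) (l - u n)) as T. replace (u n + (l - u n)) with l in T by ring.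
    replace (l - u n) with (- (u n - l)) in T by ring. rewrite Cmod_opp in T. lra. }
  assert (Hun : u n <> 0) by (apply Cmod_gt_0; lra).
  replace (/ u n - / l) with (- (u n - l) * / (u n * l)) by (field; split; assumption).
  rewrite Cmod_mult, Cmod_opp, Cmod_inv, Cmod_mult by (apply Cmult_neq_0; assumption).
  assert (P : (0 < Cmod (u n) * Cmod l)%R) by (apply Rmult_lt_0_compat; lra).
  apply Rmult_lt_reg_r with (1 := P). rewrite Rmult_assoc, Rinv_l, Rmult_1_r by lra.
  apply Rlt_le_trans with (eps * (Cmod l * Cmod l) / 2)%R; [lra|].
  replace (eps * (Cmod l * Cmod l) / 2)%R with (eps * (Cmod l / 2 * Cmod l))%R by field.
  apply Rmult_le_compat_l; [lra|]. apply Rmult_le_compat_r; lra.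
Qed.

Lemma cvg_cauchy (u : nat -> C) :
  (forall eps : R, (0 < eps)%R -> exists N, forall n m, (N <= n)%nat -> (N <= m)%nat ->
     (Cmod (u n - u m) < eps)%R) -> exists l, cvg u l.
Proof.
  intros H.
  assert (HR : ex_finite_lim_seq (fun n => Re (u n))).
  { apply ex_lim_seq_cauchy_corr. intros eps. destruct (H eps (cond_pos eps)) as [N HN].
    exists N. intros n m Hn Hm. apply Rle_lt_trans with (2 := HN n m Hn Hm). exact (re_le_Cmod (u n - u m)). }
  assert (HI : ex_finite_lim_seq (fun n => Im (u n))).
  { apply ex_lim_seq_cauchy_corr. intros eps. destruct (H eps (cond_pos eps)) as [N HN].
    exists N. intros n m Hn Hm. apply Rle_lt_trans with (2 := HN n m Hn Hm). exact (im_le_Cmod (u n - u m)). }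
  destruct HR as [r Hr]. destruct HI as [i Hi]. exists (r, i). intros eps He.
  apply is_lim_seq_spec in Hr. apply is_lim_seq_spec in Hi.
  destruct (Hr (mkposreal (eps / 2) ltac:(lra))) as [N1 H1].
  destruct (Hi (mkposreal (eps / 2) ltac:(lra))) as [N2 H2]. simpl in H1, H2.
  exists (max N1 N2). intros n Hn. specialize (H1 n ltac:(lia)). specialize (H2 n ltac:(lia)).
  assert (E : u n - (r, i) = RtoC (Re (u n) - r) + Ci * RtoC (Im (u n) - i)).
  { destruct (u n) as [x y]. unfold Cminus, Cplus, Copp, Cmult, RtoC, Ci, Re, Im. simpl. f_equal; ring. }
  rewrite E. eapply Rle_lt_trans; [apply Cmod_triangle|].
  rewrite Cmod_mult, Cmod_Ci, !Cmod_R. lra.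
Qed.

Lemma cvg_le (u : nat -> C) (l : C) (B : R) N : cvg u l ->
  (forall n, (N <= n)%nat -> (Cmod (u n) <= B)%R) -> (Cmod l <= B)%R.
Proof.
  intros H HB. apply Rnot_lt_le. intros Hlt.
  destruct (H (Cmod l - B)%R) as [N' HN]; [lra|].
  specialize (HN (max N N') ltac:(lia)). specialize (HB (max N N') ltac:(lia)).
  pose proof (Cmod_triangle (u (max N N')) (l - u (max N N'))) as T.
  replace (u (max N N') + (l - u (max N N'))) with l in T by ring.
  replace (l - u (max N N')) with (- (u (max N N') - l)) in T by ring. rewrite Cmod_opp in T. lra.
Qed.

Lemma cvg_ge (u : nat -> C) (l : C) (B : R) N : cvg u l ->
  (forall n, (N <= n)%nat -> (B <= Cmod (u n))%R) -> (B <= Cmod l)%R.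
Proof.
  intros H HB. apply Rnot_lt_le. intros Hlt.
  destruct (H (B - Cmod l)%R) as [N' HN]; [lra|].
  specialize (HN (max N N') ltac:(lia)). specialize (HB (max N N') ltac:(lia)).
  pose proof (Cmod_triangle l (u (max N N') - l)) as T.
  replace (l + (u (max N N') - l)) with (u (max N N')) in T by ring. lra.
Qed.

(** * Infinite q-shifted factorials: rates, bounds and nonvanishing *)

Lemma pow_q_small (q0 : R) : (0 < q0 < 1)%R -> forall (c eps : R), (0 <= c)%R -> (0 < eps)%R ->
  exists N : nat, forall n, (N <= n)%nat -> (c * q0 ^ n < eps)%R.
Proof.
  intros Hq c eps Hc He.
  destruct (pow_lt_1_zero q0) with (y := (eps / (c + 1))%R) as [N HN].
  - rewrite Rabs_pos_eq; lra.
  - apply Rdiv_lt_0_compat; lra.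
  - exists N. intros n Hn. specialize (HN n Hn).
    assert (0 < q0 ^ n)%R by (apply pow_lt; lra). rewrite Rabs_pos_eq in HN by lra.
    apply Rle_lt_trans with ((c + 1) * q0 ^ n)%R.
    + apply Rmult_le_compat_r; lra.
    + apply Rmult_lt_compat_l with (r := (c + 1)%R) in HN; [|lra].
      replace ((c + 1) * (eps / (c + 1)))%R with eps in HN by (field; lra). exact HN.
Qed.

(** From [1 + y <= exp y], the product of the factors [1 + M * q0 ^ k] is at most the exponential of
    a geometric series. *)
Definition qbound (q0 M : R) : R := exp (M / (1 - q0)).

Lemma Cmod_q (q0 : R) n : (0 < q0 < 1)%R -> Cmod (RtoC q0 ^ n) = (q0 ^ n)%R.
Proof. intros H. rewrite Cmod_pow, Cmod_R, Rabs_pos_eq; lra. Qed.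

Lemma qpoch_bound (q0 M : R) (x : C) k : (0 < q0 < 1)%R -> (Cmod x <= M)%R ->
  (Cmod (qpoch q0 x k) <= qbound q0 M)%R.
Proof.
  intros Hq HM. pose proof (Rle_trans _ _ _ (Cmod_ge_0 _) HM) as HM0.
  assert (H : (Cmod (qpoch q0 x k) <= exp (M * ((1 - q0 ^ k) / (1 - q0))))%R).
  { induction k.
    - simpl. rewrite Cmod_1. replace (M * ((1 - 1) / (1 - q0)))%R with 0%R by (field; lra).
      rewrite exp_0. lra.
    - simpl qpoch. rewrite Cmod_mult.
      replace (M * ((1 - q0 ^ S k) / (1 - q0)))%R with
        (M * ((1 - q0 ^ k) / (1 - q0)) + M * q0 ^ k)%R by (simpl; field; lra).
      rewrite exp_plus. apply Rmult_le_compat; try apply Cmod_ge_0; [exact IHk|].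
      apply Rle_trans with (1 + M * q0 ^ k)%R; [|apply exp_ineq1_le].
      unfold Cminus. eapply Rle_trans; [apply Cmod_triangle|].
      rewrite Cmod_1, Cmod_opp, Cmod_mult, Cmod_q by assumption.
      apply Rplus_le_compat_l, Rmult_le_compat_r; [apply pow_le; lra|exact HM]. }
  apply Rle_trans with (1 := H). unfold qbound.
  assert (E : (M * ((1 - q0 ^ k) / (1 - q0)) <= M / (1 - q0))%R).
  { unfold Rdiv. rewrite <- Rmult_assoc. apply Rmult_le_compat_r.
    - left; apply Rinv_0_lt_compat; lra.
    - assert (0 < q0 ^ k)%R by (apply pow_lt; lra). nra. }
  destruct (Rle_lt_or_eq_dec _ _ E) as [L|L]; [left; now apply exp_increasing|rewrite L; lra].
Qed.

(** Telescoping gives a geometric rate that is uniform on [Cmod x <= M]. It yields the existence of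
    the infinite product and its uniform convergence along the contour. *)
Lemma qpoch_diff (q0 M : R) (x : C) n k : (0 < q0 < 1)%R -> (Cmod x <= M)%R ->
  (Cmod (qpoch q0 x (n + k) - qpoch q0 x n) <= qbound q0 M * M / (1 - q0) * q0 ^ n)%R.
Proof.
  intros Hq HM. pose proof (Rle_trans _ _ _ (Cmod_ge_0 _) HM) as HM0.
  assert (HB : (0 < qbound q0 M)%R) by apply exp_pos.
  assert (H : (Cmod (qpoch q0 x (n + k) - qpoch q0 x n) <=
     qbound q0 M * M / (1 - q0) * (q0 ^ n - q0 ^ (n + k)))%R).
  { induction k.
    - rewrite Nat.add_0_r. replace (qpoch q0 x n - qpoch q0 x n) with (RtoC 0) by ring.
      rewrite Cmod_0. lra.
    - rewrite Nat.add_succ_r. simpl qpoch.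
      replace (qpoch q0 x (n + k) * (1 - x * RtoC q0 ^ (n + k)) - qpoch q0 x n)
        with (qpoch q0 x (n + k) - qpoch q0 x n + - (qpoch q0 x (n + k) * (x * RtoC q0 ^ (n + k)))) by ring.
      eapply Rle_trans; [apply Cmod_triangle|].
      replace (qbound q0 M * M / (1 - q0) * (q0 ^ n - q0 ^ S (n + k)))%R with
        (qbound q0 M * M / (1 - q0) * (q0 ^ n - q0 ^ (n + k)) + qbound q0 M * (M * q0 ^ (n + k)))%R
        by (simpl; field; lra).
      apply Rplus_le_compat; [exact IHk|].
      rewrite Cmod_opp, !Cmod_mult, Cmod_q by assumption.
      apply Rmult_le_compat; [apply Cmod_ge_0| |now apply qpoch_bound|].
      + apply Rmult_le_pos; [apply Cmod_ge_0|apply pow_le; lra].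
      + apply Rmult_le_compat_r; [apply pow_le; lra|exact HM]. }
  apply Rle_trans with (1 := H). apply Rmult_le_compat_l.
  - apply Rmult_le_pos; [apply Rmult_le_pos; lra|left; apply Rinv_0_lt_compat; lra].
  - assert (0 < q0 ^ (n + k))%R by (apply pow_lt; lra). lra.
Qed.

Lemma qpoch_cvg (q0 : R) (x : C) : (0 < q0 < 1)%R -> cvg (qpoch q0 x) (qpoch_inf q0 x).
Proof.
  intros Hq. assert (H : exists l, cvg (qpoch q0 x) l).
  { apply cvg_cauchy. intros eps He.
    set (K := (qbound q0 (Cmod x) * Cmod x / (1 - q0))%R).
    assert (HK : (0 <= K)%R).
    { apply Rmult_le_pos; [apply Rmult_le_pos; [left; apply exp_pos|apply Cmod_ge_0]|].
      left; apply Rinv_0_lt_compat; lra. }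
    destruct (pow_q_small q0 Hq K (eps / 2)) as [N HN]; [exact HK|lra|].
    exists N. intros n m Hn Hm.
    pose proof (qpoch_diff q0 (Cmod x) x N (n - N) Hq (Rle_refl _)) as D1.
    pose proof (qpoch_diff q0 (Cmod x) x N (m - N) Hq (Rle_refl _)) as D2.
    replace (N + (n - N))%nat with n in D1 by lia. replace (N + (m - N))%nat with m in D2 by lia.
    specialize (HN N (Nat.le_refl _)). fold K in D1, D2.
    replace (qpoch q0 x n - qpoch q0 x m) with ((qpoch q0 x n - qpoch q0 x N) + - (qpoch q0 x m - qpoch q0 x N)) by ring.
    eapply Rle_lt_trans; [apply Cmod_triangle|]. rewrite Cmod_opp. lra. }
  destruct H as [l Hl]. unfold qpoch_inf. rewrite (cvg_Clim _ _ Hl). exact Hl.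
Qed.

Lemma cvg_shift (u : nat -> C) (l : C) k : cvg u l -> cvg (fun n => u (k + n)%nat) l.
Proof. intros H eps He. destruct (H eps He) as [N HN]. exists N. intros n Hn. apply HN. lia. Qed.

Lemma qpoch_inf_diff (q0 M : R) (x : C) n : (0 < q0 < 1)%R -> (Cmod x <= M)%R ->
  (Cmod (qpoch_inf q0 x - qpoch q0 x n) <= qbound q0 M * M / (1 - q0) * q0 ^ n)%R.
Proof.
  intros Hq HM.
  apply cvg_le with (u := fun k => qpoch q0 x (n + k) - qpoch q0 x n) (N := O).
  - apply (cvg_plus (fun k => qpoch q0 x (n + k)) (fun _ => - qpoch q0 x n)); [|apply cvg_const].
    apply cvg_shift, qpoch_cvg, Hq.
  - intros k _. now apply qpoch_diff.
Qed.

Lemma qpoch_inf_split (q0 : R) (x : C) k : (0 < q0 < 1)%R ->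
  qpoch_inf q0 x = qpoch q0 x k * qpoch_inf q0 (x * RtoC q0 ^ k).
Proof.
  intros Hq. apply cvg_unique with (fun n => qpoch q0 x (k + n)).
  - apply cvg_shift, qpoch_cvg, Hq.
  - apply cvg_ext with (fun n => qpoch q0 x k * qpoch q0 (x * RtoC q0 ^ k) n).
    + intros n. symmetry. apply qpoch_add.
    + apply cvg_scal, qpoch_cvg, Hq.
Qed.

Lemma qpoch_inf_step (q0 : R) (x : C) : (0 < q0 < 1)%R ->
  qpoch_inf q0 x = (1 - x) * qpoch_inf q0 (x * q0).
Proof.
  intros Hq. rewrite (qpoch_inf_split q0 x 1 Hq). simpl. rewrite !Cmult_1_r, Cmult_1_l. reflexivity.
Qed.

Lemma qpoch_inf_bound (q0 M : R) (x : C) : (0 < q0 < 1)%R -> (Cmod x <= M)%R ->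
  (Cmod (qpoch_inf q0 x) <= qbound q0 M)%R.
Proof.
  intros Hq HM. apply cvg_le with (u := qpoch q0 x) (N := O); [now apply qpoch_cvg|].
  intros; now apply qpoch_bound.
Qed.

(** [qpoch_diff] from [n = 0] bounds the distance of the product from 1, and [d] is chosen to make
    this at most 1/2. *)
Lemma qpoch_small (q0 : R) : (0 < q0 < 1)%R -> exists d : R, (0 < d)%R /\
  forall x : C, (Cmod x <= d)%R -> forall k, (1 / 2 <= Cmod (qpoch q0 x k))%R.
Proof.
  intros Hq. pose proof (exp_pos (1 / (1 - q0))) as HB. fold (qbound q0 1) in HB.
  set (d := Rmin 1 ((1 - q0) / (2 * qbound q0 1))).
  assert (Hd : (0 < d)%R) by (apply Rmin_pos; [lra|apply Rdiv_lt_0_compat; lra]).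
  exists d. split; [exact Hd|]. intros x Hx k.
  assert (Hx1 : (Cmod x <= d)%R) by exact Hx.
  pose proof (Rmin_l 1 ((1 - q0) / (2 * qbound q0 1))) as M1. fold d in M1.
  pose proof (Rmin_r 1 ((1 - q0) / (2 * qbound q0 1))) as M2. fold d in M2.
  pose proof (qpoch_diff q0 d x 0 k Hq Hx1) as D. simpl in D.
  assert (B1 : (qbound q0 d <= qbound q0 1)%R).
  { unfold qbound. destruct (Rle_lt_or_eq_dec _ _ M1) as [L|L]; [left; apply exp_increasing|rewrite L; lra].
    apply Rmult_lt_compat_r; [apply Rinv_0_lt_compat|]; lra. }
  assert (B2 : (qbound q0 d * d / (1 - q0) * 1 <= 1 / 2)%R).
  { apply Rle_trans with (qbound q0 1 * ((1 - q0) / (2 * qbound q0 1)) / (1 - q0))%R.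
    - rewrite Rmult_1_r. apply Rmult_le_compat_r; [left; apply Rinv_0_lt_compat; lra|].
      apply Rmult_le_compat; try lra. left; apply exp_pos.
    - right. field. lra. }
  pose proof (Cmod_triangle (qpoch q0 x k) (1 - qpoch q0 x k)) as T.
  replace (qpoch q0 x k + (1 - qpoch q0 x k)) with (RtoC 1) in T by ring.
  replace (1 - qpoch q0 x k) with (- (qpoch q0 x k - 1)) in T by ring.
  rewrite Cmod_opp, Cmod_1 in T. lra.
Qed.

(** From some [N] on [x * q0 ^ N] is so small that [qpoch_small] controls the remaining factors;
    before that only finitely many nonzero products occur. *)
Lemma qpoch_lower (q0 : R) (x : C) : (0 < q0 < 1)%R -> (forall k, 1 - x * RtoC q0 ^ k <> 0) ->
  exists d : R, (0 < d)%R /\ forall k, (d <= Cmod (qpoch q0 x k))%R.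
Proof.
  intros Hq Hx. destruct (qpoch_small q0 Hq) as (d0 & Hd0 & Hsm).
  destruct (pow_q_small q0 Hq (Cmod x) d0 (Cmod_ge_0 x) Hd0) as [N HN].
  assert (F : forall n, exists d, (0 < d)%R /\ forall k, (k <= n)%nat -> (d <= Cmod (qpoch q0 x k))%R).
  { intros n. induction n as [|n (d & Hd & Hdk)].
    - exists 1%R. split; [lra|]. intros k Hk. replace k with O by lia. simpl. rewrite Cmod_1. lra.
    - exists (Rmin d (Cmod (qpoch q0 x (S n)))). split.
      + apply Rmin_pos; [exact Hd|]. apply Cmod_gt_0, qpoch_neq_0. auto.
      + intros k Hk. destruct (Nat.eq_dec k (S n)) as [->|Hne]; [apply Rmin_r|].
        eapply Rle_trans; [apply Rmin_l|]. apply Hdk. lia. }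
  destruct (F N) as (d & Hd & Hdk). exists (d / 2)%R. split; [lra|].
  intros k. destruct (le_lt_dec k N) as [L|L]; [specialize (Hdk k L); lra|].
  replace k with (N + (k - N))%nat by lia. rewrite qpoch_add, Cmod_mult.
  pose proof (Hdk N (Nat.le_refl _)) as D1.
  assert (D2 : (1 / 2 <= Cmod (qpoch q0 (x * RtoC q0 ^ N) (k - N)))%R).
  { apply Hsm. rewrite Cmod_mult, Cmod_q by assumption. left. apply HN. lia. }
  apply Rle_trans with (d * (1 / 2))%R; [lra|]. apply Rmult_le_compat; lra.
Qed.

Lemma qpoch_inf_neq_0 (q0 : R) (x : C) : (0 < q0 < 1)%R -> (forall k, 1 - x * RtoC q0 ^ k <> 0) ->
  qpoch_inf q0 x <> 0.
Proof.
  intros Hq Hx. destruct (qpoch_lower q0 x Hq Hx) as (d & Hd & Hk).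
  apply Cmod_gt_0. apply Rlt_le_trans with (1 := Hd).
  apply cvg_ge with (u := qpoch q0 x) (N := O); [now apply qpoch_cvg|auto].
Qed.

(** * Integrals along curves *)

Definition ccont (f : R -> C) (t : R) : Prop :=
  forall eps : R, (0 < eps)%R -> exists d : R, (0 < d)%R /\
    forall s, (Rabs (s - t) < d)%R -> (Cmod (f s - f t) < eps)%R.

Definition rcvg (s : nat -> R) (t : R) : Prop :=
  forall d : R, (0 < d)%R -> exists N, forall n, (N <= n)%nat -> (Rabs (s n - t) < d)%R.

(** Reduces the algebra of continuous functions to that of [cvg]. The converse direction chooses a
    sequence of counterexamples at distance below [/ INR (S n)]. *)
Lemma ccont_seq (f : R -> C) t :
  ccont f t <-> forall s, rcvg s t -> cvg (fun n => f (s n)) (f t).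
Proof.
  split.
  - intros H s Hs eps He. destruct (H eps He) as (d & Hd & Hf).
    destruct (Hs d Hd) as [N HN]. exists N. intros n Hn. apply Hf, HN, Hn.
  - intros H eps He. apply NNPP. intros Hno.
    assert (Hn : forall n : nat, exists s, (Rabs (s - t) < / INR (S n))%R /\ (eps <= Cmod (f s - f t))%R).
    { intros n. apply NNPP. intros Hn. apply Hno. exists (/ INR (S n))%R. split.
      - apply Rinv_0_lt_compat, lt_0_INR. lia.
      - intros s Hs. apply Rnot_le_lt. intros Hle. apply Hn. exists s. split; assumption. }
    set (s := fun n => proj1_sig (constructive_indefinite_description _ (Hn n))).
    assert (Hs : forall n, (Rabs (s n - t) < / INR (S n))%R /\ (eps <= Cmod (f (s n) - f t))%R)
      by (intros n; exact (proj2_sig (constructive_indefinite_description _ (Hn n)))).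
    destruct (H s) with (eps := eps) as [N HN]; [|exact He|].
    + intros d Hd. destruct (archimed_cor1 d Hd) as (N & HN & HN0). exists N. intros n Hn'.
      apply Rlt_trans with (1 := proj1 (Hs n)). apply Rle_lt_trans with (2 := HN).
      apply Rinv_le_contravar; [apply lt_0_INR, HN0|apply le_INR; lia].
    + specialize (HN N (Nat.le_refl _)). pose proof (proj2 (Hs N)). lra.
Qed.

Lemma ccont_const (c : C) t : ccont (fun _ => c) t.
Proof. apply ccont_seq. intros s _. apply cvg_const. Qed.

Lemma ccont_plus (f g : R -> C) t : ccont f t -> ccont g t -> ccont (fun s => f s + g s) t.
Proof.
  rewrite !ccont_seq. intros Hf Hg s Hs.
  apply (cvg_plus (fun n => f (s n)) (fun n => g (s n))); auto.
Qed.

Lemma ccont_mult (f g : R -> C) t : ccont f t -> ccont g t -> ccont (fun s => f s * g s) t.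
Proof.
  rewrite !ccont_seq. intros Hf Hg s Hs.
  apply (cvg_mult (fun n => f (s n)) (fun n => g (s n))); auto.
Qed.

Lemma ccont_inv (f : R -> C) t : f t <> 0 -> ccont f t -> ccont (fun s => / f s) t.
Proof.
  rewrite !ccont_seq. intros H0 Hf s Hs. apply (cvg_inv (fun n => f (s n))); auto.
Qed.

Lemma ccont_ext (f g : R -> C) t : (forall s, f s = g s) -> ccont f t -> ccont g t.
Proof. intros E H eps He. destruct (H eps He) as (d & Hd & Hs). exists d. split; [exact Hd|]. intros s. rewrite <- !E. apply Hs. Qed.

Lemma ccont_pow (f : R -> C) t n : ccont f t -> ccont (fun s => f s ^ n) t.
Proof.
  intros H. induction n; [exact (ccont_const 1 t)|]. apply (ccont_mult f (fun s => f s ^ n)); assumption.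
Qed.

Lemma ccont_continuous (f : R -> C) t :
  ccont f t <-> @continuous R_UniformSpace C_UniformSpace f t.
Proof.
  unfold continuous. rewrite (filterlim_locally (F := locally t) f (f t)). split.
  - intros H eps. destruct (H eps (cond_pos eps)) as (d & Hd & Hs).
    exists (mkposreal d Hd). intros s Hb. apply C_NormedModule_mixin_compat1. apply Hs, Hb.
  (* The balls of the product uniform structure are squares; a square of radius [r] lies in the disc
     of radius [sqrt 2 * r]. *)
  - intros H eps He. assert (H2 : (0 < sqrt 2)%R) by (apply sqrt_lt_R0; lra).
    destruct (H (mkposreal (eps / sqrt 2) ltac:(apply Rdiv_lt_0_compat; assumption))) as [d Hd].
    exists d. split; [apply cond_pos|]. intros s Hs.
    specialize (Hd s Hs). apply C_NormedModule_mixin_compat2 in Hd. simpl in Hd.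
    replace (sqrt 2 * (eps / sqrt 2))%R with eps in Hd by (field; lra). exact Hd.
Qed.

Definition I01 (t : R) : Prop := (0 <= t <= 1)%R.

Lemma ccont_lower (f : R -> C) : (forall t, I01 t -> ccont f t) -> (forall t, I01 t -> f t <> 0) ->
  exists d : R, (0 < d)%R /\ forall t, I01 t -> (d <= Cmod (f t))%R.
Proof.
  intros Hc H0. destruct (continuity_ab_min (fun t => Cmod (f t)) 0 1) as (x & Hx & Hx01).
  - lra.
  - intros t Ht eps He. destruct (Hc t Ht eps He) as (d & Hd & Hs). exists d. split; [exact Hd|].
    intros s [_ Hst]. simpl in *. unfold R_dist in *.
    specialize (Hs s Hst). apply Rabs_def1.
    + pose proof (Cmod_triangle (f t) (f s - f t)) as T. replace (f t + (f s - f t)) with (f s) in T by ring. lra.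
    + pose proof (Cmod_triangle (f s) (- (f s - f t))) as T. rewrite Cmod_opp in T.
      replace (f s + - (f s - f t)) with (f t) in T by ring. lra.
  - exists (Cmod (f x)). split; [apply Cmod_gt_0, H0, Hx01|]. intros t Ht. now apply Hx.
Qed.

Lemma ccont_upper (f : R -> C) : (forall t, I01 t -> ccont f t) ->
  exists B : R, (0 < B)%R /\ forall t, I01 t -> (Cmod (f t) <= B)%R.
Proof.
  intros Hc. destruct (continuity_ab_maj (fun t => Cmod (f t)) 0 1) as (x & Hx & Hx01).
  - lra.
  - intros t Ht eps He. destruct (Hc t Ht eps He) as (d & Hd & Hs). exists d. split; [exact Hd|].
    intros s [_ Hst]. simpl in *. unfold R_dist in *.
    specialize (Hs s Hst). apply Rabs_def1.
    + pose proof (Cmod_triangle (f t) (f s - f t)) as T. replace (f t + (f s - f t)) with (f s) in T by ring. lra.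
    + pose proof (Cmod_triangle (f s) (- (f s - f t))) as T. rewrite Cmod_opp in T.
      replace (f s + - (f s - f t)) with (f t) in T by ring. lra.
  - exists (Cmod (f x) + 1)%R. split; [pose proof (Cmod_ge_0 (f x)); lra|].
    intros t Ht. specialize (Hx t Ht). simpl in Hx. lra.
Qed.

Definition CI (g : R -> C) (v : C) : Prop := @is_RInt C_R_NormedModule g 0 1 v.

Lemma CI_ext (f g : R -> C) v : (forall t, I01 t -> f t = g t) -> CI f v -> CI g v.
Proof.
  intros E. apply is_RInt_ext. intros t. rewrite Rmin_left, Rmax_right by lra.
  intros Ht. apply E. unfold I01; lra.
Qed.

Lemma CI_unique (f : R -> C) v : CI f v -> @RInt C_R_CompleteNormedModule f 0 1 = v.
Proof. apply (is_RInt_unique (V := C_R_CompleteNormedModule)). Qed.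

Lemma CI_inj (f : R -> C) v w : CI f v -> CI f w -> v = w.
Proof. intros Hv Hw. rewrite <- (CI_unique _ _ Hv). apply CI_unique, Hw. Qed.

Lemma CI_plus (f g : R -> C) v w : CI f v -> CI g w -> CI (fun t => f t + g t) (v + w).
Proof. apply (is_RInt_plus (V := C_R_NormedModule)). Qed.

(** The integral is taken in a normed module over the reals, so a complex factor has to be
    distributed over the two components. *)
Lemma CI_scal (c : C) (f : R -> C) v : CI f v -> CI (fun t => c * f t) (c * v).
Proof.
  intros H.
  pose proof (is_RInt_fct_extend_fst (U := R_NormedModule) (V := R_NormedModule) f 0 1 v H) as H1.
  pose proof (is_RInt_fct_extend_snd (U := R_NormedModule) (V := R_NormedModule) f 0 1 v H) as H2.
  unfold CI. destruct c as [x y]. destruct v as [v1 v2].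
  apply (is_RInt_fct_extend_pair (U := R_NormedModule) (V := R_NormedModule)); simpl.
  - apply (is_RInt_minus (V := R_NormedModule) (fun t => x * fst (f t))%R (fun t => y * snd (f t))%R).
    + apply (is_RInt_scal (V := R_NormedModule) _ 0 1 x), H1.
    + apply (is_RInt_scal (V := R_NormedModule) _ 0 1 y), H2.
  - apply (is_RInt_plus (V := R_NormedModule) (fun t => x * snd (f t))%R (fun t => y * fst (f t))%R).
    + apply (is_RInt_scal (V := R_NormedModule) _ 0 1 x), H2.
    + apply (is_RInt_scal (V := R_NormedModule) _ 0 1 y), H1.
Qed.

Lemma CI_cont (f : R -> C) : (forall t, I01 t -> ccont f t) -> exists v, CI f v.
Proof.
  intros H. destruct (ex_RInt_continuous (V := C_R_CompleteNormedModule) f 0 1) as [v Hv].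
  - intros t. rewrite Rmin_left, Rmax_right by lra. intros Ht.
    apply ccont_continuous, H, Ht.
  - exists v. exact Hv.
Qed.

(** * Uniform convergence on the unit interval and limits of integrals *)

Definition ucv (f : nat -> R -> C) (g : R -> C) : Prop :=
  forall eps : R, (0 < eps)%R -> exists N, forall n, (N <= n)%nat ->
    forall t, I01 t -> (Cmod (f n t - g t) < eps)%R.

Definition ubd (g : R -> C) : Prop := exists B : R, (0 < B)%R /\ forall t, I01 t -> (Cmod (g t) <= B)%R.

Lemma ucv_CI (f : nat -> R -> C) (g : R -> C) (v : nat -> C) :
  (forall n, CI (f n) (v n)) -> ucv f g -> exists w, CI g w /\ cvg v w.
Proof.
  intros Hf Hu.
  (* [filterlim_RInt] asks for uniform convergence on the whole line, so all functions are cut to 0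
     outside the unit interval. *)
  set (cut := fun (h : R -> C) (t : R) => if Rle_dec 0 t then if Rle_dec t 1 then h t else 0 else 0).
  assert (Hcut : forall h t, I01 t -> cut h t = h t).
  { intros h t [H1 H2]. unfold cut. destruct (Rle_dec 0 t); [|contradiction].
    destruct (Rle_dec t 1); [reflexivity|contradiction]. }
  destruct (filterlim_RInt (V := C_R_CompleteNormedModule) (fun n => cut (f n)) 0 1 eventually _ (cut g) v) as (w & Hw & Hg).
  - intros n. apply (CI_ext (f n)); [|apply Hf]. intros t Ht. symmetry. now apply Hcut.
  - apply filterlim_locally. intros eps. destruct (Hu eps (cond_pos eps)) as [N HN].
    exists N. intros n Hn t. apply C_NormedModule_mixin_compat1.
    unfold cut. destruct (Rle_dec 0 t); [destruct (Rle_dec t 1)|].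
    + apply HN; [exact Hn|split; assumption].
    + rewrite minus_eq_zero. change (Cmod 0 < eps)%R. rewrite Cmod_0. apply cond_pos.
    + rewrite minus_eq_zero. change (Cmod 0 < eps)%R. rewrite Cmod_0. apply cond_pos.
  - exists w. split.
    + apply (CI_ext (cut g)); [|exact Hg]. intros t Ht. now apply Hcut.
    + intros eps He. assert (H2 : (0 < sqrt 2)%R) by (apply sqrt_lt_R0; lra).
      apply filterlim_locally with (eps := mkposreal (eps / sqrt 2) ltac:(apply Rdiv_lt_0_compat; assumption)) in Hw.
      destruct Hw as [N HN]. exists N. intros n Hn. specialize (HN n Hn).
      apply C_NormedModule_mixin_compat2 in HN. simpl in HN.
      replace (sqrt 2 * (eps / sqrt 2))%R with eps in HN by (field; lra). exact HN.
Qed.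

Lemma ucv_ext (f f' : nat -> R -> C) (g g' : R -> C) :
  (forall n t, I01 t -> f n t = f' n t) -> (forall t, I01 t -> g t = g' t) -> ucv f g -> ucv f' g'.
Proof.
  intros Ef Eg H eps He. destruct (H eps He) as [N HN]. exists N. intros n Hn t Ht.
  rewrite <- Ef, <- Eg by assumption. now apply HN.
Qed.

Lemma ucv_const (g : R -> C) : ucv (fun _ => g) g.
Proof.
  intros eps He. exists O. intros n _ t _. replace (g t - g t) with (RtoC 0) by ring. now rewrite Cmod_0.
Qed.

Lemma ucv_mult (f f' : nat -> R -> C) (g g' : R -> C) : ubd g -> ubd g' ->
  ucv f g -> ucv f' g' -> ucv (fun n t => f n t * f' n t) (fun t => g t * g' t).
Proof.
  intros (B & HB & Hg) (B' & HB' & Hg') H H' eps He.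
  destruct (H (Rmin 1 (eps / (2 * (B' + 1))))%R) as [N HN].
  { apply Rmin_pos; [lra|apply Rdiv_lt_0_compat; lra]. }
  destruct (H' (Rmin 1 (eps / (2 * (B + 1))))%R) as [N' HN'].
  { apply Rmin_pos; [lra|apply Rdiv_lt_0_compat; lra]. }
  exists (max N N'). intros n Hn t Ht.
  specialize (HN n ltac:(lia) t Ht). specialize (HN' n ltac:(lia) t Ht).
  specialize (Hg t Ht). specialize (Hg' t Ht).
  pose proof (Rmin_l 1 (eps / (2 * (B' + 1)))) as A1. pose proof (Rmin_r 1 (eps / (2 * (B' + 1)))) as A2.
  pose proof (Rmin_l 1 (eps / (2 * (B + 1)))) as A3. pose proof (Rmin_r 1 (eps / (2 * (B + 1)))) as A4.
  replace (f n t * f' n t - g t * g' t) with ((f n t - g t) * f' n t + g t * (f' n t - g' t)) by ring.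
  eapply Rle_lt_trans; [apply Cmod_triangle|]. rewrite !Cmod_mult.
  assert (Hf' : (Cmod (f' n t) <= B' + 1)%R).
  { replace (f' n t) with (g' t + (f' n t - g' t)) by ring. eapply Rle_trans; [apply Cmod_triangle|]. lra. }
  assert (T1 : (Cmod (f n t - g t) * Cmod (f' n t) <= eps / (2 * (B' + 1)) * (B' + 1))%R)
    by (apply Rmult_le_compat; try apply Cmod_ge_0; lra).
  assert (T2 : (Cmod (g t) * Cmod (f' n t - g' t) < (B + 1) * (eps / (2 * (B + 1))))%R).
  { apply Rle_lt_trans with (B * Cmod (f' n t - g' t))%R.
    - apply Rmult_le_compat_r; [apply Cmod_ge_0|exact Hg].
    - apply Rle_lt_trans with (B * (eps / (2 * (B + 1))))%R.
      + apply Rmult_le_compat_l; lra.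
      + apply Rmult_lt_compat_r; [apply Rdiv_lt_0_compat; lra|lra]. }
  replace (eps / (2 * (B' + 1)) * (B' + 1))%R with (eps / 2)%R in T1 by (field; lra).
  replace ((B + 1) * (eps / (2 * (B + 1))))%R with (eps / 2)%R in T2 by (field; lra). lra.
Qed.

Lemma ubd_mult (f g : R -> C) : ubd f -> ubd g -> ubd (fun t => f t * g t).
Proof.
  intros (B & HB & Hf) (B' & HB' & Hg). exists (B * B')%R. split; [now apply Rmult_lt_0_compat|].
  intros t Ht. rewrite Cmod_mult. apply Rmult_le_compat; try apply Cmod_ge_0; auto.
Qed.

Definition ulow (g : R -> C) : Prop := exists d : R, (0 < d)%R /\ forall t, I01 t -> (d <= Cmod (g t))%R.

Lemma ulow_mult (f g : R -> C) : ulow f -> ulow g -> ulow (fun t => f t * g t).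
Proof.
  intros (B & HB & Hf) (B' & HB' & Hg). exists (B * B')%R. split; [now apply Rmult_lt_0_compat|].
  intros t Ht. rewrite Cmod_mult. apply Rmult_le_compat; auto; lra.
Qed.

Lemma ubd_inv (g : R -> C) : ulow g -> ubd (fun t => / g t).
Proof.
  intros (d & Hd & Hg). exists (/ d)%R. split; [now apply Rinv_0_lt_compat|].
  intros t Ht. specialize (Hg t Ht). rewrite Cmod_inv by (apply Cmod_gt_0; lra).
  apply Rinv_le_contravar; assumption.
Qed.

Lemma ucv_inv (f : nat -> R -> C) (g : R -> C) : ulow g ->
  ucv f g -> ucv (fun n t => / f n t) (fun t => / g t).
Proof.
  intros (d & Hd & Hg) H eps He.
  destruct (H (Rmin (d / 2) (eps * (d * d) / 2))%R) as [N HN].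
  { apply Rmin_pos; [lra|]. apply Rdiv_lt_0_compat; [|lra]. repeat apply Rmult_lt_0_compat; lra. }
  exists N. intros n Hn t Ht. specialize (HN n Hn t Ht). specialize (Hg t Ht).
  pose proof (Rmin_l (d / 2) (eps * (d * d) / 2)) as M1.
  pose proof (Rmin_r (d / 2) (eps * (d * d) / 2)) as M2.
  assert (Hu : (d / 2 < Cmod (f n t))%R).
  { pose proof (Cmod_triangle (f n t) (g t - f n t)) as T. replace (f n t + (g t - f n t)) with (g t) in T by ring.
    replace (g t - f n t) with (- (f n t - g t)) in T by ring. rewrite Cmod_opp in T. lra. }
  assert (Hun : f n t <> 0) by (apply Cmod_gt_0; lra).
  assert (Hl : g t <> 0) by (apply Cmod_gt_0; lra).
  replace (/ f n t - / g t) with (- (f n t - g t) * / (f n t * g t)) by (field; split; assumption).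
  rewrite Cmod_mult, Cmod_opp, Cmod_inv, Cmod_mult by (apply Cmult_neq_0; assumption).
  assert (P : (0 < Cmod (f n t) * Cmod (g t))%R) by (apply Rmult_lt_0_compat; lra).
  apply Rmult_lt_reg_r with (1 := P). rewrite Rmult_assoc, Rinv_l, Rmult_1_r by lra.
  apply Rlt_le_trans with (eps * (d * d) / 2)%R; [lra|].
  replace (eps * (d * d) / 2)%R with (eps * (d / 2 * d))%R by field.
  apply Rmult_le_compat_l; [lra|]. apply Rmult_le_compat; lra.
Qed.

Lemma ucv_qpoch (q0 : R) (y : R -> C) : (0 < q0 < 1)%R -> ubd y ->
  ucv (fun K t => qpoch q0 (y t) K) (fun t => qpoch_inf q0 (y t)).
Proof.
  intros Hq (B & HB & Hy) eps He.
  destruct (pow_q_small q0 Hq (qbound q0 B * B / (1 - q0)) eps) as [N HN]; [|exact He|].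
  { apply Rmult_le_pos; [apply Rmult_le_pos; [left; apply exp_pos|lra]|left; apply Rinv_0_lt_compat; lra]. }
  exists N. intros n Hn t Ht. apply Rle_lt_trans with (2 := HN n Hn).
  replace (qpoch q0 (y t) n - qpoch_inf q0 (y t)) with (- (qpoch_inf q0 (y t) - qpoch q0 (y t) n)) by ring.
  rewrite Cmod_opp. now apply qpoch_inf_diff; [|apply Hy].
Qed.

Lemma ubd_qpoch_inf (q0 : R) (y : R -> C) : (0 < q0 < 1)%R -> ubd y -> ubd (fun t => qpoch_inf q0 (y t)).
Proof.
  intros Hq (B & HB & Hy). exists (qbound q0 B). split; [apply exp_pos|].
  intros t Ht. apply qpoch_inf_bound; auto.
Qed.

Lemma ccont_qpoch (q0 : R) (y : R -> C) t K : ccont y t -> ccont (fun s => qpoch q0 (y s) K) t.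
Proof.
  intros H. induction K; simpl; [exact (ccont_const 1 t)|].
  apply (ccont_mult (fun s => qpoch q0 (y s) K)); [exact IHK|].
  apply ccont_ext with (fun s => 1 + - RtoC q0 ^ K * y s); [intros; ring|].
  apply (ccont_plus (fun _ => 1)); [apply ccont_const|].
  apply (ccont_mult (fun _ => - RtoC q0 ^ K)); [apply ccont_const|exact H].
Qed.

(** Compactness enters twice: [y] is bounded, so one [N] makes the tail at least 1/2 for all [t],
    and the first [N] factors have a positive minimum. *)
Lemma ulow_qpoch_inf (q0 : R) (y : R -> C) : (0 < q0 < 1)%R ->
  (forall t, I01 t -> ccont y t) -> (forall t k, I01 t -> 1 - y t * RtoC q0 ^ k <> 0) ->
  ulow (fun t => qpoch_inf q0 (y t)).
Proof.
  intros Hq Hc Hn.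
  destruct (ccont_upper y Hc) as (B & HB & Hy).
  destruct (qpoch_small q0 Hq) as (d0 & Hd0 & Hsm).
  destruct (pow_q_small q0 Hq B d0) as [N HN]; [lra|exact Hd0|].
  destruct (ccont_lower (fun t => qpoch q0 (y t) N)) as (d & Hd & Hdt).
  - intros t Ht. apply ccont_qpoch, Hc, Ht.
  - intros t Ht. apply qpoch_neq_0. auto.
  - exists (d * (1 / 2))%R. split; [lra|]. intros t Ht.
    rewrite (qpoch_inf_split q0 (y t) N Hq), Cmod_mult.
    apply Rmult_le_compat; try lra; [now apply Hdt|].
    apply cvg_ge with (u := qpoch q0 (y t * RtoC q0 ^ N)) (N := O); [now apply qpoch_cvg|].
    intros k _. apply Hsm. rewrite Cmod_mult, Cmod_q by assumption.
    apply Rle_trans with (B * q0 ^ N)%R.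
    + apply Rmult_le_compat_r; [apply pow_le; lra|auto].
    + left. apply HN. lia.
Qed.

(** * Derivatives along real parameters and integrals over closed loops *)

Definition Cder (f : R -> C) (t : R) (l : C) : Prop :=
  @is_derive R_AbsRing C_R_NormedModule f t l.

Lemma Cder_parts (f : R -> C) t (l : C) :
  is_derive (fun s => Re (f s)) t (Re l) -> is_derive (fun s => Im (f s)) t (Im l) -> Cder f t l.
Proof.
  intros H1 H2. unfold Cder.
  pose proof (is_derive_plus (V := C_R_NormedModule)
    (fun s => @scal R_Ring C_R_NormedModule (Re (f s)) (1, 0)) (fun s => @scal R_Ring C_R_NormedModule (Im (f s)) (0, 1)) t
    _ _ (is_derive_scal_l (V := C_R_NormedModule) _ t _ (1, 0) H1)
    (is_derive_scal_l (V := C_R_NormedModule) _ t _ (0, 1) H2)) as H.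
  replace l with (plus (@scal R_Ring C_R_NormedModule (Re l) (1, 0)) (@scal R_Ring C_R_NormedModule (Im l) (0, 1))).
  - apply is_derive_ext with (2 := H). intros s. destruct (f s) as [x y].
    unfold plus, scal; simpl. unfold prod_plus, prod_scal; simpl. unfold scal, plus; simpl. unfold mult; simpl.
    f_equal; ring.
  - destruct l as [x y].
    unfold plus, scal; simpl. unfold prod_plus, prod_scal; simpl. unfold scal, plus; simpl. unfold mult; simpl.
    f_equal; ring.
Qed.

Lemma Cder_Re (f : R -> C) t (l : C) : Cder f t l -> is_derive (fun s => Re (f s)) t (Re l).
Proof.
  intros H. unfold Cder, is_derive in *.
  pose proof (filterdiff_comp (U := R_NormedModule) (V := C_R_NormedModule) (W := R_NormedModule) (F := locally t) f fst _ fst H) as K.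
  apply K.
  apply filterdiff_linear. apply (is_linear_fst (U := R_NormedModule) (V := R_NormedModule)).
Qed.

Lemma Cder_Im (f : R -> C) t (l : C) : Cder f t l -> is_derive (fun s => Im (f s)) t (Im l).
Proof.
  intros H. unfold Cder, is_derive in *.
  pose proof (filterdiff_comp (U := R_NormedModule) (V := C_R_NormedModule) (W := R_NormedModule) (F := locally t) f snd _ snd H) as K.
  apply K.
  apply filterdiff_linear. apply (is_linear_snd (U := R_NormedModule) (V := R_NormedModule)).
Qed.

Lemma Cder_ccont (f : R -> C) t (l : C) : Cder f t l -> ccont f t.
Proof.
  intros H. apply ccont_continuous. apply (ex_derive_continuous (V := C_R_NormedModule)). exists l. exact H.
Qed.

Lemma Cder_const (c : C) t : Cder (fun _ => c) t 0.
Proof. apply (is_derive_const (V := C_R_NormedModule)). Qed.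

Lemma Cder_plus (f g : R -> C) t (l m : C) : Cder f t l -> Cder g t m -> Cder (fun s => f s + g s) t (l + m).
Proof. apply (is_derive_plus (V := C_R_NormedModule)). Qed.

Lemma Cder_mult (f g : R -> C) t (l m : C) : Cder f t l -> Cder g t m ->
  Cder (fun s => f s * g s) t (l * g t + f t * m).
Proof.
  intros Hf Hg. apply Cder_parts.
  - replace (Re (l * g t + f t * m)) with
      ((Re l * Re (g t) + Re (f t) * Re m) - (Im l * Im (g t) + Im (f t) * Im m))%R
      by (destruct l, m, (f t), (g t); unfold Re, Im; simpl; ring).
    apply (is_derive_minus (V := R_NormedModule) (fun s => Re (f s) * Re (g s))%R (fun s => Im (f s) * Im (g s))%R t
      (Re l * Re (g t) + Re (f t) * Re m)%R (Im l * Im (g t) + Im (f t) * Im m)%R);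
      apply (is_derive_mult (K := R_AbsRing)); try apply Rmult_comm; auto using Cder_Re, Cder_Im.
  - replace (Im (l * g t + f t * m)) with
      ((Re l * Im (g t) + Re (f t) * Im m) + (Im l * Re (g t) + Im (f t) * Re m))%R
      by (destruct l, m, (f t), (g t); unfold Re, Im; simpl; ring).
    apply (is_derive_plus (V := R_NormedModule) (fun s => Re (f s) * Im (g s))%R (fun s => Im (f s) * Re (g s))%R t
      (Re l * Im (g t) + Re (f t) * Im m)%R (Im l * Re (g t) + Im (f t) * Re m)%R);
      apply (is_derive_mult (K := R_AbsRing)); try apply Rmult_comm; auto using Cder_Re, Cder_Im.
Qed.

Lemma Cder_inv (f : R -> C) t (l : C) : f t <> 0 -> Cder f t l -> Cder (fun s => / f s) t (- l * (/ f t * / f t)).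
Proof.
  intros H0 Hf. pose proof (Cder_Re _ _ _ Hf) as H1. pose proof (Cder_Im _ _ _ Hf) as H2.
  set (n := fun s => (Re (f s) * Re (f s) + Im (f s) * Im (f s))%R).
  assert (Hn : is_derive n t ((Re l * Re (f t) + Re (f t) * Re l) + (Im l * Im (f t) + Im (f t) * Im l))%R).
  { apply (is_derive_plus (V := R_NormedModule) (fun s => Re (f s) * Re (f s))%R (fun s => Im (f s) * Im (f s))%R);
      apply (is_derive_mult (K := R_AbsRing)); try apply Rmult_comm; auto. }
  assert (Hnt : n t <> 0%R).
  { unfold n. intro E. apply H0. destruct (f t) as [x y]. unfold Re, Im in E. simpl in E.
    assert (x = 0%R) by nra. assert (y = 0%R) by nra. subst. reflexivity. }
  apply Cder_parts.
  - apply is_derive_ext with (f := (fun s => Re (f s) / n s)%R).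
    + intros s. unfold n, Cinv, Re, Im. simpl. f_equal. ring.
    + replace (Re (- l * (/ f t * / f t))) with
        ((Re l * n t - Re (f t) * ((Re l * Re (f t) + Re (f t) * Re l) + (Im l * Im (f t) + Im (f t) * Im l))) / n t ^ 2)%R.
      * apply is_derive_div; assumption.
      * unfold n in *. destruct (f t) as [x y], l as [u v]. unfold Re, Im in *. simpl in *. field.
        intro E; apply Hnt; nra.
  - apply is_derive_ext with (f := (fun s => (- Im (f s)) / n s)%R).
    + intros s. unfold n, Cinv, Re, Im. simpl. f_equal. ring.
    + replace (Im (- l * (/ f t * / f t))) with
        (((- Im l) * n t - (- Im (f t)) * ((Re l * Re (f t) + Re (f t) * Re l) + (Im l * Im (f t) + Im (f t) * Im l))) / n t ^ 2)%R.
      * apply (is_derive_div (fun s => (- Im (f s))%R) n); try assumption.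
        apply (is_derive_opp (V := R_NormedModule) (fun s => Im (f s)) t (Im l)). exact H2.
      * unfold n in *. destruct (f t) as [x y], l as [u v]. unfold Re, Im in *. simpl in *. field.
        intro E; apply Hnt; nra.
Qed.

Lemma Cder_pow (f : R -> C) t (l : C) n : Cder f t l -> Cder (fun s => f s ^ S n) t (RtoC (INR (S n)) * f t ^ n * l).
Proof.
  intros H. induction n.
  - replace (RtoC (INR 1) * f t ^ 0 * l) with l by (simpl; ring).
    apply (is_derive_ext (V := C_R_NormedModule) f); [intros s; simpl; ring|exact H].
  - pose proof (Cder_mult f (fun s => f s ^ S n) t _ _ H IHn) as K.
    replace (RtoC (INR (S (S n))) * f t ^ S n * l) with
      (l * f t ^ S n + f t * (RtoC (INR (S n)) * f t ^ n * l)); [exact K|].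
    rewrite (S_INR (S n)), RtoC_plus. simpl Cpow. ring.
Qed.

Definition loop (g dg : R -> C) : Prop :=
  (forall t, I01 t -> Cder g t (dg t)) /\ (forall t, I01 t -> ccont dg t) /\ g 0%R = g 1%R.

Lemma loop_contour (T : contour) : loop (path T) (dpath T).
Proof.
  split; [|split].
  - intros t Ht. apply path_derive, Ht.
  - intros t Ht. apply ccont_continuous, dpath_continuous, Ht.
  - apply path_closed.
Qed.

Lemma loop_scal (c : C) (g dg : R -> C) : loop g dg -> loop (fun t => c * g t) (fun t => c * dg t).
Proof.
  intros (H1 & H2 & H3). split; [|split].
  - intros t Ht. replace (c * dg t) with (0 * g t + c * dg t) by ring.
    apply (Cder_mult (fun _ => c)); [apply Cder_const|apply H1, Ht].
  - intros t Ht. apply (ccont_mult (fun _ => c)); [apply ccont_const|apply H2, Ht].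
  - now rewrite H3.
Qed.

Lemma loop_ccont (g dg : R -> C) t : loop g dg -> I01 t -> ccont g t.
Proof. intros (H & _) Ht. eapply Cder_ccont, H, Ht. Qed.

Lemma CI_FTC (F f : R -> C) : (forall t, I01 t -> Cder F t (f t)) -> (forall t, I01 t -> ccont f t) ->
  F 0%R = F 1%R -> CI f 0.
Proof.
  intros HF Hf E.
  replace (RtoC 0) with (minus (F 1%R : C_R_CompleteNormedModule) (F 0%R)).
  - apply (is_RInt_derive (V := C_R_CompleteNormedModule) F f 0 1); intros t;
      rewrite Rmin_left, Rmax_right by lra; intros Ht.
    + apply HF, Ht.
    + apply ccont_continuous, Hf, Ht.
  - rewrite E. apply (minus_eq_zero (G := C_R_CompleteNormedModule)).
Qed.

Lemma CI_pow_derivative (u du : R -> C) n : loop u du -> CI (fun t => u t ^ n * du t) 0.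
Proof.
  intros H. pose proof H as (H1 & H2 & H3).
  assert (Hn : RtoC (INR (S n)) <> 0).
  { intro E. apply RtoC_inj in E. apply (not_0_INR (S n)); [lia|exact E]. }
  replace (RtoC 0) with (/ RtoC (INR (S n)) * 0) by ring.
  apply CI_ext with (fun t => / RtoC (INR (S n)) * (RtoC (INR (S n)) * u t ^ n * du t)).
  - intros t _. field. exact Hn.
  - apply CI_scal. apply CI_FTC with (fun t => u t ^ S n).
    + intros t Ht. apply Cder_pow, H1, Ht.
    + intros t Ht. apply (ccont_mult (fun t => RtoC (INR (S n)) * u t ^ n)); [|apply H2, Ht].
      apply (ccont_mult (fun _ => RtoC (INR (S n)))); [apply ccont_const|].
      apply ccont_pow. eapply loop_ccont; eassumption.
    + rewrite H3. reflexivity.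
Qed.

(** A pole of order at least 2 has a primitive: with [u = / (g - p)] the integrand is, up to sign,
    [u ^ n] times the derivative of [u]. The exponent [S (S n)] excludes order 1, which carries the
    winding number. *)
Lemma CI_pole (g dg : R -> C) (p : C) n : loop g dg -> (forall t, I01 t -> g t <> p) ->
  CI (fun t => (/ (g t - p)) ^ S (S n) * dg t) 0.
Proof.
  intros H Hp. pose proof H as (H1 & H2 & H3).
  assert (Hp' : forall t, I01 t -> g t - p <> 0) by (intros t Ht; apply Cneq_sub; intro E; apply (Hp t Ht); auto).
  assert (L : loop (fun t => / (g t - p)) (fun t => - dg t * (/ (g t - p) * / (g t - p)))).
  { split; [|split].
    - intros t Ht. apply (Cder_inv (fun t => g t - p)); [apply Hp', Ht|].
      replace (dg t) with (dg t + 0) by ring. apply (Cder_plus g (fun _ => - p)); [apply H1, Ht|apply Cder_const].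
    - intros t Ht.
      assert (Hi : ccont (fun t => / (g t - p)) t).
      { apply ccont_inv; [apply Hp', Ht|]. apply (ccont_plus g (fun _ => - p)); [eapply loop_ccont; eassumption|apply ccont_const]. }
      apply (ccont_mult (fun t => - dg t)); [|apply ccont_mult; exact Hi].
      apply ccont_ext with (fun t => - (1) * dg t); [intros; ring|].
      apply (ccont_mult (fun _ => - (1))); [apply ccont_const|apply H2, Ht].
    - rewrite H3. reflexivity. }
  pose proof (CI_scal (- (1)) _ _ (CI_pow_derivative _ _ n L)) as K.
  rewrite Cmult_0_r in K. apply CI_ext with (2 := K). intros t _. simpl. ring.
Qed.

(** * Rational functions with equal integrals over two loops *)

Section TwoLoops.

Variables g1 dg1 g2 dg2 : R -> C.
Hypothesis L1 : loop g1 dg1.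
Hypothesis L2 : loop g2 dg2.

(** Stands in for Cauchy's theorem. For rational functions, equality of the two integrals reduces to
    equality for each simple pole, as all other powers integrate to 0. *)
Definition same_int (f : C -> C) : Prop :=
  exists v, CI (fun t => f (g1 t) * dg1 t) v /\ CI (fun t => f (g2 t) * dg2 t) v.

Definition on_loops (z : C) : Prop := exists t, I01 t /\ (z = g1 t \/ z = g2 t).

(** The second condition says that both loops have the same winding number about [p]. *)
Definition good_pole (p : C) : Prop := ~ on_loops p /\ same_int (fun z => / (z - p)).

Lemma same_int_ext (f h : C -> C) : (forall z, on_loops z -> f z = h z) -> same_int f -> same_int h.
Proof.
  intros E (v & H1 & H2). exists v. split.
  - apply CI_ext with (2 := H1). intros t Ht. rewrite E; [reflexivity|]. exists t; auto.
  - apply CI_ext with (2 := H2). intros t Ht. rewrite E; [reflexivity|]. exists t; auto.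
Qed.

Lemma same_int_lin (c k : C) (f h : C -> C) : same_int f -> same_int h -> same_int (fun z => c * f z + k * h z).
Proof.
  intros (v & H1 & H2) (w & H3 & H4). exists (c * v + k * w). split.
  - apply CI_ext with (fun t => c * (f (g1 t) * dg1 t) + k * (h (g1 t) * dg1 t)); [intros; ring|].
    apply CI_plus; apply CI_scal; assumption.
  - apply CI_ext with (fun t => c * (f (g2 t) * dg2 t) + k * (h (g2 t) * dg2 t)); [intros; ring|].
    apply CI_plus; apply CI_scal; assumption.
Qed.

Lemma good_pole_neq (p z : C) : good_pole p -> on_loops z -> z - p <> 0.
Proof. intros [H _] Hz. apply Cneq_sub. intro E. apply H. rewrite E. exact Hz. Qed.

Definition prodinv (ps : list C) (z : C) : C := fold_right (fun p r => / (z - p) * r) 1 ps.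

Lemma same_int_pole (p : C) n : good_pole p -> same_int (fun z => (/ (z - p)) ^ S n).
Proof.
  intros [Hon Hs]. destruct n as [|n].
  - apply same_int_ext with (2 := Hs). intros; simpl; ring.
  - exists 0. split; apply CI_pole; try assumption; intros t Ht E; apply Hon; exists t; auto.
Qed.

(** Partial fractions: a product of simple poles is reduced to powers of a single one. *)
Lemma same_int_prodinv (ps : list C) : List.Forall good_pole ps -> forall (p : C) k, good_pole p ->
  same_int (fun z => (/ (z - p)) ^ S k * prodinv ps z).
Proof.
  induction ps as [|p' ps IH]; intros Hps p k Hp.
  - apply same_int_ext with (2 := same_int_pole p k Hp). intros; simpl; ring.
  - inversion_clear Hps as [|? ? Hp' Hps'].
    destruct (Ceq_dec p p') as [<-|Hne].
    + apply same_int_ext with (2 := IH Hps' p (S k) Hp). intros; simpl; ring.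
    + assert (Hd : p' - p <> 0) by (apply Cneq_sub, Hne).
      induction k as [|k IHk].
      * apply same_int_ext with (2 := same_int_lin (/ (p' - p)) (- / (p' - p)) _ _ (IH Hps' p' O Hp') (IH Hps' p O Hp)).
        intros z Hz. pose proof (good_pole_neq p z Hp Hz). pose proof (good_pole_neq p' z Hp' Hz).
        simpl. field. repeat split; assumption.
      * apply same_int_ext with (2 := same_int_lin (/ (p' - p)) (- / (p' - p)) _ _ IHk (IH Hps' p (S k) Hp)).
        intros z Hz. pose proof (good_pole_neq p z Hp Hz). pose proof (good_pole_neq p' z Hp' Hz).
        simpl. set (X := Cpow (/ (z - p)) k). field. repeat split; assumption.
Qed.

Lemma same_int_mono (n : nat) : forall ps, List.Forall good_pole ps -> same_int (fun z => z ^ n * prodinv ps z).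
Proof.
  assert (Hnil : forall n, same_int (fun z => z ^ n * prodinv [] z)).
  { intros m. exists 0. split.
    - apply CI_ext with (2 := CI_pow_derivative _ _ m L1). intros; simpl; ring.
    - apply CI_ext with (2 := CI_pow_derivative _ _ m L2). intros; simpl; ring. }
  induction n as [|n IH]; intros [|p ps] Hps; [exact (Hnil O)| |exact (Hnil (S n))|].
  - inversion_clear Hps. apply same_int_ext with (fun z => (/ (z - p)) ^ 1 * prodinv ps z).
    + intros; simpl; ring.
    + now apply same_int_prodinv.
  - inversion Hps as [|? ? Hp Hps']; subst.
    (* [z / (z - p) = 1 + p / (z - p)] lowers the power of [z], in one of the two terms with one
       pole fewer. *)
    apply same_int_ext with (2 := same_int_lin 1 p _ _ (IH ps Hps') (IH (p :: ps) Hps)).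
    intros z Hz. pose proof (good_pole_neq p z Hp Hz). simpl. field. assumption.
Qed.

(** The factor [z ^ n * prodinv ps z] makes this class closed under multiplication by [z] and by
    [/ (z - p)] for good poles [p]. *)
Definition ratl (f : C -> C) : Prop :=
  forall n ps, List.Forall good_pole ps -> same_int (fun z => z ^ n * prodinv ps z * f z).

Lemma ratl_same_int (f : C -> C) : ratl f -> same_int f.
Proof. intros H. apply same_int_ext with (2 := H O [] (List.Forall_nil _)). intros; simpl; ring. Qed.

Lemma ratl_1 : ratl (fun _ => 1).
Proof. intros n ps Hps. apply same_int_ext with (2 := same_int_mono n ps Hps). intros; ring. Qed.

Lemma ratl_ext (f h : C -> C) : (forall z, on_loops z -> f z = h z) -> ratl f -> ratl h.
Proof.
  intros E H n ps Hps. apply same_int_ext with (2 := H n ps Hps). intros z Hz. now rewrite E.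
Qed.

Lemma ratl_lin (c k : C) (f h : C -> C) : ratl f -> ratl h -> ratl (fun z => c * f z + k * h z).
Proof.
  intros Hf Hh n ps Hps. apply same_int_ext with (2 := same_int_lin c k _ _ (Hf n ps Hps) (Hh n ps Hps)).
  intros; ring.
Qed.

Lemma ratl_mulz (f : C -> C) : ratl f -> ratl (fun z => z * f z).
Proof.
  intros Hf n ps Hps. apply same_int_ext with (2 := Hf (S n) ps Hps). intros; simpl; ring.
Qed.

Lemma ratl_pole (f : C -> C) (p : C) : good_pole p -> ratl f -> ratl (fun z => / (z - p) * f z).
Proof.
  intros Hp Hf n ps Hps. apply same_int_ext with (2 := Hf n (p :: ps) (List.Forall_cons _ Hp Hps)). intros; simpl; ring.
Qed.

End TwoLoops.

(** A bound on the limit is carried along because uniform convergence of products relies on it. *)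
Definition uconv (f : nat -> R -> C) (g : R -> C) : Prop := ucv f g /\ ubd g.

Lemma uconv_mult (f f' : nat -> R -> C) (g g' : R -> C) : uconv f g -> uconv f' g' ->
  uconv (fun n t => f n t * f' n t) (fun t => g t * g' t).
Proof. intros [H1 H2] [H3 H4]. split; [now apply ucv_mult|now apply ubd_mult]. Qed.

Lemma uconv_inv (f : nat -> R -> C) (g : R -> C) : ulow g -> uconv f g ->
  uconv (fun n t => / f n t) (fun t => / g t).
Proof. intros H [H1 H2]. split; [now apply ucv_inv|now apply ubd_inv]. Qed.

Lemma ccont_ubd (g : R -> C) : (forall t, I01 t -> ccont g t) -> ubd g.
Proof. apply ccont_upper. Qed.

Lemma uconv_const (g : R -> C) : (forall t, I01 t -> ccont g t) -> uconv (fun _ => g) g.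
Proof. intros H. split; [apply ucv_const|now apply ccont_ubd]. Qed.

Lemma uconv_qpoch (q0 : R) (y : R -> C) : (0 < q0 < 1)%R -> (forall t, I01 t -> ccont y t) ->
  uconv (fun K t => qpoch q0 (y t) K) (fun t => qpoch_inf q0 (y t)).
Proof.
  intros Hq H. apply ccont_ubd in H. split; [now apply ucv_qpoch|now apply ubd_qpoch_inf].
Qed.

Lemma uconv_ext (f f' : nat -> R -> C) (g g' : R -> C) :
  (forall n t, I01 t -> f n t = f' n t) -> (forall t, I01 t -> g t = g' t) -> uconv f g -> uconv f' g'.
Proof.
  intros Ef Eg [H (B & HB & Hg)]. split; [now apply ucv_ext with (3 := H)|].
  exists B. split; [exact HB|]. intros t Ht. rewrite <- Eg by assumption. auto.
Qed.

Definition lprod (h : C -> C) (es : list C) : C := fold_right (fun e r => h e * r) 1 es.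

Lemma lprod_ext (h k : C -> C) es : (forall e, In e es -> h e = k e) -> lprod h es = lprod k es.
Proof.
  induction es as [|e es IH]; intros H; simpl; [reflexivity|].
  rewrite H, IH; [reflexivity| |left; reflexivity]. intros; apply H; right; assumption.
Qed.

Lemma uconv_lprod (f : nat -> R -> C -> C) (g : R -> C -> C) es :
  (forall e, In e es -> uconv (fun n t => f n t e) (fun t => g t e)) ->
  uconv (fun n t => lprod (f n t) es) (fun t => lprod (g t) es).
Proof.
  induction es as [|e es IH]; intros H; simpl.
  - apply uconv_const. intros t _. apply ccont_const.
  - apply (uconv_mult (fun n t => f n t e) (fun n t => lprod (f n t) es)).
    + apply H. left; reflexivity.
    + apply IH. intros; apply H; right; assumption.
Qed.

Lemma ccont_lprod (g : R -> C -> C) es t :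
  (forall e, In e es -> ccont (fun t => g t e) t) -> ccont (fun t => lprod (g t) es) t.
Proof.
  induction es as [|e es IH]; intros H; simpl; [apply ccont_const|].
  apply (ccont_mult (fun t => g t e)); [apply H; left; reflexivity|].
  apply IH. intros; apply H; right; assumption.
Qed.

Lemma ulow_lprod (g : R -> C -> C) es :
  (forall e, In e es -> ulow (fun t => g t e)) -> ulow (fun t => lprod (g t) es).
Proof.
  induction es as [|e es IH]; intros H; simpl.
  - exists 1%R. split; [lra|]. intros. rewrite Cmod_1. lra.
  - apply (ulow_mult (fun t => g t e)); [apply H; left; reflexivity|].
    apply IH. intros; apply H; right; assumption.
Qed.

Lemma lprod_neq_0 (h : C -> C) es : (forall e, In e es -> h e <> 0) -> lprod h es <> 0.
Proof.
  induction es as [|e es IH]; intros H; simpl; [apply C1_nz|].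
  apply Cmult_neq_0; [apply H; left; reflexivity|]. apply IH. intros; apply H; right; assumption.
Qed.

(** * Integrals of the weight *)

Definition wt (q : C) (es : list C) (x : C) : C :=
  qpoch_inf q (x ^ 2) * qpoch_inf q (/ x ^ 2) *
  / lprod (fun e => qpoch_inf q (e * x) * qpoch_inf q (e / x)) es.

(** This truncation is rational in [x], hence continuous off its poles; the integrals of [wt] are
    obtained from it by uniform convergence. *)
Definition wtK (q : C) (es : list C) (K : nat) (x : C) : C :=
  qpoch q (x ^ 2) K * qpoch q (/ x ^ 2) K *
  / lprod (fun e => qpoch q (e * x) K * qpoch q (e / x) K) es.

Definition Phi (q : C) (es : list C) (x : C) : C :=
  (1 - q * x ^ 2) / x * (qpoch_inf q (q ^ 2 * x ^ 2) * qpoch_inf q (/ x ^ 2)) *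
  / lprod (fun e => qpoch_inf q (e * q * x) * qpoch_inf q (e / x)) es.

Definition PhiK (q : C) (es : list C) (K : nat) (x : C) : C :=
  (1 - q * x ^ 2) / x * (qpoch q (q ^ 2 * x ^ 2) K * qpoch q (/ x ^ 2) K) *
  / lprod (fun e => qpoch q (e * q * x) K * qpoch q (e / x) K) es.

(** The two lists differ for [Phi], whose denominators are [e / x] and [e * q * x]: its outer poles
    start one power of [q] further out than those of the weight. *)
Record pole_free (q : C) (es es' : list C) (x : R -> C) : Prop := {
  pf_cont : forall t, I01 t -> ccont x t;
  pf_0 : forall t, I01 t -> x t <> 0;
  pf_in : forall e, In e es -> forall t k, I01 t -> 1 - e / x t * q ^ k <> 0;
  pf_out : forall e, In e es' -> forall t k, I01 t -> 1 - e * x t * q ^ k <> 0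
}.

Lemma ccont_scal (c : C) (f : R -> C) t : ccont f t -> ccont (fun s => c * f s) t.
Proof. apply (ccont_mult (fun _ => c)), ccont_const. Qed.

Lemma ccont_scal_inv (c : C) (f : R -> C) t : f t <> 0 -> ccont f t -> ccont (fun s => c / f s) t.
Proof. intros H0 H. apply (ccont_scal c (fun s => / f s)), ccont_inv; assumption. Qed.

Lemma ccont_inv_sq (f : R -> C) t : f t <> 0 -> ccont f t -> ccont (fun s => / f s ^ 2) t.
Proof.
  intros H0 H. apply (ccont_inv (fun s => f s ^ 2)); [now apply Cpow_nz|now apply ccont_pow].
Qed.

Lemma pole_free_lower (q0 : R) es es' x : (0 < q0 < 1)%R -> pole_free q0 es es' x ->
  (forall e, In e es -> ulow (fun t => qpoch_inf q0 (e / x t))) /\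
  (forall e, In e es' -> ulow (fun t => qpoch_inf q0 (e * x t))).
Proof.
  intros Hq [Hc H0 Hi Ho]. split; intros e He; apply ulow_qpoch_inf; auto.
  - intros t Ht. apply ccont_scal_inv; auto.
  - intros t Ht. apply ccont_scal; auto.
Qed.

Lemma uconv_wt (q0 : R) es x : (0 < q0 < 1)%R -> pole_free q0 es es x ->
  uconv (fun K t => wtK q0 es K (x t)) (fun t => wt q0 es (x t)).
Proof.
  intros Hq H. destruct (pole_free_lower q0 es es x Hq H) as [Hl1 Hl2]. destruct H as [Hc H0 Hi Ho].
  unfold wtK, wt. repeat apply uconv_mult.
  - apply (uconv_qpoch q0 (fun t => x t ^ 2)); [exact Hq|]. intros; apply ccont_pow; auto.
  - apply (uconv_qpoch q0 (fun t => / x t ^ 2)); [exact Hq|]. intros; apply ccont_inv_sq; auto.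
  - apply uconv_inv.
    + apply ulow_lprod. intros e He. apply ulow_mult; auto.
    + apply (uconv_lprod (fun K t e => qpoch q0 (e * x t) K * qpoch q0 (e / x t) K)).
      intros e He. apply uconv_mult.
      * apply (uconv_qpoch q0 (fun t => e * x t)); [exact Hq|]. intros; apply ccont_scal; auto.
      * apply (uconv_qpoch q0 (fun t => e / x t)); [exact Hq|]. intros; apply ccont_scal_inv; auto.
Qed.

Lemma ccont_wtK (q0 : R) es x K t : pole_free q0 es es x -> I01 t -> ccont (fun t => wtK q0 es K (x t)) t.
Proof.
  intros [Hc H0 Hi Ho] Ht. unfold wtK. repeat apply ccont_mult.
  - apply (ccont_qpoch q0 (fun t => x t ^ 2)). apply ccont_pow; auto.
  - apply (ccont_qpoch q0 (fun t => / x t ^ 2)). apply ccont_inv_sq; auto.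
  - apply ccont_inv.
    + apply lprod_neq_0. intros e He. apply Cmult_neq_0; apply qpoch_neq_0; auto.
    + apply (ccont_lprod (fun t e => qpoch q0 (e * x t) K * qpoch q0 (e / x t) K)).
      intros e He. apply ccont_mult.
      * apply (ccont_qpoch q0 (fun t => e * x t)). apply ccont_scal; auto.
      * apply (ccont_qpoch q0 (fun t => e / x t)). apply ccont_scal_inv; auto.
Qed.

Lemma uconv_Phi (q0 : R) es x : (0 < q0 < 1)%R -> pole_free q0 es (map (fun e => e * q0) es) x ->
  uconv (fun K t => PhiK q0 es K (x t)) (fun t => Phi q0 es (x t)).
Proof.
  intros Hq H. destruct (pole_free_lower q0 es _ x Hq H) as [Hl1 Hl2]. destruct H as [Hc H0 Hi Ho].
  unfold PhiK, Phi. apply uconv_mult; [apply uconv_mult; [|apply uconv_mult]|].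
  - apply (uconv_const (fun t => (1 - q0 * x t ^ 2) / x t)). intros t Ht.
    apply (ccont_mult (fun t => 1 - q0 * x t ^ 2)); [|apply ccont_inv; auto].
    apply ccont_ext with (fun t => 1 + (- q0) * x t ^ 2); [intros; ring|].
    apply (ccont_plus (fun _ => 1)); [apply ccont_const|].
    apply (ccont_scal (- q0)). apply ccont_pow; auto.
  - apply (uconv_qpoch q0 (fun t => RtoC q0 ^ 2 * x t ^ 2)); [exact Hq|]. intros; apply ccont_scal, ccont_pow; auto.
  - apply (uconv_qpoch q0 (fun t => / x t ^ 2)); [exact Hq|]. intros; apply ccont_inv_sq; auto.
  - apply uconv_inv.
    + apply ulow_lprod. intros e He. apply ulow_mult; auto.
      apply Hl2. apply in_map with (f := fun e => e * q0). exact He.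
    + apply (uconv_lprod (fun K t e => qpoch q0 (e * q0 * x t) K * qpoch q0 (e / x t) K)).
      intros e He. apply uconv_mult.
      * apply (uconv_qpoch q0 (fun t => e * q0 * x t)); [exact Hq|]. intros; apply ccont_scal; auto.
      * apply (uconv_qpoch q0 (fun t => e / x t)); [exact Hq|]. intros; apply ccont_scal_inv; auto.
Qed.

Lemma uconv_CI (f : nat -> R -> C) (g h : R -> C) (v : nat -> C) :
  uconv f g -> (forall t, I01 t -> ccont h t) -> (forall n, CI (fun t => f n t * h t) (v n)) ->
  exists w, CI (fun t => g t * h t) w /\ cvg v w.
Proof.
  intros H Hh Hv. apply ucv_CI with (fun n t => f n t * h t); [exact Hv|].
  apply (uconv_mult f (fun _ => h) g h H). now apply uconv_const.
Qed.

Lemma CI_wt_exists (q0 : R) es (x h : R -> C) : (0 < q0 < 1)%R -> pole_free q0 es es x ->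
  (forall t, I01 t -> ccont h t) -> exists w, CI (fun t => wt q0 es (x t) * h t) w.
Proof.
  intros Hq Hp Hh.
  assert (Hv : forall K, exists v, CI (fun t => wtK q0 es K (x t) * h t) v).
  { intros K. apply CI_cont. intros t Ht. apply (ccont_mult (fun t => wtK q0 es K (x t))); [|auto].
    now apply ccont_wtK. }
  set (v := fun K => proj1_sig (constructive_indefinite_description _ (Hv K))).
  destruct (uconv_CI _ _ h v (uconv_wt q0 es x Hq Hp) Hh) as (w & Hw & _).
  - intros K. exact (proj2_sig (constructive_indefinite_description _ (Hv K))).
  - exists w. exact Hw.
Qed.

(** * Truncated products as rational functions with controlled poles *)

Section RationalClosure.

Variables (q : C) (g1 dg1 g2 dg2 : R -> C).
Let good := good_pole g1 dg1 g2 dg2.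
Let rat := ratl g1 dg1 g2 dg2.
Hypothesis good_0 : good 0.

Let nz (z : C) : on_loops g1 g2 z -> z <> 0.
Proof.
  intros Hz E. apply (good_pole_neq g1 dg1 g2 dg2 0 z good_0 Hz). rewrite E. ring.
Qed.

Lemma ratl_qpoch_sq (f : C -> C) (al : C) K : rat f -> rat (fun z => qpoch q (al * z ^ 2) K * f z).
Proof.
  intros H. induction K as [|K IH].
  - apply ratl_ext with (2 := H). intros; simpl; ring.
  - apply ratl_ext with (2 := ratl_lin _ _ _ _ 1 (- al * q ^ K) _ _ IH (ratl_mulz _ _ _ _ _ (ratl_mulz _ _ _ _ _ IH))).
    intros; simpl; ring.
Qed.

Lemma ratl_divz (f : C -> C) : rat f -> rat (fun z => / z * f z).
Proof.
  intros H. apply ratl_ext with (2 := ratl_pole _ _ _ _ _ 0 good_0 H).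
  intros z _. replace (z - 0) with z by ring. reflexivity.
Qed.

Lemma ratl_qpoch_isq (f : C -> C) (al : C) K : rat f -> rat (fun z => qpoch q (al * / z ^ 2) K * f z).
Proof.
  intros H. induction K as [|K IH].
  - apply ratl_ext with (2 := H). intros; simpl; ring.
  - apply ratl_ext with (2 := ratl_lin _ _ _ _ 1 (- al * q ^ K) _ _ IH (ratl_divz _ (ratl_divz _ IH))).
    intros z Hz. pose proof (nz z Hz). simpl. set (X := qpoch q _ K). field. assumption.
Qed.

Lemma ratl_qpoch_inv (f : C -> C) (al : C) K : q <> 0 -> al <> 0 ->
  (forall k, good (/ (al * q ^ k))) -> rat f ->
  rat (fun z => / qpoch q (al * z) K * f z).
Proof.
  intros Hq Ha Hp H.
  assert (Hn : forall z k, on_loops g1 g2 z -> 1 - al * z * q ^ k <> 0).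
  { intros z k Hz E. apply (good_pole_neq _ _ _ _ _ z (Hp k) Hz).
    pose proof (Cpow_nz q k Hq).
    replace (z - / (al * q ^ k)) with (- (1 - al * z * q ^ k) / (al * q ^ k)) by (field; split; assumption).
    rewrite E. unfold Cdiv. ring. }
  induction K as [|K IH].
  - apply ratl_ext with (2 := H). intros; simpl. field.
  - apply ratl_ext with (2 := ratl_lin _ _ _ _ (- / (al * q ^ K)) 0 _ _ (ratl_pole _ _ _ _ _ _ (Hp K) IH) IH).
    intros z Hz. pose proof (Hn z K Hz). pose proof (good_pole_neq _ _ _ _ _ z (Hp K) Hz).
    pose proof (Cpow_nz q K Hq).
    assert (qpoch q (al * z) K <> 0) by (apply qpoch_neq_0; auto).
    simpl. rewrite Cmult_0_l, Cplus_0_r.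
    assert (z * (al * q ^ K) - 1 <> 0).
    { replace (z * (al * q ^ K) - 1) with (- (1 - al * z * q ^ K)) by ring. intro E. apply H0.
      replace (1 - al * z * q ^ K) with (- - (1 - al * z * q ^ K)) by ring. rewrite E; ring. }
    field. repeat split; assumption.
Qed.

Lemma ratl_qpoch_iinv (f : C -> C) (al : C) K : (forall k, good (al * q ^ k)) -> rat f ->
  rat (fun z => / qpoch q (al / z) K * f z).
Proof.
  intros Hp H.
  assert (Hn : forall z k, on_loops g1 g2 z -> 1 - al / z * q ^ k <> 0).
  { intros z k Hz E. apply (good_pole_neq _ _ _ _ _ z (Hp k) Hz). pose proof (nz z Hz).
    replace (z - al * q ^ k) with (z * (1 - al / z * q ^ k)) by (field; assumption).
    rewrite E. ring. }
  induction K as [|K IH].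
  - apply ratl_ext with (2 := H). intros; simpl. field.
  - apply ratl_ext with (2 := ratl_mulz _ _ _ _ _ (ratl_pole _ _ _ _ _ _ (Hp K) IH)).
    intros z Hz. pose proof (Hn z K Hz). pose proof (good_pole_neq _ _ _ _ _ z (Hp K) Hz).
    pose proof (nz z Hz).
    assert (qpoch q (al / z) K <> 0) by (apply qpoch_neq_0; auto).
    simpl. field. repeat split; assumption.
Qed.

Lemma ratl_inv_lprod (q' : C) (es : list C) K : q <> 0 -> loop g1 dg1 -> loop g2 dg2 ->
  (forall e, In e es -> e * q' <> 0) ->
  (forall e k, In e es -> good (e * q ^ k)) -> (forall e k, In e es -> good (/ (e * q' * q ^ k))) ->
  rat (fun z => / lprod (fun e => qpoch q (e * q' * z) K * qpoch q (e / z) K) es).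
Proof.
  intros Hq HL1 HL2. induction es as [|e es IH]; intros He0 Hi Ho.
  - apply ratl_ext with (2 := ratl_1 _ _ _ _ HL1 HL2). intros; simpl. field.
  - assert (H : rat (fun z => / lprod (fun e => qpoch q (e * q' * z) K * qpoch q (e / z) K) es)).
    { apply IH; intros; [apply He0|apply Hi|apply Ho]; right; assumption. }
    apply ratl_ext with (2 := ratl_qpoch_inv _ (e * q') K Hq (He0 e (or_introl eq_refl))
      (fun k => Ho e k (or_introl eq_refl)) (ratl_qpoch_iinv _ e K (fun k => Hi e k (or_introl eq_refl)) H)).
    intros z Hz.
    assert (N1 : forall e, In e es -> qpoch q (e * q' * z) K * qpoch q (e / z) K <> 0 ).
    { intros e' He'. apply Cmult_neq_0; apply qpoch_neq_0; intros k _ E.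
      - apply (good_pole_neq _ _ _ _ _ z (Ho e' k (or_intror He')) Hz).
        pose proof (Cpow_nz q k Hq). pose proof (He0 e' (or_intror He')).
        replace (z - / (e' * q' * q ^ k)) with (- (1 - e' * q' * z * q ^ k) / (e' * q' * q ^ k))
          by (field; repeat split; try assumption; intro E'; apply H1; rewrite E'; ring).
        rewrite E. unfold Cdiv. ring.
      - apply (good_pole_neq _ _ _ _ _ z (Hi e' k (or_intror He')) Hz).
        replace (z - e' * q ^ k) with (z * (1 - e' / z * q ^ k)) by (field; apply nz; assumption).
        rewrite E. ring. }
    assert (N2 : qpoch q (e * q' * z) K <> 0).
    { apply qpoch_neq_0; intros k _ E.
      apply (good_pole_neq _ _ _ _ _ z (Ho e k (or_introl eq_refl)) Hz).
      pose proof (Cpow_nz q k Hq). pose proof (He0 e (or_introl eq_refl)).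
      replace (z - / (e * q' * q ^ k)) with (- (1 - e * q' * z * q ^ k) / (e * q' * q ^ k))
        by (field; repeat split; try assumption; intro E'; apply H1; rewrite E'; ring).
      rewrite E. unfold Cdiv. ring. }
    assert (N3 : qpoch q (e / z) K <> 0).
    { apply qpoch_neq_0; intros k _ E.
      apply (good_pole_neq _ _ _ _ _ z (Hi e k (or_introl eq_refl)) Hz).
      replace (z - e * q ^ k) with (z * (1 - e / z * q ^ k)) by (field; apply nz; assumption).
      rewrite E. ring. }
    pose proof (lprod_neq_0 _ _ N1) as N4. simpl lprod. unfold lprod in *. simpl.
    field. repeat split; assumption.
Qed.

Lemma ratl_PhiK (es : list C) K : q <> 0 -> loop g1 dg1 -> loop g2 dg2 ->
  (forall e, In e es -> e <> 0) ->
  (forall e k, In e es -> good (e * q ^ k)) -> (forall e k, In e es -> good (/ (e * q * q ^ k))) ->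
  rat (fun z => / z * PhiK q es K z).
Proof.
  intros Hq HL1 HL2 He0 Hi Ho.
  pose proof (ratl_inv_lprod q es K Hq HL1 HL2 (fun e H => Cmult_neq_0 _ _ (He0 e H) Hq) Hi Ho) as H.
  apply ratl_qpoch_isq with (al := RtoC 1) (K := K) in H.
  apply ratl_qpoch_sq with (al := q ^ 2) (K := K) in H.
  apply ratl_qpoch_sq with (al := q) (K := 1%nat) in H.
  apply ratl_divz in H. apply ratl_divz in H.
  apply ratl_ext with (2 := H). intros z _. unfold PhiK.
  replace (qpoch q (1 * / z ^ 2) K) with (qpoch q (/ z ^ 2) K) by (f_equal; ring).
  replace (qpoch q (q * z ^ 2) 1) with (1 - q * z ^ 2) by (simpl; ring).
  unfold Cdiv. ring.
Qed.

End RationalClosure.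

(** [Phi] is chosen so that its q-difference is the weight times a degree-one polynomial. *)
Lemma Phi_difference (q0 : R) (a b c d x : C) : (0 < q0 < 1)%R -> x <> 0 ->
  (forall e k, In e [a; b; c; d] -> 1 - e * x * RtoC q0 ^ k <> 0) ->
  (forall e k, In e [a; b; c; d] -> 1 - e / x * RtoC q0 ^ k <> 0) ->
  Phi q0 [a; b; c; d] x - Phi q0 [a; b; c; d] (/ RtoC q0 * x) =
  wt q0 [a; b; c; d] x *
  ((1 - a * b * c * d) * (x + / x) + (a * b * c + a * b * d + a * c * d + b * c * d - (a + b + c + d))).
Proof.
  intros Hq Hx Ho Hi.
  assert (Hq0 : RtoC q0 <> 0) by (intro E; apply RtoC_inj in E; lra).
  assert (S1 : forall e, In e [a; b; c; d] -> qpoch_inf q0 (e * x) = (1 - e * x) * qpoch_inf q0 (e * q0 * x)).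
  { intros e _. rewrite qpoch_inf_step by assumption. f_equal. f_equal. ring. }
  assert (S2 : forall e, In e [a; b; c; d] -> qpoch_inf q0 (e / x) = (1 - e / x) * qpoch_inf q0 (e / (/ RtoC q0 * x))).
  { intros e _. rewrite qpoch_inf_step by assumption. f_equal. f_equal. field. split; assumption. }
  assert (N1 : forall e, In e [a; b; c; d] -> qpoch_inf q0 (e * x) <> 0)
    by (intros; apply qpoch_inf_neq_0; auto).
  assert (N2 : forall e, In e [a; b; c; d] -> qpoch_inf q0 (e / x) <> 0)
    by (intros; apply qpoch_inf_neq_0; auto).
  assert (T1 : qpoch_inf q0 (x ^ 2) = (1 - x ^ 2) * ((1 - q0 * x ^ 2) * qpoch_inf q0 (RtoC q0 ^ 2 * x ^ 2))).
  { rewrite qpoch_inf_step by assumption. rewrite (qpoch_inf_step q0 (x ^ 2 * q0)) by assumption.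
    replace (x ^ 2 * q0 * q0) with (RtoC q0 ^ 2 * x ^ 2) by ring. f_equal. f_equal. ring. }
  assert (T2 : qpoch_inf q0 (/ x ^ 2) = (1 - / x ^ 2) * ((1 - q0 / x ^ 2) * qpoch_inf q0 (/ (/ RtoC q0 * x) ^ 2))).
  { rewrite qpoch_inf_step by assumption. rewrite (qpoch_inf_step q0 (/ x ^ 2 * q0)) by assumption.
    replace (/ x ^ 2 * q0 * q0) with (/ (/ RtoC q0 * x) ^ 2) by (field; split; assumption).
    f_equal. f_equal. unfold Cdiv. ring. }
  assert (E3 : RtoC q0 ^ 2 * (/ RtoC q0 * x) ^ 2 = x ^ 2) by (field; assumption).
  assert (E4 : forall e, e * q0 * (/ RtoC q0 * x) = e * x) by (intros; field; assumption).
  unfold wt, Phi. simpl lprod. rewrite E3, !E4.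
  rewrite T1, T2.
  assert (Na : In a [a; b; c; d]) by (simpl; auto). assert (Nb : In b [a; b; c; d]) by (simpl; auto).
  assert (Nc : In c [a; b; c; d]) by (simpl; auto). assert (Nd : In d [a; b; c; d]) by (simpl; auto).
  pose proof (N1 a Na) as A1. pose proof (N1 b Nb) as B1. pose proof (N1 c Nc) as C1. pose proof (N1 d Nd) as D1.
  pose proof (N2 a Na) as A2. pose proof (N2 b Nb) as B2. pose proof (N2 c Nc) as C2. pose proof (N2 d Nd) as D2.
  rewrite (S1 a Na) in A1 |- *. rewrite (S1 b Nb) in B1 |- *. rewrite (S1 c Nc) in C1 |- *. rewrite (S1 d Nd) in D1 |- *.
  rewrite (S2 a Na) in A2 |- *. rewrite (S2 b Nb) in B2 |- *. rewrite (S2 c Nc) in C2 |- *. rewrite (S2 d Nd) in D2 |- *.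
  set (P1 := qpoch_inf q0 (RtoC q0 ^ 2 * x ^ 2)) in *.
  set (P2 := qpoch_inf q0 (/ (/ RtoC q0 * x) ^ 2)) in *.
  set (a1 := qpoch_inf q0 (a * q0 * x)) in *. set (a2 := qpoch_inf q0 (a / (/ RtoC q0 * x))) in *.
  set (b1 := qpoch_inf q0 (b * q0 * x)) in *. set (b2 := qpoch_inf q0 (b / (/ RtoC q0 * x))) in *.
  set (c1 := qpoch_inf q0 (c * q0 * x)) in *. set (c2 := qpoch_inf q0 (c / (/ RtoC q0 * x))) in *.
  set (d1 := qpoch_inf q0 (d * q0 * x)) in *. set (d2 := qpoch_inf q0 (d / (/ RtoC q0 * x))) in *.
  clearbody P1 P2 a1 a2 b1 b2 c1 c2 d1 d2.
  assert (F : forall y z : C, y * z <> 0 -> y <> 0 /\ z <> 0).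
  { intros y z Hyz. split; intro E; apply Hyz; rewrite E; ring. }
  apply F in A1, B1, C1, D1, A2, B2, C2, D2.
  destruct A1, B1, C1, D1, A2, B2, C2, D2.
  assert (G : forall e, 1 - e / x <> 0 -> x - e <> 0).
  { intros e He E. apply He. replace (1 - e / x) with ((x - e) / x) by (field; assumption). rewrite E. unfold Cdiv; ring. }
  assert (x - a <> 0) by auto. assert (x - b <> 0) by auto. assert (x - c <> 0) by auto. assert (x - d <> 0) by auto.
  field. repeat split; assumption.
Qed.

(** * Admissible contours, the vanishing moment and the first contiguous relation *)

Definition admissible (q : C) (T : contour) (e : C) : Prop :=
  e <> 0 /\ forall k : nat, Defs.interior T (e * q ^ k) /\ exterior T (/ e * / q ^ k).

Lemma admissible_shift (q : C) T e : q <> 0 -> admissible q T e -> admissible q T (e * q).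
Proof.
  intros Hq [He H]. split; [now apply Cmult_neq_0|]. intros k. destruct (H (S k)) as [H1 H2].
  pose proof (Cpow_nz q k Hq). simpl in H1, H2.
  replace (e * q * q ^ k) with (e * (q * q ^ k)) by ring.
  replace (/ (e * q) * / q ^ k) with (/ e * / (q * q ^ k)) by (field; repeat split; assumption).
  split; assumption.
Qed.

Lemma two_pi_i_neq_0 : 2 * RtoC PI * Ci <> 0.
Proof.
  apply Cmult_neq_0; [apply Cmult_neq_0|].
  - intro E. apply RtoC_inj in E. lra.
  - intro E. apply RtoC_inj in E. pose proof PI_RGT_0. lra.
  - intro E. apply (f_equal snd) in E. simpl in E. lra.
Qed.

Lemma CI_winding (T : contour) (p : C) : avoids T p ->
  CI (fun t => / (path T t - p) * dpath T t) (2 * RtoC PI * Ci * winding T p).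
Proof.
  intros Hp. pose proof (loop_contour T) as L.
  destruct (CI_cont (fun t => / (path T t - p) * dpath T t)) as [v Hv].
  - intros t Ht. apply (ccont_mult (fun t => / (path T t - p))); [|apply L, Ht].
    apply ccont_inv; [apply Cneq_sub; intro E; apply (Hp t Ht); auto|].
    apply (ccont_plus (path T) (fun _ => - p)); [eapply loop_ccont; eassumption|apply ccont_const].
  - replace (2 * RtoC PI * Ci * winding T p) with v; [exact Hv|].
    unfold winding, cint. rewrite (CI_unique _ _ Hv).
    pose proof two_pi_i_neq_0 as N. set (w := 2 * RtoC PI * Ci) in *. clearbody w. field. assumption.
Qed.

(** The loop dilated by [c] winds about [p] as the original loop winds about [p / c]. *)
Lemma good_pole_scaled (T : contour) (c p : C) : c <> 0 -> avoids T p -> avoids T (p / c) ->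
  winding T p = winding T (p / c) ->
  good_pole (path T) (dpath T) (fun t => c * path T t) (fun t => c * dpath T t) p.
Proof.
  intros Hc H1 H2 E. split.
  - intros (t & Ht & [Et|Et]); [apply (H1 t Ht); auto|].
    apply (H2 t Ht). rewrite Et. field. assumption.
  - exists (2 * RtoC PI * Ci * winding T p). split; [now apply CI_winding|].
    rewrite E. apply CI_ext with (2 := CI_winding T (p / c) H2).
    intros t Ht. assert (path T t - p / c <> 0) by (apply Cneq_sub; intro E'; apply (H2 t Ht); auto).
    assert (c * path T t - p <> 0).
    { replace (c * path T t - p) with (c * (path T t - p / c)) by (field; assumption). now apply Cmult_neq_0. }
    field. repeat split; assumption.
Qed.

Section OnContour.

Variables (q0 : R) (T : contour).
Hypothesis Hq : (0 < q0 < 1)%R.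
Hypothesis HT0 : avoids T 0.
Let q := RtoC q0.
Let x := path T.
Let dx := fun t => dpath T t / path T t.
Let adm := admissible q T.

Lemma q_neq_0 : q <> 0.
Proof. intro E. apply RtoC_inj in E. lra. Qed.

Lemma one_sub_qpow k : 1 - q ^ S k <> 0.
Proof.
  unfold q. rewrite <- RtoC_pow, <- RtoC_minus. intro E. apply RtoC_inj in E.
  assert (q0 ^ S k < 1)%R; [|lra]. simpl.
  assert (0 < q0 ^ k <= 1)%R; [|nra]. split; [apply pow_lt; lra|].
  rewrite <- (pow1 k). apply pow_incr. lra.
Qed.

Lemma path_ccont t : I01 t -> ccont x t.
Proof. apply loop_ccont with (dpath T), loop_contour. Qed.

Lemma path_neq_0 t : I01 t -> x t <> 0.
Proof. intros Ht. apply HT0, Ht. Qed.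

Lemma dx_ccont t : I01 t -> ccont dx t.
Proof.
  intros Ht. apply (ccont_mult (dpath T)); [apply loop_contour, Ht|].
  apply ccont_inv; [now apply path_neq_0|now apply path_ccont].
Qed.

Lemma adm_in e t k : adm e -> I01 t -> 1 - e / x t * q ^ k <> 0.
Proof.
  intros [He H] Ht E. destruct (H k) as [[Hi _] _]. apply (Hi t Ht).
  pose proof (path_neq_0 t Ht) as Hx. change (path T t) with (x t).
  replace (e * q ^ k) with (x t * (1 - (1 - e / x t * q ^ k))) by (field; assumption).
  rewrite E. ring.
Qed.

Lemma adm_out e t k : adm e -> I01 t -> 1 - e * x t * q ^ k <> 0.
Proof.
  intros [He H] Ht E. destruct (H k) as [_ [Hi _]]. apply (Hi t Ht).
  pose proof (path_neq_0 t Ht) as Hx. pose proof (Cpow_nz q k q_neq_0). change (path T t) with (x t).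
  replace (/ e * / q ^ k) with (x t + (1 - e * x t * q ^ k) / (e * q ^ k)) by (field; split; assumption).
  rewrite E. unfold Cdiv. ring.
Qed.

Lemma adm_pole_free es : (forall e, In e es -> adm e) -> pole_free q es es x.
Proof.
  intros H. constructor.
  - apply path_ccont.
  - apply path_neq_0.
  - intros; apply adm_in; auto.
  - intros; apply adm_out; auto.
Qed.

(** For the dilation by [/ q] the inner pole [e * q ^ k] is compared with [e * q ^ S k], again
    inside, and the outer pole [/ (e * q * q ^ k)] with [/ (e * q ^ k)], still outside. The extra
    [q] in the factor [e * q * x] of [Phi] makes the second comparison possible. *)
Lemma adm_good es e k : (forall e, In e es -> adm e) -> In e es ->
  good_pole x (dpath T) (fun t => / q * x t) (fun t => / q * dpath T t) (e * q ^ k) /\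
  good_pole x (dpath T) (fun t => / q * x t) (fun t => / q * dpath T t) (/ (e * q * q ^ k)).
Proof.
  intros H He. destruct (H e He) as [He0 Hk]. pose proof q_neq_0 as Hq0. pose proof (Cpow_nz q k Hq0) as Hqk.
  pose proof (Cinv_neq_0 q Hq0) as Hqi. split.
  - apply good_pole_scaled; [assumption|apply Hk| |].
    + replace (e * q ^ k / / q) with (e * q ^ S k) by (simpl; field; assumption). apply Hk.
    + replace (e * q ^ k / / q) with (e * q ^ S k) by (simpl; field; assumption).
      destruct (Hk k) as [[_ ->] _]. destruct (Hk (S k)) as [[_ ->] _]. reflexivity.
  - replace (/ (e * q * q ^ k)) with (/ e * / q ^ S k) by (simpl; field; repeat split; assumption).
    apply good_pole_scaled; [assumption|apply Hk| |].
    + replace (/ e * / q ^ S k / / q) with (/ e * / q ^ k) by (simpl; field; repeat split; assumption). apply Hk.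
    + replace (/ e * / q ^ S k / / q) with (/ e * / q ^ k) by (simpl; field; repeat split; assumption).
      destruct (Hk k) as [_ [_ ->]]. destruct (Hk (S k)) as [_ [_ ->]]. reflexivity.
Qed.

Lemma good_0 (c : C) : c <> 0 ->
  good_pole x (dpath T) (fun t => c * x t) (fun t => c * dpath T t) 0.
Proof.
  intros Hc. apply good_pole_scaled; try assumption;
  replace (0 / c) with (RtoC 0) by (unfold Cdiv; ring); [assumption|reflexivity].
Qed.

(** By [Phi_difference] the integrand is [Phi (x) - Phi (/ q * x)] against [dx / x]. As [dx / x] is
    invariant under dilation, this is a difference of integrals over the contour and its
    dilation. *)
Lemma wt_moment (a b c d : C) : (forall e, In e [a; b; c; d] -> adm e) ->
  CI (fun t => wt q [a; b; c; d] (x t) *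
    (((1 - a * b * c * d) * (x t + / x t) +
      (a * b * c + a * b * d + a * c * d + b * c * d - (a + b + c + d))) * dx t)) 0.
Proof.
  intros H. set (es := [a; b; c; d]) in *.
  pose proof q_neq_0 as Hq0.
  pose proof (loop_contour T) as L. pose proof (loop_scal (/ q) _ _ L) as L'.
  assert (P1 : pole_free q es (map (fun e => e * q) es) x).
  { constructor; [apply path_ccont|apply path_neq_0|intros; apply adm_in; auto|].
    intros e He t k Ht. apply in_map_iff in He. destruct He as (e' & <- & He').
    apply adm_out; [|assumption]. apply admissible_shift; auto. exact (H e' He'). }
  assert (P2 : pole_free q es (map (fun e => e * q) es) (fun t => / q * x t)).
  { constructor.
    - intros t Ht. apply ccont_scal, path_ccont, Ht.
    - intros t Ht. apply Cmult_neq_0; [now apply Cinv_neq_0|now apply path_neq_0].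
    - intros e He t k Ht. pose proof (path_neq_0 t Ht).
      replace (e / (/ q * x t) * q ^ k) with (e * q / x t * q ^ k) by (field; split; assumption).
      apply adm_in; [|assumption]. apply admissible_shift; auto. exact (H e He).
    - intros e He t k Ht. apply in_map_iff in He. destruct He as (e' & <- & He').
      replace (e' * q * (/ q * x t)) with (e' * x t) by (field; assumption).
      apply adm_out; auto. }
  assert (V : forall K, exists v, CI (fun t => PhiK q es K (x t) * dx t) v /\
     CI (fun t => PhiK q es K (/ q * x t) * dx t) v).
  { intros K. pose proof (ratl_PhiK q _ _ _ _ (good_0 (/ q) (Cinv_neq_0 _ Hq0)) es K Hq0 L L') as R.
    destruct (ratl_same_int _ _ _ _ _ (R (fun e He => proj1 (H e He))
       (fun e k He => proj1 (adm_good es e k H He)) (fun e k He => proj2 (adm_good es e k H He)))) as (v & H1 & H2).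
    exists v. split.
    - apply CI_ext with (2 := H1). intros t Ht. unfold dx, Cdiv. fold x. ring.
    - apply CI_ext with (2 := H2). intros t Ht. unfold dx. fold x. pose proof (path_neq_0 t Ht).
      field. split; assumption. }
  set (v := fun K => proj1_sig (constructive_indefinite_description _ (V K))).
  assert (Hv : forall K, CI (fun t => PhiK q es K (x t) * dx t) (v K) /\
     CI (fun t => PhiK q es K (/ q * x t) * dx t) (v K))
    by (intros K; exact (proj2_sig (constructive_indefinite_description _ (V K)))).
  destruct (uconv_CI _ _ dx v (uconv_Phi q0 es x Hq P1) dx_ccont (fun K => proj1 (Hv K))) as (w & Hw & Cw).
  destruct (uconv_CI _ _ dx v (uconv_Phi q0 es _ Hq P2) dx_ccont (fun K => proj2 (Hv K))) as (w' & Hw' & Cw').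
  (* Every truncation has the same integral [v K] over both loops, so the two limits coincide. *)
  rewrite (cvg_unique _ _ _ Cw' Cw) in Hw'.
  pose proof (CI_plus _ _ _ _ Hw (CI_scal (- (1)) _ _ Hw')) as K.
  replace (w + - (1) * w) with (RtoC 0) in K by ring.
  apply CI_ext with (2 := K). intros t Ht. cbv beta.
  pose proof (Phi_difference q0 a b c d (x t) Hq (path_neq_0 t Ht)
    (fun e k He => adm_out e t k (H e He) Ht) (fun e k He => adm_in e t k (H e He) Ht)) as E.
  transitivity ((Phi q es (x t) - Phi q es (/ q * x t)) * dx t); [fold q; ring|].
  unfold es, q. rewrite E. ring.
Qed.

Lemma wt_shift (a : C) es t : adm a -> (forall e, In e es -> adm e) -> I01 t ->
  wt q (a * q :: es) (x t) = wt q (a :: es) (x t) * ((1 - a * x t) * (1 - a / x t)).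
Proof.
  intros Ha Hes Ht. unfold wt. simpl lprod.
  pose proof (path_neq_0 t Ht) as Hx.
  unfold q. rewrite (qpoch_inf_step q0 (a * x t) Hq), (qpoch_inf_step q0 (a / x t) Hq).
  replace (a * x t * q0) with (a * q0 * x t) by ring.
  replace (a / x t * q0) with (a * q0 / x t) by (unfold Cdiv; ring).
  assert (N1 : 1 - a * x t <> 0) by (pose proof (adm_out a t 0 Ha Ht) as E; simpl in E; rewrite Cmult_1_r in E; exact E).
  assert (N2 : 1 - a / x t <> 0) by (pose proof (adm_in a t 0 Ha Ht) as E; simpl in E; rewrite Cmult_1_r in E; exact E).
  assert (Ha' : adm (a * q)) by (apply admissible_shift; [apply q_neq_0|exact Ha]).
  assert (N3 : qpoch_inf q0 (a * q0 * x t) <> 0).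
  { apply qpoch_inf_neq_0; [exact Hq|]. intros k. exact (adm_out _ t k Ha' Ht). }
  assert (N4 : qpoch_inf q0 (a * q0 / x t) <> 0).
  { apply qpoch_inf_neq_0; [exact Hq|]. intros k. exact (adm_in _ t k Ha' Ht). }
  assert (N5 : lprod (fun e => qpoch_inf q0 (e * x t) * qpoch_inf q0 (e / x t)) es <> 0).
  { apply lprod_neq_0. intros e He. apply Cmult_neq_0; apply qpoch_inf_neq_0; try exact Hq; intros k.
    - exact (adm_out _ t k (Hes e He) Ht).
    - exact (adm_in _ t k (Hes e He) Ht). }
  set (l := lprod _ es) in *. set (u1 := qpoch_inf q0 (a * q0 * x t)) in *.
  set (u2 := qpoch_inf q0 (a * q0 / x t)) in *.
  set (y1 := 1 - a * x t) in *. set (y2 := 1 - a / x t) in *. clearbody l u1 u2 y1 y2.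
  field. repeat split; assumption.
Qed.

Definition IW (es : list C) (v : C) : Prop := CI (fun t => wt q es (x t) * dx t) v.

Lemma IW_exists es : (forall e, In e es -> adm e) -> exists v, IW es v.
Proof.
  intros H. apply (CI_wt_exists q0 es x dx Hq); [now apply adm_pole_free|exact dx_ccont].
Qed.

(** Replacing [a] by [a * q] multiplies the weight by [(1 - a * x) * (1 - a / x)], which is affine
    in [x + / x]. Subtracting a multiple of the vanishing moment leaves a constant, found at
    [x = a]. *)
Lemma IW_shift (a b c d v v' : C) : (forall e, In e [a; b; c; d] -> adm e) ->
  IW [a; b; c; d] v -> IW [a * q; b; c; d] v' ->
  (1 - a * b * c * d) * v' = (1 - a * b) * (1 - a * c) * (1 - a * d) * v.
Proof.
  intros H Hv Hv'. pose proof (wt_moment a b c d H) as H0.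
  assert (K : CI (fun t => (1 - a * b * c * d) * (wt q [a * q; b; c; d] (x t) * dx t)) ((1 - a * b) * (1 - a * c) * (1 - a * d) * v)).
  { pose proof (CI_plus _ _ _ _ (CI_scal ((1 - a * b) * (1 - a * c) * (1 - a * d)) _ _ Hv) (CI_scal (- a) _ _ H0)) as K.
    rewrite Cmult_0_r, Cplus_0_r in K.
    apply CI_ext with (2 := K). intros t Ht. cbv beta.
    rewrite (wt_shift a [b; c; d] t); [|apply H; simpl; auto|intros; apply H; simpl; auto|exact Ht].
    pose proof (path_neq_0 t Ht). set (w := wt q _ _). clearbody w. field. assumption. }
  apply (CI_inj _ _ _ (CI_scal _ _ _ Hv') K).
Qed.

End OnContour.

Lemma qpoch_S (q y : C) k : qpoch q y (S k) = qpoch q y k * (1 - y * q ^ k).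
Proof. reflexivity. Qed.

(** * Nonvanishing of the integral without parameters *)

Section Evaluation.

Variables (q0 : R) (T : contour).
Hypothesis Hq : (0 < q0 < 1)%R.
Hypothesis HT0 : avoids T 0.
Let q := RtoC q0.
Let x := path T.
Let dx := fun t => dpath T t / path T t.
Let adm := admissible q T.
Let IW := IW q0 T.

(** The winding number is 1 about the points [e * q ^ k], which tend to 0. As the contour avoids 0,
    uniform convergence of [/ (x - e * q ^ k)] carries this over to the point 0. *)
Lemma CI_dx (e : C) : adm e -> CI dx (2 * RtoC PI * Ci).
Proof.
  intros [He H].
  assert (Hx : forall t, I01 t -> ccont x t) by (intros; apply path_ccont; assumption).
  assert (U : uconv (fun k t => x t - e * q ^ k) x).
  { split; [|now apply ccont_ubd]. intros eps Heps.
    destruct (pow_q_small q0 Hq (Cmod e) eps (Cmod_ge_0 e) Heps) as [N HN].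
    exists N. intros n Hn t Ht. replace (x t - e * q ^ n - x t) with (- (e * q ^ n)) by ring.
    rewrite Cmod_opp, Cmod_mult. unfold q. rewrite Cmod_q by assumption. auto. }
  assert (U' : uconv (fun k t => / (x t - e * q ^ k)) (fun t => / x t)).
  { apply uconv_inv; [|exact U]. apply ccont_lower; [exact Hx|]. intros t Ht. apply path_neq_0; assumption. }
  destruct (uconv_CI _ _ (dpath T) (fun _ => 2 * RtoC PI * Ci) U') as (w & Hw & Cw).
  - apply loop_contour.
  - intros k. destruct (H k) as [[Ha Hk] _].
    pose proof (CI_winding T (e * q ^ k) Ha) as K. rewrite Hk, Cmult_1_r in K. exact K.
  - rewrite <- (cvg_unique _ _ _ Cw (cvg_const _)).
    apply CI_ext with (2 := Hw). intros t Ht. unfold dx, Cdiv. fold (x t). ring.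
Qed.

(** Truncated Jacobi theta function in [z ^ 2]; the weight without parameters is its limit times
    [1 - / z ^ 2]. The factor 1 matches the form [al * z ^ 2] of [ratl_qpoch_sq]. *)
Definition thetaK (K : nat) (z : C) : C := qpoch q (1 * z ^ 2) K * qpoch q (q * / z ^ 2) K.

(** Truncated form of the quasi-periodicity [theta (q * y) = - theta (y) / y] with [y = z ^ 2]. *)
Lemma thetaK_shift K (z s : C) : s * s = q -> z <> 0 ->
  (z ^ 2 - q ^ K) * thetaK K (s * z) = - (1 - z ^ 2 * q ^ K) * thetaK K z.
Proof.
  intros Hs Hz. pose proof (q_neq_0 q0 Hq) as Hq0. fold q in Hq0.
  assert (Hs0 : s <> 0) by (intro E; apply Hq0; rewrite <- Hs, E; ring).
  unfold thetaK.
  replace (1 * (s * z) ^ 2) with (q * z ^ 2) by (rewrite <- Hs; ring).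
  replace (q * / (s * z) ^ 2) with (/ z ^ 2) by (rewrite <- Hs; field; split; assumption).
  replace (1 * z ^ 2) with (z ^ 2) by ring.
  pose proof (qpoch_shift q (z ^ 2) K) as E1. rewrite qpoch_S in E1.
  pose proof (qpoch_shift q (/ z ^ 2) K) as E2. rewrite qpoch_S in E2.
  replace (z ^ 2 * q) with (q * z ^ 2) in E1 by ring. replace (/ z ^ 2 * q) with (q * / z ^ 2) in E2 by ring.
  set (u := qpoch q (q * z ^ 2) K) in *. set (v := qpoch q (/ z ^ 2) K) in *.
  transitivity (u * z ^ 2 * (v * (1 - / z ^ 2 * q ^ K))); [field; assumption|].
  rewrite E2. transitivity (- ((1 - z ^ 2) * u) * qpoch q (q * / z ^ 2) K); [field; assumption|].
  rewrite <- E1. ring.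
Qed.

(** The contour rescaled by a square root of [q] gives the same integrals, by [thetaK_shift]. *)
Lemma theta_moments K (m : C) : CI (fun t => thetaK K (x t) * dx t) m ->
  exists p n, CI (fun t => x t ^ 2 * thetaK K (x t) * dx t) p /\
    CI (fun t => / x t ^ 2 * thetaK K (x t) * dx t) n /\
    p * (1 - q ^ S K) = - (q * m * (1 - q ^ K)) /\ n * (1 - q ^ S K) = - (m * (1 - q ^ K)).
Proof.
  intros Hm. pose proof (q_neq_0 q0 Hq) as Hq0. fold q in Hq0.
  set (s := RtoC (sqrt q0)).
  assert (Hs : s * s = q) by (unfold s; rewrite <- RtoC_mult, sqrt_sqrt by lra; reflexivity).
  assert (Hs0 : s <> 0) by (intro E; apply Hq0; rewrite <- Hs, E; ring).
  pose proof (loop_contour T) as L. pose proof (loop_scal s _ _ L) as L'.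
  pose proof (good_0 T HT0 s Hs0) as G0.
  assert (R : ratl x (dpath T) (fun t => s * x t) (fun t => s * dpath T t) (thetaK K)).
  { pose proof (ratl_qpoch_sq q _ _ _ _ _ 1 K (ratl_qpoch_isq q _ _ _ _ G0 _ q K (ratl_1 _ _ _ _ L L'))) as R.
    apply ratl_ext with (2 := R). intros z _. unfold thetaK. ring. }
  pose proof (ratl_same_int _ _ _ _ _ (ratl_divz _ _ _ _ G0 _ R)) as (m' & M1 & M2).
  pose proof (ratl_same_int _ _ _ _ _ (ratl_divz _ _ _ _ G0 _ (ratl_mulz _ _ _ _ _ (ratl_mulz _ _ _ _ _ R)))) as (p & P1 & P2).
  pose proof (ratl_same_int _ _ _ _ _ (ratl_divz _ _ _ _ G0 _ (ratl_divz _ _ _ _ G0 _ (ratl_divz _ _ _ _ G0 _ R)))) as (n & N1 & N2).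
  assert (Hx : forall t, I01 t -> x t <> 0) by (intros; apply path_neq_0; assumption).
  assert (Em : m' = m).
  { apply (CI_inj (fun t => thetaK K (x t) * dx t)); [|exact Hm].
    apply CI_ext with (2 := M1). intros t Ht. unfold dx, Cdiv. fold (x t). ring. }
  subst m'. exists p, n.
  assert (P1' : CI (fun t => x t ^ 2 * thetaK K (x t) * dx t) p).
  { apply CI_ext with (2 := P1). intros t Ht. unfold dx, Cdiv. fold (x t). ring. }
  assert (N1' : CI (fun t => / x t ^ 2 * thetaK K (x t) * dx t) n).
  { apply CI_ext with (2 := N1). intros t Ht. unfold dx. fold (x t). field. auto. }
  assert (M2' : CI (fun t => thetaK K (s * x t) * dx t) m).
  { apply CI_ext with (2 := M2). intros t Ht. unfold dx. fold (x t). field. split; auto. }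
  assert (P2' : CI (fun t => q * (x t ^ 2 * thetaK K (s * x t) * dx t)) p).
  { apply CI_ext with (2 := P2). intros t Ht. unfold dx. fold (x t). rewrite <- Hs. field. split; auto. }
  assert (N2' : CI (fun t => / q * (/ x t ^ 2 * thetaK K (s * x t) * dx t)) n).
  { apply CI_ext with (2 := N2). intros t Ht. unfold dx. fold (x t). rewrite <- Hs. field. split; auto. }
  split; [exact P1'|]. split; [exact N1'|]. split.
  - assert (E : / q * p + - q ^ K * m = - (1) * m + q ^ K * p).
    { apply (CI_inj (fun t => (x t ^ 2 - q ^ K) * thetaK K (s * x t) * dx t)).
      - pose proof (CI_plus _ _ _ _ (CI_scal (/ q) _ _ P2') (CI_scal (- q ^ K) _ _ M2')) as Z.
        apply CI_ext with (2 := Z). intros t Ht. field. exact Hq0.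
      - pose proof (CI_plus _ _ _ _ (CI_scal (- (1)) _ _ Hm) (CI_scal (q ^ K) _ _ P1')) as Z.
        apply CI_ext with (2 := Z). intros t Ht. cbv beta. rewrite (thetaK_shift K (x t) s Hs (Hx t Ht)). ring. }
    replace (p * (1 - q ^ S K)) with (q * ((/ q * p + - q ^ K * m) + q ^ K * m - q ^ K * p)) by (simpl; field; exact Hq0).
    rewrite E. ring.
  - assert (E : 1 * m + - q ^ K * (q * n) = - (1) * n + q ^ K * m).
    { apply (CI_inj (fun t => / x t ^ 2 * ((x t ^ 2 - q ^ K) * thetaK K (s * x t)) * dx t)).
      - pose proof (CI_plus _ _ _ _ (CI_scal 1 _ _ M2') (CI_scal (- q ^ K) _ _ (CI_scal q _ _ N2'))) as Z.
        apply CI_ext with (2 := Z). intros t Ht. field. split; auto.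
      - pose proof (CI_plus _ _ _ _ (CI_scal (- (1)) _ _ N1') (CI_scal (q ^ K) _ _ Hm)) as Z.
        apply CI_ext with (2 := Z). intros t Ht. cbv beta. rewrite (thetaK_shift K (x t) s Hs (Hx t Ht)).
        field. auto. }
    replace (n * (1 - q ^ S K)) with (n - q ^ K * (q * n)) by (simpl; ring).
    replace (n - q ^ K * (q * n)) with ((1 * m + - q ^ K * (q * n)) - m + n) by ring.
    rewrite E. ring.
Qed.

Lemma RtoC_ratio_step K (c1 c2 : R) (m p n : C) :
  p * (1 - q ^ S K) = - (q * m * (1 - q ^ K)) -> n * (1 - q ^ S K) = - (m * (1 - q ^ K)) ->
  RtoC c1 * m + - (RtoC c2 * p) + - n = RtoC (c1 + (c2 * q0 + 1) * ((1 - q0 ^ K) / (1 - q0 ^ S K))) * m.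
Proof.
  intros Hp Hn. pose proof (one_sub_qpow q0 Hq K) as H. fold q in H.
  assert (E : RtoC ((1 - q0 ^ K) / (1 - q0 ^ S K)) = (1 - q ^ K) / (1 - q ^ S K)).
  { assert (H1 : (1 - q0 ^ S K <> 0)%R).
    { intro E. apply H. unfold q. rewrite <- RtoC_pow, <- RtoC_minus, E. reflexivity. }
    rewrite RtoC_div by exact H1. rewrite !RtoC_minus, !RtoC_pow. reflexivity. }
  rewrite RtoC_plus, RtoC_mult, E, RtoC_plus, RtoC_mult. fold q.
  assert (Ep : p = - (q * m * (1 - q ^ K)) / (1 - q ^ S K)) by (rewrite <- Hp; field; exact H).
  assert (En : n = - (m * (1 - q ^ K)) / (1 - q ^ S K)) by (rewrite <- Hn; field; exact H).
  rewrite Ep, En. field. exact H.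
Qed.

Lemma ratio_nonneg K : (0 <= (1 - q0 ^ K) / (1 - q0 ^ S K))%R.
Proof.
  assert (A : forall k, (0 < q0 ^ k <= 1)%R).
  { intros k. split; [apply pow_lt; lra|]. rewrite <- (pow1 k). apply pow_incr. lra. }
  assert (0 < 1 - q0 ^ S K)%R by (simpl; pose proof (A K); nra).
  apply Rmult_le_pos; [pose proof (A K); lra|]. left. now apply Rinv_0_lt_compat.
Qed.

(** [r] is the constant term of [thetaK], a q-binomial coefficient by the finite triple product. In
    the step the new factor is [1 + q ^ (2 * K + 1)] minus nonnegative multiples of [x ^ 2] and
    [/ x ^ 2]; by [theta_moments] the moments of these are nonpositive multiples of the previous
    integral, so [r] does not decrease. *)
Lemma theta_lower (e : C) K : adm e -> exists r : R, (1 <= r)%R /\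
  CI (fun t => thetaK K (x t) * dx t) (RtoC r * (2 * RtoC PI * Ci)).
Proof.
  intros He.
  assert (Hx : forall t, I01 t -> x t <> 0) by (intros; apply path_neq_0; assumption).
  induction K as [|K (r & Hr & HK)].
  - exists 1%R. split; [lra|]. rewrite Cmult_1_l.
    apply CI_ext with (2 := CI_dx e He). intros t Ht. unfold thetaK. simpl. ring.
  - destruct (theta_moments K _ HK) as (p & n & P & N & Ep & En).
    exists ((1 + q0 ^ (2 * K + 1) + (q0 ^ K * q0 + q0 ^ S K) * ((1 - q0 ^ K) / (1 - q0 ^ S K))) * r)%R. split.
    + pose proof (ratio_nonneg K). pose proof (pow_le q0 K ltac:(lra)). pose proof (pow_le q0 (S K) ltac:(lra)).
      pose proof (pow_le q0 (2 * K + 1) ltac:(lra)).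
      assert (0 <= (q0 ^ K * q0 + q0 ^ S K) * ((1 - q0 ^ K) / (1 - q0 ^ S K)))%R.
      { apply Rmult_le_pos; [|assumption]. apply Rplus_le_le_0_compat; [apply Rmult_le_pos; lra|assumption]. }
      nra.
    + pose proof (CI_plus _ _ _ _ (CI_plus _ _ _ _ (CI_scal (1 + q ^ (2 * K + 1)) _ _ HK) (CI_scal (- q ^ K) _ _ P))
        (CI_scal (- q ^ S K) _ _ N)) as Z.
      replace (RtoC ((1 + q0 ^ (2 * K + 1) + (q0 ^ K * q0 + q0 ^ S K) * ((1 - q0 ^ K) / (1 - q0 ^ S K))) * r) * (2 * RtoC PI * Ci))
        with ((1 + q ^ (2 * K + 1)) * (RtoC r * (2 * RtoC PI * Ci)) + - q ^ K * p + - q ^ S K * n).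
      * apply CI_ext with (2 := Z). intros t Ht. cbv beta. unfold thetaK. rewrite !qpoch_S.
        rewrite Cpow_add_r, Cpow_double. set (u := qpoch q (1 * x t ^ 2) K). set (v := qpoch q (q * / x t ^ 2) K).
        simpl Cpow. pose proof (Hx t Ht). field. assumption.
      * set (m := RtoC r * (2 * RtoC PI * Ci)) in *.
        assert (E : RtoC ((1 + q0 ^ (2 * K + 1) + (q0 ^ K * q0 + q0 ^ S K) * ((1 - q0 ^ K) / (1 - q0 ^ S K))) * r) * (2 * RtoC PI * Ci)
           = RtoC (1 + q0 ^ (2 * K + 1) + (q0 ^ K * q0 + q0 ^ S K) * ((1 - q0 ^ K) / (1 - q0 ^ S K))) * m)
          by (unfold m; rewrite RtoC_mult; ring).
        rewrite E.
        pose proof (one_sub_qpow q0 Hq K) as H. fold q in H.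
        assert (H1 : (1 - q0 ^ S K <> 0)%R).
        { intro E'. apply H. unfold q. rewrite <- RtoC_pow, <- RtoC_minus, E'. reflexivity. }
        assert (Er : RtoC ((1 - q0 ^ K) / (1 - q0 ^ S K)) = (1 - q ^ K) / (1 - q ^ S K)).
        { rewrite RtoC_div by exact H1. rewrite !RtoC_minus, !RtoC_pow. reflexivity. }
        rewrite RtoC_plus, RtoC_mult, Er, !RtoC_plus, RtoC_mult, !RtoC_pow. fold q.
        assert (Ep' : p = - (q * m * (1 - q ^ K)) / (1 - q ^ S K)) by (rewrite <- Ep; field; exact H).
        assert (En' : n = - (m * (1 - q ^ K)) / (1 - q ^ S K)) by (rewrite <- En; field; exact H).
        rewrite Ep', En'. simpl (q ^ S K) in *. field. exact H.
Qed.

(** The truncation of length [S K] is [thetaK K] times [(1 - q ^ K * x ^ 2) * (1 - / x ^ 2)]. Its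
    integral is again a real multiple, at least 1, of [2 * PI * Ci], and this bound survives the
    limit. *)
Lemma IW_nil_neq_0 (e w : C) : adm e -> IW [] w -> w <> 0.
Proof.
  intros He Hw.
  assert (Hx : forall t, I01 t -> x t <> 0) by (intros; apply path_neq_0; assumption).
  assert (V : forall K, exists r : R, (1 <= r)%R /\
    CI (fun t => wtK q [] (S K) (x t) * dx t) (RtoC r * (2 * RtoC PI * Ci))).
  { intros K. destruct (theta_lower e K He) as (r & Hr & HK).
    destruct (theta_moments K _ HK) as (p & n & P & N & Ep & En).
    exists ((1 + q0 ^ K + (q0 ^ K * q0 + 1) * ((1 - q0 ^ K) / (1 - q0 ^ S K))) * r)%R. split.
    - pose proof (ratio_nonneg K). pose proof (pow_le q0 K ltac:(lra)).
      assert (0 <= (q0 ^ K * q0 + 1) * ((1 - q0 ^ K) / (1 - q0 ^ S K)))%R by (apply Rmult_le_pos; nra).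
      nra.
    - pose proof (CI_plus _ _ _ _ (CI_plus _ _ _ _ (CI_scal (1 + q ^ K) _ _ HK) (CI_scal (- q ^ K) _ _ P))
        (CI_scal (- (1)) _ _ N)) as Z.
      set (m := RtoC r * (2 * RtoC PI * Ci)) in *.
      pose proof (RtoC_ratio_step K (1 + q0 ^ K) (q0 ^ K) m p n Ep En) as E.
      replace (RtoC ((1 + q0 ^ K + (q0 ^ K * q0 + 1) * ((1 - q0 ^ K) / (1 - q0 ^ S K))) * r) * (2 * RtoC PI * Ci))
        with ((1 + q ^ K) * m + - q ^ K * p + - (1) * n).
      + apply CI_ext with (2 := Z). intros t Ht. cbv beta. unfold thetaK, wtK. simpl lprod.
        pose proof (Hx t Ht).
        rewrite (qpoch_shift q (/ x t ^ 2)), qpoch_S.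
        replace (1 * x t ^ 2) with (x t ^ 2) by ring.
        replace (q * / x t ^ 2) with (/ x t ^ 2 * q) by ring.
        set (u := qpoch q (x t ^ 2) K). set (v := qpoch q (/ x t ^ 2 * q) K).
        simpl Cpow. field. assumption.
      + rewrite RtoC_mult, <- Cmult_assoc. fold m. rewrite <- E, RtoC_plus, RtoC_pow. fold q. ring. }
  set (r := fun K => proj1_sig (constructive_indefinite_description _ (V K))).
  assert (Hr : forall K, (1 <= r K)%R /\ CI (fun t => wtK q [] (S K) (x t) * dx t) (RtoC (r K) * (2 * RtoC PI * Ci)))
    by (intros K; exact (proj2_sig (constructive_indefinite_description _ (V K)))).
  destruct (uconv_wt q0 [] x Hq) as [U1 U2].
  { apply adm_pole_free; try assumption. intros e' []. }
  destruct (uconv_CI (fun K t => wtK q [] (S K) (x t)) (fun t => wt q [] (x t)) dx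
     (fun K => RtoC (r K) * (2 * RtoC PI * Ci))) as (w' & Hw' & Cw).
  - split; [|exact U2]. intros eps Heps. destruct (U1 eps Heps) as [N HN]. exists N. intros n Hn t Ht. apply HN; [lia|exact Ht].
  - intros t Ht. apply dx_ccont; assumption.
  - intros K. apply Hr.
  - rewrite (CI_inj _ _ _ Hw Hw'). apply Cmod_gt_0.
    apply Rlt_le_trans with (Cmod (2 * RtoC PI * Ci)); [apply Cmod_gt_0, two_pi_i_neq_0|].
    apply (cvg_ge _ _ _ O Cw). intros n _. cbv beta. rewrite (Cmod_mult (RtoC (r n))), Cmod_R.
    destruct (Hr n) as [H1 _]. rewrite Rabs_pos_eq by lra.
    pose proof (Cmod_ge_0 (2 * RtoC PI * Ci)). nra.
Qed.

End Evaluation.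

Lemma lprod_app (h : C -> C) es es' : lprod h (es ++ es') = lprod h es * lprod h es'.
Proof. induction es; simpl; [ring|]. rewrite IHes; ring. Qed.

Lemma lprod_map (h k : C -> C) es : lprod h (map k es) = lprod (fun e => h (k e)) es.
Proof. induction es; simpl; [reflexivity|]. now rewrite IHes. Qed.

Lemma lprod_mult (h k : C -> C) es : lprod (fun e => h e * k e) es = lprod h es * lprod k es.
Proof. induction es; simpl; [ring|]. rewrite IHes; ring. Qed.

Lemma lprod_perm (h : C -> C) es es' : Permutation es es' -> lprod h es = lprod h es'.
Proof.
  induction 1; simpl; [reflexivity|now rewrite IHPermutation|ring|congruence].
Qed.

(** * Ratios of integrals with different parameters *)

Section Ratios.

Variables (q0 : R) (T : contour).
Hypothesis Hq : (0 < q0 < 1)%R.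
Hypothesis HT0 : avoids T 0.
Let q := RtoC q0.
Let x := path T.
Let dx := fun t => dpath T t / path T t.
Let adm := admissible q T.
Let IW := IW q0 T.

Lemma adm_pow e K : adm e -> adm (e * q ^ K).
Proof.
  intros H. induction K.
  - simpl. rewrite Cmult_1_r. exact H.
  - replace (e * q ^ S K) with (e * q ^ K * q) by (simpl; ring).
    apply admissible_shift; [apply q_neq_0; exact Hq|exact IHK].
Qed.

Lemma IW_perm es es' v : Permutation es es' -> IW es v -> IW es' v.
Proof.
  intros P. apply CI_ext. intros t _. unfold wt. now rewrite (lprod_perm _ es es').
Qed.

Lemma adm_qpoch_neq_0 e t : adm e -> I01 t ->
  (forall K, qpoch q (e * x t) K <> 0 /\ qpoch q (e / x t) K <> 0) /\
  qpoch_inf q (e * x t) <> 0 /\ qpoch_inf q (e / x t) <> 0.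
Proof.
  intros He Ht. split; [intros K; split; apply qpoch_neq_0; intros|split; apply qpoch_inf_neq_0; try exact Hq; intros].
  - now apply (adm_out q0 T Hq HT0).
  - now apply (adm_in q0 T HT0).
  - now apply (adm_out q0 T Hq HT0).
  - now apply (adm_in q0 T HT0).
Qed.

(** Multiplying a parameter by [q ^ K] removes its first [K] factors from the denominator, so in the
    limit the parameter is dropped from the weight. *)
Lemma uconv_wt_limit es es' : (forall e, In e (es ++ es') -> adm e) ->
  uconv (fun K t => wt q (map (fun e => e * q ^ K) es ++ es') (x t)) (fun t => wt q es' (x t)).
Proof.
  intros H.
  assert (Hes : forall e, In e es -> adm e) by (intros; apply H, in_or_app; left; assumption).
  assert (Hes' : forall e, In e es' -> adm e) by (intros; apply H, in_or_app; right; assumption).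
  assert (Hc : forall t, I01 t -> ccont x t) by (intros; now apply path_ccont).
  assert (H0 : forall t, I01 t -> x t <> 0) by (intros; now apply path_neq_0).
  destruct (pole_free_lower q0 es es x Hq (adm_pole_free q0 T Hq HT0 es Hes)) as [L1 L2].
  apply uconv_ext with
    (f := fun K t => wt q es' (x t) * (lprod (fun e => qpoch q (e * x t) K * qpoch q (e / x t) K) es *
                      / lprod (fun e => qpoch_inf q (e * x t) * qpoch_inf q (e / x t)) es))
    (g := fun t => wt q es' (x t) * (lprod (fun e => qpoch_inf q (e * x t) * qpoch_inf q (e / x t)) es *
                      / lprod (fun e => qpoch_inf q (e * x t) * qpoch_inf q (e / x t)) es)).
  - intros K t Ht. unfold wt. rewrite lprod_app, lprod_map.
    rewrite (lprod_ext (fun e => qpoch_inf q (e * x t) * qpoch_inf q (e / x t))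
      (fun e => (qpoch q (e * x t) K * qpoch q (e / x t) K) *
                (qpoch_inf q (e * q ^ K * x t) * qpoch_inf q (e * q ^ K / x t))) es).
    + rewrite (lprod_mult (fun e => qpoch q (e * x t) K * qpoch q (e / x t) K)
        (fun e => qpoch_inf q (e * q ^ K * x t) * qpoch_inf q (e * q ^ K / x t))). cbv beta.
      assert (N1 : lprod (fun e => qpoch q (e * x t) K * qpoch q (e / x t) K) es <> 0).
      { apply lprod_neq_0. intros e He. apply Cmult_neq_0; apply (adm_qpoch_neq_0 e t (Hes e He) Ht). }
      assert (N2 : lprod (fun e => qpoch_inf q (e * q ^ K * x t) * qpoch_inf q (e * q ^ K / x t)) es <> 0).
      { apply lprod_neq_0. intros e He. apply Cmult_neq_0; apply (adm_qpoch_neq_0 _ t (adm_pow e K (Hes e He)) Ht). }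
      assert (N3 : lprod (fun e => qpoch_inf q (e * x t) * qpoch_inf q (e / x t)) es' <> 0).
      { apply lprod_neq_0. intros e He. apply Cmult_neq_0; apply (adm_qpoch_neq_0 _ t (Hes' e He) Ht). }
      set (l1 := lprod _ es) in *. set (l2 := lprod _ es) in *. set (l3 := lprod _ es') in *.
      clearbody l1 l2 l3. field. repeat split; assumption.
    + intros e _. unfold q. rewrite (qpoch_inf_split q0 (e * x t) K Hq), (qpoch_inf_split q0 (e / x t) K Hq).
      fold q. replace (e * x t * q ^ K) with (e * q ^ K * x t) by ring.
      replace (e / x t * q ^ K) with (e * q ^ K / x t) by (unfold Cdiv; ring). ring.
  - intros t Ht.
    assert (N3 : lprod (fun e => qpoch_inf q (e * x t) * qpoch_inf q (e / x t)) es <> 0).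
    { apply lprod_neq_0. intros e He. apply Cmult_neq_0; apply (adm_qpoch_neq_0 _ t (Hes e He) Ht). }
    field. exact N3.
  - apply (uconv_mult (fun _ t => wt q es' (x t))); [|apply uconv_mult].
    + split; [apply ucv_const|]. apply (uconv_wt q0 es' x Hq). now apply adm_pole_free.
    + apply (uconv_lprod (fun K t e => qpoch q (e * x t) K * qpoch q (e / x t) K)).
      intros e He. apply uconv_mult.
      * apply (uconv_qpoch q0 (fun t => e * x t)); [exact Hq|]. intros; apply ccont_scal; auto.
      * apply (uconv_qpoch q0 (fun t => e / x t)); [exact Hq|]. intros; apply ccont_scal_inv; auto.
    + assert (L : ulow (fun t => lprod (fun e => qpoch_inf q (e * x t) * qpoch_inf q (e / x t)) es)).
      { apply ulow_lprod. intros e He. apply ulow_mult; [apply L2, He|apply L1, He]. }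
      split; [apply ucv_const|]. now apply ubd_inv.
Qed.

Lemma IW_shift_iter (a b c d v v' : C) K : (forall e, In e [a; b; c; d] -> adm e) ->
  IW [a; b; c; d] v -> IW [a * q ^ K; b; c; d] v' ->
  qpoch q (a * b * c * d) K * v' = qpoch q (a * b) K * qpoch q (a * c) K * qpoch q (a * d) K * v.
Proof.
  intros H Hv. revert v'. induction K; intros v' Hv'.
  - simpl in *. rewrite Cmult_1_r in Hv'. rewrite (CI_inj _ _ _ Hv Hv'). ring.
  - assert (HK : forall e, In e [a * q ^ K; b; c; d] -> adm e).
    { intros e [<-|He]; [apply adm_pow|]; apply H; simpl in *; auto. }
    destruct (IW_exists q0 T Hq HT0 _ HK) as [u Hu].
    replace (a * q ^ S K) with (a * q ^ K * q) in Hv' by (simpl; ring).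
    pose proof (IW_shift q0 T Hq HT0 _ _ _ _ _ _ HK Hu Hv') as E.
    specialize (IHK u Hu). rewrite !qpoch_S.
    transitivity (qpoch q (a * b * c * d) K * ((1 - a * q ^ K * b * c * d) * v')); [ring|].
    rewrite E.
    transitivity ((1 - a * q ^ K * b) * (1 - a * q ^ K * c) * (1 - a * q ^ K * d) * (qpoch q (a * b * c * d) K * u)); [ring|].
    rewrite IHK. ring.
Qed.

(** The limit of [IW_shift_iter] as [K] grows. It compares the integrals with four and three
    parameters, which is all that [F] asks of them. *)
Lemma IW_drop (a b c d v w : C) : (forall e, In e [a; b; c; d] -> adm e) ->
  IW [a; b; c; d] v -> IW [b; c; d] w ->
  qpoch_inf q (a * b * c * d) * w =
  qpoch_inf q (a * b) * qpoch_inf q (a * c) * qpoch_inf q (a * d) * v.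
Proof.
  intros H Hv Hw.
  assert (V : forall K, exists u, IW [a * q ^ K; b; c; d] u).
  { intros K. apply (IW_exists q0 T Hq HT0). intros e [<-|He]; [apply adm_pow|]; apply H; simpl in *; auto. }
  set (u := fun K => proj1_sig (constructive_indefinite_description _ (V K))).
  assert (Hu : forall K, IW [a * q ^ K; b; c; d] (u K))
    by (intros K; exact (proj2_sig (constructive_indefinite_description _ (V K)))).
  destruct (uconv_CI _ _ dx u (uconv_wt_limit [a] [b; c; d] H) (fun t Ht => dx_ccont T HT0 t Ht) Hu) as (w' & Hw' & Cw).
  rewrite (CI_inj _ _ _ Hw' Hw) in Cw.
  apply cvg_unique with (fun K => qpoch q (a * b * c * d) K * u K).
  - apply cvg_mult; [now apply qpoch_cvg|exact Cw].
  - apply cvg_ext with (fun K => qpoch q (a * b) K * qpoch q (a * c) K * qpoch q (a * d) K * v).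
    + intros K. symmetry. now apply IW_shift_iter.
    + repeat (apply cvg_mult; [|apply cvg_const || now apply qpoch_cvg]). now apply qpoch_cvg.
Qed.

(** Formally this is [IW_shift] at [d = 0], a value that [admissible] excludes. Instead an auxiliary
    [d] is dropped by [IW_drop] from the integrals before and after the shift. *)
Lemma IW_shift3 (a b c d w w' : C) : (forall e, In e [a; b; c; d] -> adm e) ->
  (forall k, 1 - a * b * c * d * q ^ k <> 0) ->
  IW [a; b; c] w -> IW [a * q; b; c] w' -> w' = (1 - a * b) * (1 - a * c) * w.
Proof.
  intros H HM Hw Hw'.
  assert (P : forall y z u : C, Permutation [y; z; u; d] [d; y; z; u]).
  { intros. apply Permutation_sym. exact (Permutation_cons_append [y; z; u] d). }
  assert (H1 : forall e, In e [d; a; b; c] -> adm e) by (intros e He; apply H; simpl in *; tauto).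
  assert (H2 : forall e, In e [d; a * q; b; c] -> adm e).
  { intros e [<-|[<-|He]]; [apply H; simpl; auto|apply admissible_shift; [now apply q_neq_0|apply H; simpl; auto]|].
    apply H; simpl in *; tauto. }
  assert (H3 : forall e, In e [a * q; b; c; d] -> adm e) by (intros e He; apply H2; simpl in *; tauto).
  destruct (IW_exists q0 T Hq HT0 _ H) as [v Hv]. destruct (IW_exists q0 T Hq HT0 _ H3) as [v' Hv'].
  pose proof (IW_drop d a b c v w H1 (IW_perm _ _ _ (P a b c) Hv) Hw) as E1.
  pose proof (IW_drop d (a * q) b c v' w' H2 (IW_perm _ _ _ (P (a * q) b c) Hv') Hw') as E2.
  pose proof (IW_shift q0 T Hq HT0 _ _ _ _ _ _ H Hv Hv') as E3.
  assert (N : qpoch_inf q (d * a * b * c) <> 0).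
  { apply qpoch_inf_neq_0; [exact Hq|]. intros k. replace (d * a * b * c) with (a * b * c * d) by ring. apply HM. }
  unfold q in E1, N. rewrite (qpoch_inf_step q0 (d * a * b * c) Hq) in E1, N. rewrite (qpoch_inf_step q0 (d * a) Hq) in E1.
  fold q in E1, N.
  replace (d * a * b * c * q) with (d * (a * q) * b * c) in E1, N by ring.
  replace (d * a * q) with (d * (a * q)) in E1 by ring.
  set (Mi := qpoch_inf q (d * (a * q) * b * c)) in *.
  assert (E : (1 - d * a * b * c) * Mi * w' = (1 - d * a * b * c) * Mi * ((1 - a * b) * (1 - a * c) * w)).
  { transitivity ((1 - d * a * b * c) * (Mi * w')); [ring|]. rewrite E2.
    transitivity (qpoch_inf q (d * (a * q)) * qpoch_inf q (d * b) * qpoch_inf q (d * c) * ((1 - a * b * c * d) * v')); [ring|].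
    rewrite E3.
    transitivity ((1 - a * b) * (1 - a * c) * ((1 - d * a) * qpoch_inf q (d * (a * q)) * qpoch_inf q (d * b) * qpoch_inf q (d * c) * v)); [ring|].
    rewrite <- E1. ring. }
  set (X := (1 - d * a * b * c) * Mi) in *. clearbody X.
  transitivity (/ X * (X * w')); [field; exact N|]. rewrite E. field. exact N.
Qed.

Lemma IW_shift3_iter (a b c d w w' : C) K : (forall e, In e [a; b; c; d] -> adm e) ->
  (forall k, 1 - a * b * c * d * q ^ k <> 0) ->
  IW [a; b; c] w -> IW [a * q ^ K; b; c] w' -> w' = qpoch q (a * b) K * qpoch q (a * c) K * w.
Proof.
  intros H HM Hw. revert w'. induction K; intros w' Hw'.
  - simpl in *. rewrite Cmult_1_r in Hw'. rewrite (CI_inj _ _ _ Hw' Hw). ring.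
  - assert (HK : forall e, In e [a * q ^ K; b; c; d] -> adm e).
    { intros e [<-|He]; [apply adm_pow|]; apply H; simpl in *; auto. }
    destruct (IW_exists q0 T Hq HT0 [a * q ^ K; b; c]) as [u Hu]; [intros e He; apply HK; simpl in *; tauto|].
    replace (a * q ^ S K) with (a * q ^ K * q) in Hw' by (simpl; ring).
    assert (HMK : forall k, 1 - a * q ^ K * b * c * d * q ^ k <> 0).
    { intros k. pose proof (HM (K + k)%nat) as E. rewrite Cpow_add_r in E.
      replace (a * q ^ K * b * c * d * q ^ k) with (a * b * c * d * (q ^ K * q ^ k)) by ring. exact E. }
    rewrite (IW_shift3 _ _ _ _ _ _ HK HMK Hu Hw'), (IHK u Hu), !qpoch_S. ring.
Qed.

(** Shifting [a] first turns the pair [a * b] into [a * b * q ^ k], whence the factor with [j + k].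
    This is the only coupling of the two indices, and [qpoch_add_newton] is designed to separate
    it. *)
Lemma IW_shift3_two (a b c d w w' : C) k j : (forall e, In e [a; b; c; d] -> adm e) ->
  (forall k, 1 - a * b * c * d * q ^ k <> 0) ->
  IW [a; b; c] w -> IW [a * q ^ k; b * q ^ j; c] w' ->
  w' = qpoch q (a * b) (j + k) * qpoch q (a * c) k * qpoch q (b * c) j * w.
Proof.
  intros H HM Hw Hw'.
  assert (H1 : forall e, In e [b; a * q ^ k; c; d] -> adm e).
  { intros e [<-|[<-|He]]; [apply H; simpl; auto|apply adm_pow, H; simpl; auto|]. apply H; simpl in *; tauto. }
  destruct (IW_exists q0 T Hq HT0 [a * q ^ k; b; c]) as [u Hu]; [intros e He; apply H1; simpl in *; tauto|].
  assert (HMk : forall k', 1 - b * (a * q ^ k) * c * d * q ^ k' <> 0).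
  { intros k'. pose proof (HM (k + k')%nat) as E. rewrite Cpow_add_r in E.
    replace (b * (a * q ^ k) * c * d * q ^ k') with (a * b * c * d * (q ^ k * q ^ k')) by ring. exact E. }
  rewrite (IW_shift3_iter b (a * q ^ k) c d u w' j H1 HMk).
  - rewrite (IW_shift3_iter a b c d w u k H HM Hw Hu).
    rewrite Nat.add_comm, qpoch_add. replace (b * (a * q ^ k)) with (a * b * q ^ k) by ring. ring.
  - apply IW_perm with (2 := Hu). constructor.
  - apply IW_perm with (2 := Hw'). constructor.
Qed.

(** If the integral were 0, [IW_shift_iter] would keep it 0 under all shifts, and so would the limit
    in which every parameter is dropped, against [IW_nil_neq_0]. *)
Lemma IW4_neq_0 (a b c d v : C) : (forall e, In e [a; b; c; d] -> adm e) ->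
  (forall k, 1 - a * b * c * d * q ^ k <> 0) -> IW [a; b; c; d] v -> v <> 0.
Proof.
  intros H HM Hv E. rewrite E in Hv.
  (* Shifts the first parameter and rotates the list, so that four applications treat each parameter
     once. *)
  assert (St : forall K y1 y2 y3 y4, (forall e, In e [y1; y2; y3; y4] -> adm e) ->
     (forall k, 1 - y1 * y2 * y3 * y4 * q ^ k <> 0) -> IW [y1; y2; y3; y4] 0 ->
     (forall e, In e [y2; y3; y4; y1 * q ^ K] -> adm e) /\
     (forall k, 1 - y2 * y3 * y4 * (y1 * q ^ K) * q ^ k <> 0) /\ IW [y2; y3; y4; y1 * q ^ K] 0).
  { intros K y1 y2 y3 y4 Hy HyM Hy0.
    assert (HK : forall e, In e [y1 * q ^ K; y2; y3; y4] -> adm e).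
    { intros e [<-|He]; [apply adm_pow|]; apply Hy; simpl in *; auto. }
    split; [|split].
    - intros e He. apply HK. simpl in *. tauto.
    - intros k. pose proof (HyM (K + k)%nat) as E'. rewrite Cpow_add_r in E'.
      replace (y2 * y3 * y4 * (y1 * q ^ K) * q ^ k) with (y1 * y2 * y3 * y4 * (q ^ K * q ^ k)) by ring. exact E'.
    - destruct (IW_exists q0 T Hq HT0 _ HK) as [u Hu].
      pose proof (IW_shift_iter _ _ _ _ _ _ K Hy Hy0 Hu) as E'. rewrite Cmult_0_r in E'.
      assert (N : qpoch q (y1 * y2 * y3 * y4) K <> 0) by (apply qpoch_neq_0; auto).
      destruct (Cmult_integral_contra _ _ E') as [E''|E'']; [contradiction|].
      rewrite E'' in Hu. apply IW_perm with (2 := Hu). exact (Permutation_cons_append [y2; y3; y4] (y1 * q ^ K)). }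
  assert (Z : forall K, IW (map (fun e => e * q ^ K) [a; b; c; d] ++ []) 0).
  { intros K. destruct (St K _ _ _ _ H HM Hv) as (A1 & A2 & A3).
    destruct (St K _ _ _ _ A1 A2 A3) as (B1 & B2 & B3). destruct (St K _ _ _ _ B1 B2 B3) as (C1 & C2 & C3).
    exact (proj2 (proj2 (St K _ _ _ _ C1 C2 C3))). }
  destruct (uconv_CI _ _ dx (fun _ => 0) (uconv_wt_limit [a; b; c; d] [] H) (fun t Ht => dx_ccont T HT0 t Ht) Z) as (w & Hw & Cw).
  apply (IW_nil_neq_0 q0 T Hq HT0 a w); [apply H; simpl; auto|exact Hw|].
  symmetry. apply (cvg_unique _ _ _ (cvg_const 0) Cw).
Qed.

End Ratios.

(** * Spectrum, Gaussian and the space A *)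

Lemma csqrt_sqr (z : C) : csqrt z * csqrt z = z.
Proof.
  destruct z as [a b]. unfold csqrt.
  set (m := Cmod (a, b)).
  assert (Hm : (m * m = a * a + b * b)%R).
  { unfold m. pose proof (Cmod2_alt (a, b)) as E. unfold Re, Im in E. simpl in E. lra. }
  assert (Hm0 : (0 <= m)%R) by apply Cmod_ge_0.
  simpl Re. simpl Im.
  assert (H1 : (0 <= (m + a) / 2)%R) by nra.
  assert (H2 : (0 <= (m - a) / 2)%R) by nra.
  assert (H3 : (sqrt ((m + a) / 2) * sqrt ((m - a) / 2) = Rabs b / 2)%R).
  { rewrite <- sqrt_mult by assumption.
    replace ((m + a) / 2 * ((m - a) / 2))%R with ((Rabs b / 2) * (Rabs b / 2))%R.
    - apply sqrt_square. pose proof (Rabs_pos b). lra.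
    - pose proof (Rsqr_abs b) as E. unfold Rsqr in E. nra. }
  pose proof (sqrt_sqrt _ H1) as S1. pose proof (sqrt_sqrt _ H2) as S2.
  set (u := sqrt ((m + a) / 2)) in *. set (v := sqrt ((m - a) / 2)) in *.
  destruct (Rlt_dec b 0) as [Hb|Hb]; unfold Cmult; simpl; f_equal.
  - lra.
  - rewrite Rabs_left in H3 by exact Hb. lra.
  - lra.
  - rewrite Rabs_pos_eq in H3 by lra. lra.
Qed.

Lemma Cinv_0 : / RtoC 0 = 0.
Proof. unfold Cinv, RtoC. simpl. f_equal; unfold Rdiv; ring. Qed.

(** With [/ 0 = 0] this includes 0, so [/ gauss] is the product [ginv] also at the poles of the
    Gaussian. *)
Lemma Cinv_inv_all (z : C) : / / z = z.
Proof.
  destruct (Ceq_dec z 0) as [->|H]; [rewrite !Cinv_0; reflexivity|]. field. exact H.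
Qed.

Lemma sum_n_csum_Re (u : nat -> C) n : sum_n (fun k => Re (u k)) n = Re (csum u (S n)).
Proof.
  induction n.
  - rewrite sum_O. simpl. unfold Re. simpl. ring.
  - rewrite sum_Sn, IHn. reflexivity.
Qed.

Lemma sum_n_csum_Im (u : nat -> C) n : sum_n (fun k => Im (u k)) n = Im (csum u (S n)).
Proof.
  induction n.
  - rewrite sum_O. simpl. unfold Im. simpl. ring.
  - rewrite sum_Sn, IHn. reflexivity.
Qed.

Lemma cvg_CSeries (u : nat -> C) (l : C) : cvg (fun n => csum u (S n)) l -> CSeries u = l.
Proof.
  intros H. unfold CSeries, Series.
  rewrite (is_lim_seq_unique (sum_n (fun n => Re (u n))) (Re l)).
  - rewrite (is_lim_seq_unique (sum_n (fun n => Im (u n))) (Im l)).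
    + destruct l; reflexivity.
    + apply is_lim_seq_ext with (2 := cvg_Im _ _ H). intros; symmetry; apply sum_n_csum_Im.
  - apply is_lim_seq_ext with (2 := cvg_Re _ _ H). intros; symmetry; apply sum_n_csum_Re.
Qed.

Lemma CSeries_ext (u v : nat -> C) : (forall n, u n = v n) -> CSeries u = CSeries v.
Proof.
  intros E. unfold CSeries. f_equal; apply Series_ext; intros; now rewrite E.
Qed.

Lemma CSeries_finite (u : nat -> C) N : (forall k, (N <= k)%nat -> u k = 0) -> CSeries u = csum u N.
Proof.
  intros H. apply cvg_CSeries. apply cvg_ext_loc with (fun _ => csum u N) N; [|apply cvg_const].
  intros n Hn. symmetry. apply csum_extend; [lia|exact H].
Qed.

Lemma AWpoly_awE (q a b c d : C) n (x : C) : q <> 0 ->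
  AWpoly q (Params a b c d) n x = awE q a b c d n x.
Proof.
  intros Hq. unfold AWpoly, phi43, awE.
  rewrite (CSeries_ext _ (fun k => awU q a b c d n k * awR q a b c d k * awphi q a x k)).
  - apply CSeries_finite. intros k Hk. rewrite awU_trunc by (assumption || lia). ring.
  - intros k. unfold qpochs, awU, awR, awphi. simpl fold_right. rewrite !Cmult_1_r. unfold Cdiv.
    rewrite !Cmult_assoc. ring.
Qed.

Lemma AWweight_wt (q a b c d x : C) : AWweight q (Params a b c d) x = wt q [a; b; c; d] x.
Proof.
  unfold AWweight, wt. cbv beta iota delta [qpochs_inf lprod fold_right]. unfold Cdiv. f_equal; [ring|]. f_equal. ring.
Qed.

Definition ginv (q d x : C) : C := qpoch_inf q (d * x) * qpoch_inf q (d / x).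

Lemma gauss_ginv (q a b c d x : C) : / gauss q (Params a b c d) x = ginv q d x.
Proof. unfold gauss, qpochs_inf, ginv. simpl. rewrite Cinv_inv_all. ring. Qed.

Lemma ptilde_sqr (q : C) (al : params) : ptilde q al * ptilde q al = / q * pa al * pb al * pc al * pd al.
Proof. apply csqrt_sqr. Qed.

Lemma ptilde_neq_0 (q : C) (al : params) : q <> 0 -> (forall e, In e (plist al) -> e <> 0) -> ptilde q al <> 0.
Proof.
  intros Hq H E. pose proof (ptilde_sqr q al) as S. rewrite E, Cmult_0_l in S. symmetry in S. revert S.
  repeat apply Cmult_neq_0; try (apply H; simpl; auto; fail). now apply Cinv_neq_0.
Qed.

Lemma qpow_inj (q0 : R) m n : (0 < q0 < 1)%R -> RtoC q0 ^ m = RtoC q0 ^ n -> m = n.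
Proof.
  intros Hq E. rewrite <- !RtoC_pow in E. apply RtoC_inj in E.
  assert (D : forall i j, (i < j)%nat -> (q0 ^ j < q0 ^ i)%R).
  { intros i j Hij. replace j with (i + S (j - i - 1))%nat by lia. rewrite pow_add.
    assert (0 < q0 ^ i)%R by (apply pow_lt; lra).
    assert (q0 ^ S (j - i - 1) < 1)%R; [|nra]. simpl.
    assert (0 < q0 ^ (j - i - 1) <= 1)%R; [|nra]. split; [apply pow_lt; lra|].
    rewrite <- (pow1 (j - i - 1)). apply pow_incr. lra. }
  destruct (lt_eq_lt_dec m n) as [[L|L]|L]; [|exact L|]; apply D in L; lra.
Qed.

Lemma spec_index_pt (q0 : R) (al : params) m : (0 < q0 < 1)%R -> ptilde q0 al <> 0 ->
  spec_index q0 al (spec_pt q0 al m) = m.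
Proof.
  intros Hq Hp. unfold spec_index.
  pose proof (epsilon_spec (inhabits O) (fun k => spec_pt q0 al m = spec_pt q0 al k) (ex_intro _ m eq_refl)) as E.
  cbv beta in E. set (k := epsilon _ _) in *. unfold spec_pt in E.
  symmetry. apply (qpow_inj q0 m k Hq).
  transitivity (/ ptilde q0 al * (ptilde q0 al * RtoC q0 ^ m)); [field; exact Hp|].
  rewrite E. field. exact Hp.
Qed.

Lemma AWE_awE (q0 : R) (al : params) m (x : C) : (0 < q0 < 1)%R -> ptilde q0 al <> 0 ->
  AWE q0 al (spec_pt q0 al m) x = awE q0 (pa al) (pb al) (pc al) (pd al) m x.
Proof.
  intros Hq Hp. unfold AWE. rewrite spec_index_pt by assumption.
  destruct al as [a b c d]. apply AWpoly_awE. now apply q_neq_0.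
Qed.

Lemma eq_on_sym X f g : eq_on X f g -> eq_on X g f.
Proof. intros H x Hx. symmetry. auto. Qed.

Lemma spaceA_ext (f g : C -> C) : eq_on Cstar f g -> spaceA f -> spaceA g.
Proof.
  intros E (n & c & H). exists n, c. intros x Hx. rewrite <- E by exact Hx. auto.
Qed.

Lemma sum_n_scal_C (k : C) (u : nat -> C) n : sum_n (fun i => k * u i) n = k * sum_n u n.
Proof.
  induction n.
  - rewrite !sum_O. reflexivity.
  - rewrite !sum_Sn, IHn. unfold plus. simpl. ring.
Qed.

Lemma sum_n_pad (u : nat -> C) n m : (n <= m)%nat ->
  sum_n (fun i => if le_dec i n then u i else RtoC 0) m = sum_n u n.
Proof.
  intros H. induction H.
  - apply sum_n_ext_loc. intros i Hi. destruct (le_dec i n); [reflexivity|contradiction].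
  - rewrite sum_Sn, IHle. destruct (le_dec (S m) n); [lia|]. unfold plus. simpl. ring.
Qed.

Lemma spaceA_1 : spaceA (fun _ => 1).
Proof. exists O, (fun _ => 1). intros x _. rewrite sum_O. simpl. ring. Qed.

Lemma spaceA_lin (k1 k2 : C) (f g : C -> C) : spaceA f -> spaceA g -> spaceA (fun x => k1 * f x + k2 * g x).
Proof.
  intros (n & c & Hf) (m & e & Hg).
  exists (max n m), (fun i => k1 * (if le_dec i n then c i else 0) + k2 * (if le_dec i m then e i else 0)).
  intros x Hx. rewrite Hf, Hg by exact Hx.
  rewrite <- (sum_n_pad (fun k => c k * (x + / x) ^ k) n (max n m)) by lia.
  rewrite <- (sum_n_pad (fun k => e k * (x + / x) ^ k) m (max n m)) by lia.
  rewrite <- !sum_n_scal_C.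
  change (plus (sum_n (fun i => k1 * (if le_dec i n then c i * (x + / x) ^ i else 0)) (max n m))
     (sum_n (fun i => k2 * (if le_dec i m then e i * (x + / x) ^ i else 0)) (max n m)) =
     sum_n (fun k => (k1 * (if le_dec k n then c k else 0) + k2 * (if le_dec k m then e k else 0)) * (x + / x) ^ k) (max n m)).
  rewrite <- sum_n_plus. apply sum_n_ext. intros i.
  unfold plus; simpl. destruct (le_dec i n), (le_dec i m); ring.
Qed.

Lemma spaceA_X (f : C -> C) : spaceA f -> spaceA (fun x => (x + / x) * f x).
Proof.
  intros (n & c & Hf). exists (S n), (fun k => match k with O => RtoC 0 | S j => c j end).
  intros x Hx. rewrite Hf by exact Hx. clear Hf.
  induction n.
  - rewrite sum_Sn, !sum_O. unfold plus. simpl. ring.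
  - rewrite (sum_Sn _ (S n)), <- IHn, sum_Sn. unfold plus. simpl. ring.
Qed.

(** The space is generated from 1 by linear combinations and multiplication by [x + / x]. Existence
    of integrals, growth on the spectrum and the inversion formula are all proved along these
    generators. *)
Lemma spaceA_ind (P : (C -> C) -> Prop) :
  (forall f g, eq_on Cstar f g -> P f -> P g) -> P (fun _ => 1) ->
  (forall k1 k2 f g, P f -> P g -> P (fun x => k1 * f x + k2 * g x)) ->
  (forall f, P f -> P (fun x => (x + / x) * f x)) ->
  forall p, spaceA p -> P p.
Proof.
  intros He H1 Hl HX p (n & c & Hp). apply He with (1 := eq_on_sym _ _ _ Hp). clear p Hp.
  assert (HP : forall k, P (fun x => (x + / x) ^ k)).
  { induction k; [apply He with (2 := H1); intros x _; reflexivity|].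
    apply He with (2 := HX _ IHk). intros x _; reflexivity. }
  induction n.
  - apply He with (2 := Hl (c O) 0 _ _ H1 H1). intros x _. rewrite sum_O. simpl. ring.
  - apply He with (2 := Hl 1 (c (S n)) _ _ IHn (HP (S n))). intros x _. rewrite sum_Sn. unfold plus. simpl. ring.
Qed.

Inductive spanned (E : nat -> C -> C) : (C -> C) -> Prop :=
| sp_elt n : spanned E (E n)
| sp_lin k1 k2 f g : spanned E f -> spanned E g -> spanned E (fun x => k1 * f x + k2 * g x)
| sp_ext f g : eq_on Cstar f g -> spanned E f -> spanned E g.

(** The span contains the polynomial 1 of degree 0, and the three-term recurrence makes it stable
    under [x + / x]. *)
Lemma spaceA_spanned (q a b c d : C) p : awok q a b c d -> spaceA p -> spanned (awE q a b c d) p.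
Proof.
  intros H. apply spaceA_ind.
  - apply sp_ext.
  - apply sp_ext with (2 := sp_elt _ O). intros x _. apply awE_0.
  - apply sp_lin.
  - induction 1 as [n|k1 k2 f g Hf IHf Hg IHg|f g E Hf IHf].
    + eapply sp_ext; [|apply (sp_lin _ 1 1 _ _ (sp_lin _ (awA q a b c d n) (awB q a b c d n) _ _ (sp_elt _ (S n)) (sp_elt _ n))
        (sp_lin _ (awC q a b c d n) 0 _ _ (sp_elt _ (pred n)) (sp_elt _ n)))].
      intros x Hx. cbv beta. rewrite (awE_recurrence _ _ _ _ _ n x H Hx). ring.
    + eapply sp_ext; [|apply (sp_lin _ k1 k2 _ _ IHf IHg)]. intros x _; cbv beta; ring.
    + eapply sp_ext; [|apply IHf]. intros x Hx. cbv beta. now rewrite E.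
Qed.

Lemma spaceA_awE (q a b c d : C) n : awok q a b c d -> spaceA (awE q a b c d n).
Proof.
  intros H. cut (spaceA (awE q a b c d n) /\ spaceA (awE q a b c d (pred n))); [tauto|].
  induction n as [|n [IH1 IH2]].
  - simpl pred. cut (spaceA (awE q a b c d 0)); [tauto|].
    apply spaceA_ext with (2 := spaceA_1). intros x _. symmetry. apply awE_0.
  - split; [|exact IH1]. pose proof (awA_neq_0 _ _ _ _ _ n H) as HA.
    apply spaceA_ext with (2 := spaceA_lin (/ awA q a b c d n) 1 _ _ (spaceA_lin 1 (- awB q a b c d n) _ _ (spaceA_X _ IH1) IH1)
       (spaceA_lin (- awC q a b c d n / awA q a b c d n) 0 _ _ IH2 IH2)).
    intros x Hx. cbv beta. rewrite (awE_recurrence _ _ _ _ _ n x H Hx). field. exact HA.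
Qed.

(** Reverses the order of the factors. At spectral points the Gaussians contain negative powers of
    [q]; this turns them into an ordinary shifted factorial and a power [q ^ (m * (m - 1) / 2)]. *)
Lemma qpoch_reverse (q z : C) m : q <> 0 -> z <> 0 ->
  qpoch q (q / z / q ^ m) m * ((- z) ^ m * q ^ (m * (m - 1) / 2)) = qpoch q z m.
Proof.
  intros Hq Hz. induction m as [|m IH]; [simpl; ring|].
  pose proof (Cpow_nz q m Hq).
  replace (S m * (S m - 1) / 2)%nat with (m * (m - 1) / 2 + m)%nat.
  - rewrite Cpow_add_r, qpoch_shift.
    replace (q / z / q ^ S m * q) with (q / z / q ^ m) by (simpl; field; repeat split; assumption).
    rewrite qpoch_S, <- IH. simpl Cpow. field. repeat split; assumption.
  - replace (S m * (S m - 1))%nat with (m * (m - 1) + m * 2)%nat by (destruct m; simpl; lia).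
    rewrite Nat.div_add by lia. reflexivity.
Qed.

Lemma CI_csum (f : nat -> R -> C) (v : nat -> C) n : (forall k, CI (f k) (v k)) ->
  CI (fun t => csum (fun k => f k t) n) (csum v n).
Proof.
  intros H. induction n; simpl.
  - pose proof (CI_scal 0 _ _ (H O)) as Z. rewrite Cmult_0_l in Z.
    apply CI_ext with (2 := Z). intros; ring.
  - apply CI_plus; auto.
Qed.

(** * Consequences of genericity and the transform at a spectral point *)

Section Transform.

Variables (q0 : R) (a b c d : C) (T : contour).
Let q := RtoC q0.
Let al := Params a b c d.
Hypothesis Hq : (0 < q0 < 1)%R.
Hypothesis Hg : generic q al.
Hypothesis HT : AWcontour q al T.

Let x := path T.
Let dx := fun t => dpath T t / path T t.
Let ta := ptilde q al.
Let tb := a * b / ta.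
Let tc := a * c / ta.
Let td := q / (a * d / ta).

Lemma gen_nz : a <> 0 /\ b <> 0 /\ c <> 0 /\ d <> 0.
Proof. repeat split; apply (gen_nonzero _ _ Hg); simpl; auto. Qed.

Lemma gen_pair e e' : In e [a; b; c; d] -> In e' [a; b; c; d] -> forall k, 1 - e * e' * q ^ k <> 0.
Proof. intros He He' k E. apply (gen_pairs _ _ Hg e e' He He' k). symmetry. now apply Ceq_minus. Qed.

Lemma gen_M k : 1 - q ^ k / q * a * b * c * d <> 0.
Proof.
  intros E. apply (gen_abcd _ _ Hg k). simpl. symmetry. apply Ceq_minus. rewrite <- E. unfold Cdiv. ring.
Qed.

Lemma ta_neq_0 : ta <> 0.
Proof. apply ptilde_neq_0; [now apply q_neq_0|apply Hg]. Qed.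

Lemma ta_sqr : ta * ta = / q * a * b * c * d.
Proof. apply ptilde_sqr. Qed.

Lemma gen_awok : awok q a b c d.
Proof.
  destruct gen_nz as (Ha & _). constructor; try (apply gen_pair; simpl; auto).
  - now apply q_neq_0.
  - now apply one_sub_qpow.
  - exact Ha.
  - apply gen_M.
Qed.

Lemma gen_awok_b : awok q b a c d.
Proof.
  destruct gen_nz as (_ & Hb & _). constructor; try (apply gen_pair; simpl; auto).
  - now apply q_neq_0.
  - now apply one_sub_qpow.
  - exact Hb.
  - intros k. replace (q ^ k / q * b * a * c * d) with (q ^ k / q * a * b * c * d) by ring. apply gen_M.
Qed.

Lemma gen_awok' : awok' q a b c d.
Proof. constructor; [apply gen_awok| |]; apply gen_pair; simpl; auto. Qed.

Lemma gen_tau_M k : 1 - a * b * c / d * q ^ k <> 0.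
Proof. intros E. apply (gen_abcd_tau _ _ Hg k). symmetry. apply Ceq_minus. exact E. Qed.

Lemma gen_aqd k : 1 - a * (q / d) * q ^ k <> 0.
Proof.
  destruct gen_nz as (_ & _ & _ & Hd).
  intros E. apply (gen_da_inv _ _ Hg (S k)). simpl.
  replace (a * (q * q ^ k)) with (d * (1 - (1 - a * (q / d) * q ^ k))) by (field; exact Hd). rewrite E. ring.
Qed.

Lemma gen_awok_tau : awok q a b c (q / d).
Proof.
  destruct gen_nz as (Ha & _ & _ & Hd). constructor; try (apply gen_pair; simpl; auto; fail).
  - now apply q_neq_0.
  - now apply one_sub_qpow.
  - exact Ha.
  - apply gen_aqd.
  - intros k. replace (q ^ k / q * a * b * c * (q / d)) with (a * b * c / d * q ^ k).
    + apply gen_tau_M.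
    + field. split; [exact Hd|now apply q_neq_0].
Qed.

(** Together with [td / ta = q / (a * d)] this removes the square root from the values of the
    Gaussian on the spectrum. *)
Lemma ta_td : ta * td = b * c.
Proof.
  destruct gen_nz as (Ha & Hb & Hc & Hd). pose proof ta_neq_0 as Ht. pose proof (q_neq_0 q0 Hq) as Hq0. fold q in Hq0.
  unfold td. replace (ta * (q / (a * d / ta))) with (q * (ta * ta) / (a * d)) by (field; repeat split; assumption).
  rewrite ta_sqr. field. repeat split; assumption.
Qed.

Lemma gen_awok_st : awok q ta tb tc td.
Proof.
  destruct gen_nz as (Ha & Hb & Hc & Hd). pose proof ta_neq_0 as Ht. pose proof (q_neq_0 q0 Hq) as Hq0. fold q in Hq0.
  assert (E1 : ta * tb = a * b) by (unfold tb; field; exact Ht).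
  assert (E2 : ta * tc = a * c) by (unfold tc; field; exact Ht).
  constructor.
  - exact Hq0.
  - now apply one_sub_qpow.
  - exact Ht.
  - intros k. rewrite E1. apply gen_pair; simpl; auto.
  - intros k. rewrite E2. apply gen_pair; simpl; auto.
  - intros k. rewrite ta_td. apply gen_pair; simpl; auto.
  - intros k. replace (q ^ k / q * ta * tb * tc * td) with (a * b * c / d * q ^ k); [apply gen_tau_M|].
    unfold tb, tc, td. field. repeat split; assumption.
Qed.

Lemma HT0 : avoids T 0.
Proof. apply HT. Qed.

Lemma gen_adm e : In e [a; b; c; d] -> admissible q T e.
Proof. intros He. split; [now apply (gen_nonzero _ _ Hg)|]. intros k. now apply HT. Qed.

Lemma x_neq_0 t : I01 t -> x t <> 0.
Proof. apply path_neq_0, HT0. Qed.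

Lemma gen_Mk k : 1 - a * b * c * d * q ^ k <> 0.
Proof. apply awok_M', gen_awok. Qed.

(** [v] is the normalisation of [F], and [w] the integral left after the Gaussian has cancelled [d];
    their quotient is the part of [AWconst] that comes from integration. *)
Lemma integrals_exist : exists v w, IW q0 T [a; b; c; d] v /\ IW q0 T [a; b; c] w /\ v <> 0 /\
  w / v = qpoch_inf q (a * d) * qpoch_inf q (b * d) * qpoch_inf q (c * d) / qpoch_inf q (a * b * c * d).
Proof.
  pose proof HT0 as H0.
  destruct (IW_exists q0 T Hq H0 [a; b; c; d] gen_adm) as [v Hv].
  destruct (IW_exists q0 T Hq H0 [a; b; c]) as [w Hw]; [intros e He; apply gen_adm; simpl in *; tauto|].
  exists v, w. split; [exact Hv|]. split; [exact Hw|].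
  pose proof (IW4_neq_0 q0 T Hq H0 a b c d v gen_adm gen_Mk Hv) as N. split; [exact N|].
  assert (Hv' : IW q0 T [d; a; b; c] v).
  { apply IW_perm with (2 := Hv). apply Permutation_sym. exact (Permutation_cons_append [a; b; c] d). }
  assert (Hd : forall e, In e [d; a; b; c] -> admissible q T e) by (intros e He; apply gen_adm; simpl in *; tauto).
  pose proof (IW_drop q0 T Hq H0 d a b c v w Hd Hv' Hw) as E. fold q in E.
  replace (d * a * b * c) with (a * b * c * d) in E by ring.
  replace (d * a) with (a * d) in E by ring. replace (d * b) with (b * d) in E by ring. replace (d * c) with (c * d) in E by ring.
  assert (NM : qpoch_inf q (a * b * c * d) <> 0) by (apply qpoch_inf_neq_0; [exact Hq|apply gen_Mk]).
  transitivity (qpoch_inf q (a * b * c * d) * w / (qpoch_inf q (a * b * c * d) * v)); [field; split; assumption|].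
  rewrite E. field. split; assumption.
Qed.

Lemma wt_ginv t : I01 t -> wt q [a; b; c; d] (x t) * ginv q d (x t) = wt q [a; b; c] (x t).
Proof.
  intros Ht. unfold wt, ginv. cbv beta iota delta [lprod fold_right].
  assert (N : forall e, In e [a; b; c; d] -> qpoch_inf q (e * x t) <> 0 /\ qpoch_inf q (e / x t) <> 0)
    by (intros e He; apply (adm_qpoch_neq_0 q0 T Hq HT0 e t); [now apply gen_adm|exact Ht]).
  destruct (N a ltac:(simpl; auto)), (N b ltac:(simpl; auto)), (N c ltac:(simpl; auto)), (N d ltac:(simpl; auto)).
  field. repeat split; assumption.
Qed.

Lemma int3_exists p : spaceA p -> forall g, spaceA g -> forall h, (forall t, I01 t -> ccont h t) ->
  exists v, CI (fun t => wt q [a; b; c] (x t) * (p (x t) * (g (x t) * h t))) v.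
Proof.
  assert (Hadm : forall e, In e [a; b; c] -> admissible q T e) by (intros e He; apply gen_adm; simpl in *; tauto).
  assert (HX : forall h, (forall t, I01 t -> ccont h t) -> forall t, I01 t -> ccont (fun t => (x t + / x t) * h t) t).
  { intros h Hh t Ht. assert (ccont x t) by now apply path_ccont.
    apply (ccont_mult (fun t => x t + / x t)); [|auto].
    apply (ccont_plus x (fun t => / x t)); [assumption|]. apply ccont_inv; [now apply x_neq_0|assumption]. }
  (* [h] stays arbitrary so that each factor [x + / x] of [g] can be absorbed into it; the same is
     then done for [p]. *)
  assert (H1 : forall g, spaceA g -> forall h, (forall t, I01 t -> ccont h t) ->
    exists v, CI (fun t => wt q [a; b; c] (x t) * (g (x t) * h t)) v).
  { apply (spaceA_ind (fun g => forall h, (forall t, I01 t -> ccont h t) ->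
    exists v, CI (fun t => wt q [a; b; c] (x t) * (g (x t) * h t)) v)).
    - intros f g E H h Hh. destruct (H h Hh) as [v Hv]. exists v. apply CI_ext with (2 := Hv).
      intros t Ht. rewrite E; [reflexivity|now apply x_neq_0].
    - intros h Hh. destruct (CI_wt_exists q0 [a; b; c] x h Hq) as [v Hv]; [now apply adm_pole_free; [|apply HT0|]|exact Hh|].
      exists v. apply CI_ext with (2 := Hv). intros; fold q; ring.
    - intros k1 k2 f g Hf Hg' h Hh. destruct (Hf h Hh) as [v Hv]. destruct (Hg' h Hh) as [w Hw].
      exists (k1 * v + k2 * w). apply CI_ext with (2 := CI_plus _ _ _ _ (CI_scal k1 _ _ Hv) (CI_scal k2 _ _ Hw)). intros; ring.
    - intros f Hf h Hh. destruct (Hf _ (HX h Hh)) as [v Hv]. exists v. apply CI_ext with (2 := Hv). intros; cbv beta; ring. }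
  intros Hp g Hgg. revert p Hp.
  apply (spaceA_ind (fun p => forall h, (forall t, I01 t -> ccont h t) ->
    exists v, CI (fun t => wt q [a; b; c] (x t) * (p (x t) * (g (x t) * h t))) v)).
  - intros f f' E H h Hh. destruct (H h Hh) as [v Hv]. exists v. apply CI_ext with (2 := Hv).
    intros t Ht. rewrite E; [reflexivity|now apply x_neq_0].
  - intros h Hh. destruct (H1 g Hgg h Hh) as [v Hv]. exists v. apply CI_ext with (2 := Hv). intros; ring.
  - intros k1 k2 f f' Hf Hg' h Hh. destruct (Hf h Hh) as [v Hv]. destruct (Hg' h Hh) as [w Hw].
    exists (k1 * v + k2 * w). apply CI_ext with (2 := CI_plus _ _ _ _ (CI_scal k1 _ _ Hv) (CI_scal k2 _ _ Hw)). intros; ring.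
  - intros f Hf h Hh. destruct (Hf _ (HX h Hh)) as [v Hv]. exists v. apply CI_ext with (2 := Hv). intros; cbv beta; ring.
Qed.

(** The factor [ginv q d] of the integrand has cancelled the parameter [d] of the weight. *)
Definition L3 (p : C -> C) (m : nat) (u : C) : Prop :=
  CI (fun t => wt q [a; b; c] (x t) * (p (x t) * (awE q a b c d m (x t) * dx t))) u.

Lemma L3_exists p m : spaceA p -> exists u, L3 p m u.
Proof.
  intros Hp. apply int3_exists; [exact Hp|apply spaceA_awE, gen_awok|].
  intros t Ht. now apply dx_ccont; [apply HT0|].
Qed.

Lemma AWF_value (f p : C -> C) m u v : eq_on Cstar f (fun x => p x * ginv q d x) ->
  IW q0 T [a; b; c; d] v -> v <> 0 -> L3 p m u -> AWF q al T f (spec_pt q al m) = u / v.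
Proof.
  intros Hf Hv Nv Hu. unfold AWF, AWnorm, cint.
  rewrite (CI_unique (fun t => AWweight q al (path T t) / path T t * dpath T t) v).
  2:{ apply CI_ext with (2 := Hv). intros t Ht. unfold al. rewrite AWweight_wt. fold q x. unfold Cdiv. ring. }
  rewrite (CI_unique (fun t => f (path T t) * AWE q al (spec_pt q al m) (path T t) * AWweight q al (path T t) / path T t * dpath T t) u).
  - pose proof two_pi_i_neq_0 as N.
    replace (4 * RtoC PI * Ci) with ((1 + 1) * (2 * RtoC PI * Ci)).
    + assert (N2 : RtoC 1 + 1 <> 0) by (rewrite <- RtoC_plus; intro E; apply RtoC_inj in E; lra).
      set (w := 2 * RtoC PI * Ci) in *. clearbody w. field. repeat split; assumption.
    + rewrite <- RtoC_plus. replace (1 + 1)%R with 2%R by ring.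
      replace (RtoC 4) with (RtoC 2 * RtoC 2) by (rewrite <- RtoC_mult; f_equal; ring). ring.
  - apply CI_ext with (2 := Hu). intros t Ht.
    rewrite Hf by (now apply x_neq_0). unfold q. rewrite AWE_awE by (exact Hq || apply ta_neq_0).
    fold q. simpl pa. simpl pb. simpl pc. simpl pd. unfold al. rewrite AWweight_wt.
    change (path T t) with (x t). rewrite <- (wt_ginv t Ht). unfold dx. fold (x t). unfold Cdiv. ring.
Qed.

Lemma L3_lin k1 k2 f g m u v : L3 f m u -> L3 g m v -> L3 (fun x => k1 * f x + k2 * g x) m (k1 * u + k2 * v).
Proof.
  intros Hu Hv. apply CI_ext with (2 := CI_plus _ _ _ _ (CI_scal k1 _ _ Hu) (CI_scal k2 _ _ Hv)). intros; ring.
Qed.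

Lemma L3_ext f g m u : eq_on Cstar f g -> L3 f m u -> L3 g m u.
Proof.
  intros E. apply CI_ext. intros t Ht. rewrite E; [reflexivity|now apply x_neq_0].
Qed.

End Transform.

(** * The explicit formula for F *)

Section FFormula.

Variables (q0 : R) (a b c d : C) (T : contour).
Let q := RtoC q0.
Let al := Params a b c d.
Hypothesis Hq : (0 < q0 < 1)%R.
Hypothesis Hg : generic q al.
Hypothesis HT : AWcontour q al T.

Let x := path T.
Let dx := fun t => dpath T t / path T t.
Let ta := ptilde q al.
Let tb := a * b / ta.
Let tc := a * c / ta.
Let td := q / (a * d / ta).

Lemma wt_two_shifts k j t : I01 t ->
  wt q [a * q ^ k; b * q ^ j; c] (x t) = wt q [a; b; c] (x t) * (awphi q a (x t) k * awphi q b (x t) j).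
Proof.
  intros Ht. unfold wt, awphi. cbv beta iota delta [lprod fold_right].
  assert (N : forall e K, In e [a; b; c; d] -> qpoch q (e * x t) K <> 0 /\ qpoch q (e / x t) K <> 0 /\
    qpoch_inf q (e * q ^ K * x t) <> 0 /\ qpoch_inf q (e * q ^ K / x t) <> 0).
  { intros e K He. pose proof (gen_adm q0 a b c d T Hg HT e He) as Ha. pose proof (HT0 q0 a b c d T HT) as H0.
    destruct (adm_qpoch_neq_0 q0 T Hq H0 e t Ha Ht) as [H1 _].
    destruct (adm_qpoch_neq_0 q0 T Hq H0 (e * q ^ K) t (adm_pow q0 T Hq e K Ha) Ht) as [_ H2].
    destruct (H1 K), H2. auto. }
  assert (Sp : forall e K, qpoch_inf q (e * x t) = qpoch q (e * x t) K * qpoch_inf q (e * q ^ K * x t) /\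
     qpoch_inf q (e / x t) = qpoch q (e / x t) K * qpoch_inf q (e * q ^ K / x t)).
  { intros e K. split.
    - replace (e * q ^ K * x t) with (e * x t * q ^ K) by ring. apply qpoch_inf_split, Hq.
    - replace (e * q ^ K / x t) with (e / x t * q ^ K) by (unfold Cdiv; ring). apply qpoch_inf_split, Hq. }
  destruct (Sp a k) as [-> ->]. destruct (Sp b j) as [-> ->].
  destruct (N a k ltac:(simpl; auto)) as (? & ? & ? & ?). destruct (N b j ltac:(simpl; auto)) as (? & ? & ? & ?).
  destruct (N c O ltac:(simpl; auto)) as (_ & _ & N1 & N2). simpl in N1, N2. rewrite Cmult_1_r in N1, N2.
  field. repeat split; assumption.
Qed.

(** Writing the second polynomial in the base [b] makes all integrals instances of [IW_shift3_two]. *)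
Lemma L3_awE_tau n m w : IW q0 T [a; b; c] w ->
  L3 q0 a b c d T (awE q a b c (q / d) n) m
   (awkap q a b c d m *
    ((- (a * (q / d))) ^ n * q ^ (n * (n - 1) / 2) * qpoch q (b * c) n / qpoch q (a * (q / d)) n *
     ((- (b * d)) ^ m * q ^ (m * (m - 1) / 2) * qpoch q (a * c) m / qpoch q (b * d) m) *
     awE q ta tb tc td n (ta * q ^ m)) * w).
Proof.
  intros Hw.
  destruct (gen_nz q0 a b c d Hg) as (Ha & Hb & Hc & Hd).
  pose proof (q_neq_0 q0 Hq) as Hq0. fold q in Hq0.
  pose proof (ta_neq_0 q0 a b c d Hq Hg) as Hta. fold q al ta in Hta.
  pose proof (ta_sqr q0 a b c d) as Hta2. fold q al ta in Hta2.
  pose proof (gen_awok q0 a b c d Hq Hg) as Ok. fold q in Ok.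
  pose proof (gen_awok_b q0 a b c d Hq Hg) as Okb. fold q in Okb.
  pose proof (gen_awok_tau q0 a b c d Hq Hg) as Okt. fold q in Okt.
  pose proof (ta_td q0 a b c d Hq Hg) as Htd. fold q al ta td in Htd.
  assert (Hqn : forall k, 1 - q ^ S k <> 0) by (now apply one_sub_qpow).
  assert (Pn : forall y, (forall k, 1 - y * q ^ k <> 0) -> forall k, qpoch q y k <> 0)
    by (intros; apply qpoch_neq_0; auto).
  assert (Pq : forall k, qpoch q q k <> 0) by (apply qpoch_q_neq_0, Hqn).
  pose proof (gen_pair q0 a b c d Hg) as GP. fold q in GP.
  assert (Hab : forall k, 1 - a * b * q ^ k <> 0) by (apply GP; simpl; auto).
  assert (Hac : forall k, 1 - a * c * q ^ k <> 0) by (apply GP; simpl; auto).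
  assert (Hbc : forall k, 1 - b * c * q ^ k <> 0) by (apply GP; simpl; auto).
  assert (Hbd : forall k, 1 - b * d * q ^ k <> 0) by (apply GP; simpl; auto).
  pose proof (gen_aqd q0 a b c d Hg) as Haqd. fold q in Haqd.
  set (Q1 := q ^ n / q * a * b * c * (q / d)). set (Q2 := q ^ m / q * b * a * c * d).
  (* The factors [(a * c)_k] and [(b * c)_j] of the integrals cancel those of the two polynomials.
     What remains has lower parameters [a * (q / d)] and [b * d], with product [a * b * q] as
     required. *)
  pose proof (aw_double_sum q (a * b) (a * (q / d)) (b * d) (b * c) (a * c) Q1 Q2 n m Hq0 Hqn) as DS.
  assert (Hqd : q / d <> 0) by (apply Cmult_neq_0; [|apply Cinv_neq_0]; assumption).
  specialize (DS (Cmult_neq_0 _ _ Ha Hb) (Cmult_neq_0 _ _ Ha Hqd) (Cmult_neq_0 _ _ Hb Hd) Hab Haqd Hbd Hbc Hac).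
  assert (HQ1 : forall k, 1 - Q1 * q ^ k <> 0).
  { intros k. pose proof (ok_M _ _ _ _ _ Okt (n + k)) as E. rewrite Cpow_add_r in E. unfold Q1.
    replace (q ^ n / q * a * b * c * (q / d) * q ^ k) with (q ^ n * q ^ k / q * a * b * c * (q / d)) by (unfold Cdiv; ring). exact E. }
  assert (HQ2 : forall k, 1 - Q2 * q ^ k <> 0).
  { intros k. pose proof (ok_M _ _ _ _ _ Okb (m + k)) as E. rewrite Cpow_add_r in E. unfold Q2.
    replace (q ^ m / q * b * a * c * d * q ^ k) with (q ^ m * q ^ k / q * b * a * c * d) by (unfold Cdiv; ring). exact E. }
  specialize (DS HQ1 HQ2 ltac:(unfold Q1, Cdiv; ring) ltac:(unfold Q2, Cdiv; ring) ltac:(field; exact Hd)).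
  (* At the spectral point [s = ta * q ^ m] one has [ta * s = Q2] and [ta / s = / q ^ m]: the degree
     of the second polynomial has become the argument of the transformed one. *)
  assert (EE : awE q ta tb tc td n (ta * q ^ m) =
    csum (fun i => qpoch q (/ q ^ n) i * qpoch q Q1 i * (qpoch q Q2 i * qpoch q (/ q ^ m) i) /
     (qpoch q q i * qpoch q (a * b) i * qpoch q (b * c) i * qpoch q (a * c) i) * q ^ i) (S n)).
  { unfold awE. apply csum_ext. intros i _. unfold awU, awR, awphi.
    replace (q ^ n / q * ta * tb * tc * td) with Q1 by (unfold Q1, tb, tc, td; field; repeat split; assumption).
    replace (ta * tb) with (a * b) by (unfold tb; field; exact Hta).
    replace (ta * tc) with (a * c) by (unfold tc; field; exact Hta).
    rewrite Htd.
    replace (ta * (ta * q ^ m)) with Q2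
      by (transitivity (ta * ta * q ^ m); [rewrite Hta2; unfold Q2; field; exact Hq0|ring]).
    pose proof (Cpow_nz q m Hq0).
    replace (ta / (ta * q ^ m)) with (/ q ^ m) by (field; split; assumption).
    field. repeat split; auto. }
  rewrite <- EE in DS. rewrite <- DS.
  assert (J : forall k j, exists u, IW q0 T [a * q ^ k; b * q ^ j; c] u).
  { intros k j. apply (IW_exists q0 T Hq (HT0 q0 a b c d T HT)).
    intros e [<-|[<-|He]]; [apply adm_pow|apply adm_pow|]; try assumption;
      apply (gen_adm q0 a b c d T Hg HT); simpl in *; tauto. }
  set (ca := fun k => awU q a b c (q / d) n k * awR q a b c (q / d) k).
  set (cb := fun j => awU q b a c d m j * awR q b a c d j).
  set (I3 := fun k j => qpoch q (a * b) (j + k) * qpoch q (a * c) k * qpoch q (b * c) j * w).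
  assert (J' : forall k j, CI (fun t => wt q [a; b; c] (x t) * (awphi q a (x t) k * awphi q b (x t) j) * dx t) (I3 k j)).
  { intros k j. destruct (J k j) as [u Hu].
    pose proof (IW_shift3_two q0 T Hq (HT0 q0 a b c d T HT) a b c d w u k j (gen_adm q0 a b c d T Hg HT)
      (gen_Mk q0 a b c d Hq Hg) Hw Hu) as E. fold q in E. unfold I3. rewrite <- E.
    apply CI_ext with (2 := Hu). intros t Ht. fold q x. rewrite (wt_two_shifts k j t Ht). reflexivity. }
  match goal with |- L3 _ _ _ _ _ _ _ _ ?v => replace v with
    (awkap q a b c d m * csum (fun k => csum (fun j => ca k * cb j * I3 k j) (S m)) (S n)) end.
  - pose proof (CI_scal (awkap q a b c d m) _ _
      (CI_csum (fun k t => csum (fun j => ca k * cb j * (wt q [a; b; c] (x t) * (awphi q a (x t) k * awphi q b (x t) j) * dx t)) (S m)) _ (S n)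
       (fun k => CI_csum (fun j t => ca k * cb j * (wt q [a; b; c] (x t) * (awphi q a (x t) k * awphi q b (x t) j) * dx t)) _ (S m)
         (fun j => CI_scal (ca k * cb j) _ _ (J' k j))))) as Z.
    apply CI_ext with (2 := Z). intros t Ht. cbv beta. fold q x. fold (x t).
    rewrite (awE_sym q a b c d m (x t) Ok Okb (x_neq_0 q0 a b c d T HT t Ht)).
    unfold awE. fold (ca : nat -> C).
    transitivity (awkap q a b c d m * (wt q [a; b; c] (x t) * dx t) *
      (csum (fun k => ca k * awphi q a (x t) k) (S n) * csum (fun j => cb j * awphi q b (x t) j) (S m))).
    + rewrite <- csum_mult_sums, <- !csum_scal. apply csum_ext. intros k _.
      rewrite <- !csum_scal. apply csum_ext. intros j _. ring.
    + unfold ca, cb, dx. fold (x t). ring.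
  - rewrite <- !Cmult_assoc. f_equal. rewrite Cmult_comm, <- csum_scal. apply csum_ext. intros k _.
    rewrite <- csum_scal. apply csum_ext. intros j _.
    unfold ca, cb, I3, awU, awR. fold Q1 Q2. replace (b * a) with (a * b) by ring.
    pose proof (Pn _ Haqd k). pose proof (Pn _ Hbd j). pose proof (Pn _ Hac k). pose proof (Pn _ Hbc j).
    pose proof (Pn _ Hab k). pose proof (Pn _ Hab j). pose proof (Pq k). pose proof (Pq j).
    field. repeat split; assumption.
Qed.

Definition gst (m : nat) : C := gauss q (alpha_tau q (alpha_sigma q al)) (spec_pt q al m).

Lemma qpoch_inf_split_ratio (y : C) m : (forall k, 1 - y * q ^ k <> 0) ->
  qpoch_inf q (y * q ^ m) = qpoch_inf q y / qpoch q y m.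
Proof.
  intros H. pose proof (qpoch_inf_split q0 y m Hq) as Es. fold q in Es. rewrite Es. clear Es.
  assert (qpoch q y m <> 0) by (apply qpoch_neq_0; auto). field. assumption.
Qed.

(** The two arguments of the product are [b * c * q ^ m] and [q / (a * d) / q ^ m]; the second grows
    with [m] and is handled by [qpoch_reverse]. The resulting power [q ^ (m * (m - 1) / 2)] makes
    all later series converge. *)
Lemma gst_value m : gst m = qpoch q (b * c) m * ((- (a * d)) ^ m * q ^ (m * (m - 1) / 2)) /
  (qpoch q (a * d) m * qpoch_inf q (b * c) * qpoch_inf q (q / (a * d))).
Proof.
  destruct (gen_nz q0 a b c d Hg) as (Ha & Hb & Hc & Hd).
  pose proof (q_neq_0 q0 Hq) as Hq0. fold q in Hq0. pose proof (Cpow_nz q m Hq0) as Hqm.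
  pose proof (ta_neq_0 q0 a b c d Hq Hg) as Hta. fold q al ta in Hta.
  pose proof (ta_td q0 a b c d Hq Hg) as Htd. fold q al ta td in Htd.
  pose proof (gen_pair q0 a b c d Hg) as GP. fold q in GP.
  assert (Hbc : forall k, 1 - b * c * q ^ k <> 0) by (apply GP; simpl; auto).
  assert (Had : forall k, 1 - a * d * q ^ k <> 0) by (apply GP; simpl; auto).
  assert (Hqad : forall k, 1 - q / (a * d) * q ^ k <> 0).
  { intros k E. apply (gen_ad _ _ Hg k). simpl.
    replace (q * q ^ k) with (a * d * (1 - (1 - q / (a * d) * q ^ k))) by (field; split; assumption).
    fold q. rewrite E. ring. }
  unfold gst, gauss, qpochs_inf. cbv beta iota delta [fold_right].
  change (pd (alpha_tau q (alpha_sigma q al))) with td. change (spec_pt q al m) with (ta * q ^ m).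
  replace (td * (ta * q ^ m)) with (b * c * q ^ m) by (rewrite <- Htd; ring).
  replace (td / (ta * q ^ m)) with (q / (a * d) / q ^ m) by (unfold td; field; repeat split; assumption).
  rewrite qpoch_inf_split_ratio by exact Hbc.
  pose proof (qpoch_inf_split q0 (q / (a * d) / q ^ m) m Hq) as Es. fold q in Es. rewrite Es. clear Es.
  replace (q / (a * d) / q ^ m * q ^ m) with (q / (a * d)) by (field; repeat split; assumption).
  pose proof (qpoch_reverse q (a * d) m Hq0 (Cmult_neq_0 _ _ Ha Hd)) as E.
  assert (N1 : qpoch q (a * d) m <> 0) by (apply qpoch_neq_0; auto).
  assert (N2 : qpoch q (b * c) m <> 0) by (apply qpoch_neq_0; auto).
  assert (N3 : qpoch_inf q (b * c) <> 0) by (apply qpoch_inf_neq_0; auto).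
  assert (N4 : qpoch_inf q (q / (a * d)) <> 0) by (apply qpoch_inf_neq_0; auto).
  rewrite <- E in N1 |- *.
  set (y := qpoch q (q / (a * d) / q ^ m) m) in *. set (z := (- (a * d)) ^ m * q ^ (m * (m - 1) / 2)) in *.
  clearbody y z.
  assert (y <> 0) by (intro E'; apply N1; rewrite E'; ring).
  assert (z <> 0) by (intro E'; apply N1; rewrite E'; ring).
  field. repeat split; assumption.
Qed.

Definition gtst (n : nat) : C :=
  gauss q (alpha_tau q (alpha_sigma q (alpha_tau q al))) (spec_pt q (alpha_tau q al) n).

Lemma gen_dqa k : 1 - d / a * q ^ k <> 0.
Proof.
  destruct (gen_nz q0 a b c d Hg) as (Ha & _).
  intros E. apply (gen_da _ _ Hg k). simpl. fold q.
  replace (d * q ^ k) with (a * (1 - (1 - d / a * q ^ k))) by (field; exact Ha). rewrite E. ring.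
Qed.

Lemma ptilde_tau_neq_0 : ptilde q (alpha_tau q al) <> 0.
Proof.
  destruct (gen_nz q0 a b c d Hg) as (Ha & Hb & Hc & Hd).
  pose proof (q_neq_0 q0 Hq) as Hq0. fold q in Hq0.
  apply ptilde_neq_0; [exact Hq0|].
  intros e He. simpl in He. destruct He as [<-|[<-|[<-|[<-|[]]]]]; try assumption.
  apply Cmult_neq_0; [exact Hq0|now apply Cinv_neq_0].
Qed.

(** The computation of [gst_value] with [d] replaced by [q / d], so that [q / (a * d)] becomes
    [d / a]. *)
Lemma gtst_value n : gtst n = qpoch q (b * c) n * ((- (a * (q / d))) ^ n * q ^ (n * (n - 1) / 2)) /
  (qpoch q (a * (q / d)) n * qpoch_inf q (b * c) * qpoch_inf q (d / a)).
Proof.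
  destruct (gen_nz q0 a b c d Hg) as (Ha & Hb & Hc & Hd).
  pose proof (q_neq_0 q0 Hq) as Hq0. fold q in Hq0. pose proof (Cpow_nz q n Hq0) as Hqn.
  assert (Hqd : q / d <> 0) by (apply Cmult_neq_0; [|apply Cinv_neq_0]; assumption).
  pose proof ptilde_tau_neq_0 as Hta.
  pose proof (ptilde_sqr q (alpha_tau q al)) as Hta2. simpl in Hta2.
  pose proof (gen_pair q0 a b c d Hg) as GP. fold q in GP.
  assert (Hbc : forall k, 1 - b * c * q ^ k <> 0) by (apply GP; simpl; auto).
  pose proof (gen_aqd q0 a b c d Hg) as Haqd. fold q in Haqd.
  pose proof gen_dqa as Hda.
  unfold gtst, gauss, qpochs_inf. cbv beta iota delta [fold_right].
  set (tt := ptilde q (alpha_tau q al)) in *.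
  change (spec_pt q (alpha_tau q al) n) with (tt * q ^ n).
  change (pd (alpha_tau q (alpha_sigma q (alpha_tau q al)))) with (q / (a * (q / d) / tt)).
  replace (q / (a * (q / d) / tt) * (tt * q ^ n)) with (b * c * q ^ n).
  2:{ transitivity (tt * tt * d / a * q ^ n); [rewrite Hta2|]; field; repeat split; assumption. }
  replace (q / (a * (q / d) / tt) / (tt * q ^ n)) with (q / (a * (q / d)) / q ^ n)
    by (field; repeat split; assumption).
  rewrite qpoch_inf_split_ratio by exact Hbc.
  pose proof (qpoch_inf_split q0 (q / (a * (q / d)) / q ^ n) n Hq) as Es. fold q in Es. rewrite Es. clear Es.
  replace (q / (a * (q / d)) / q ^ n * q ^ n) with (d / a) by (field; repeat split; assumption).
  pose proof (qpoch_reverse q (a * (q / d)) n Hq0 (Cmult_neq_0 _ _ Ha Hqd)) as E.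
  assert (N1 : qpoch q (a * (q / d)) n <> 0) by (apply qpoch_neq_0; auto).
  assert (N2 : qpoch q (b * c) n <> 0) by (apply qpoch_neq_0; auto).
  assert (N3 : qpoch_inf q (b * c) <> 0) by (apply qpoch_inf_neq_0; auto).
  assert (N4 : qpoch_inf q (d / a) <> 0) by (apply qpoch_inf_neq_0; auto).
  rewrite <- E in N1 |- *.
  set (y := qpoch q (q / (a * (q / d)) / q ^ n) n) in *. set (z := (- (a * (q / d))) ^ n * q ^ (n * (n - 1) / 2)) in *.
  clearbody y z.
  assert (y <> 0) by (intro E'; apply N1; rewrite E'; ring).
  assert (z <> 0) by (intro E'; apply N1; rewrite E'; ring).
  field. repeat split; assumption.
Qed.

(** [AWconst] is the ratio [w / v] times the infinite products in the denominators of [gst] and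
    [gtst]: two copies for [b * c], one for [q / (a * d)] and one for [d / a]. *)
Lemma AWF_tau (f : C -> C) n m : eq_on Cstar f (fun x => awE q a b c (q / d) n x * ginv q d x) ->
  AWF q al T f (spec_pt q al m) = AWconst q al * gtst n * (awE q ta tb tc td n (ta * q ^ m) * gst m).
Proof.
  intros Hf. destruct (integrals_exist q0 a b c d T Hq Hg HT) as (v & w & Hv & Hw & Nv & Ewv). fold q in Ewv.
  pose proof (L3_awE_tau n m w Hw) as HL.
  pose proof (AWF_value q0 a b c d T Hq Hg HT f _ m _ v Hf Hv Nv HL) as EF. fold q al in EF. rewrite EF. clear EF.
  unfold Cdiv at 1. rewrite <- Cmult_assoc. fold (w / v). rewrite Ewv.
  rewrite gst_value, gtst_value. unfold AWconst, qpochs_inf. cbv beta iota delta [fold_right].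
  destruct (gen_nz q0 a b c d Hg) as (Ha & Hb & Hc & Hd).
  pose proof (q_neq_0 q0 Hq) as Hq0. fold q in Hq0.
  pose proof (gen_pair q0 a b c d Hg) as GP. fold q in GP.
  pose proof (gen_aqd q0 a b c d Hg) as Haqd. fold q in Haqd.
  assert (Hqad : forall k, 1 - q / (a * d) * q ^ k <> 0).
  { intros k E. apply (gen_ad _ _ Hg k). simpl.
    replace (q * q ^ k) with (a * d * (1 - (1 - q / (a * d) * q ^ k))) by (field; split; assumption).
    fold q. rewrite E. ring. }
  assert (N1 : qpoch q (a * (q / d)) n <> 0) by (apply qpoch_neq_0; auto).
  assert (N2 : qpoch q (a * d) m <> 0) by (apply qpoch_neq_0; intros; apply GP; simpl; auto).
  assert (N2b : qpoch q (b * d) m <> 0) by (apply qpoch_neq_0; intros; apply GP; simpl; auto).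
  assert (N2c : qpoch q (a * c) m <> 0) by (apply qpoch_neq_0; intros; apply GP; simpl; auto).
  assert (N3 : qpoch_inf q (b * c) <> 0) by (apply qpoch_inf_neq_0; [exact Hq|apply GP; simpl; auto]).
  assert (N4 : qpoch_inf q (d / a) <> 0) by (apply qpoch_inf_neq_0; [exact Hq|apply gen_dqa]).
  assert (N5 : qpoch_inf q (q / (a * d)) <> 0) by (apply qpoch_inf_neq_0; auto).
  assert (N6 : qpoch_inf q (a * b * c * d) <> 0) by (apply qpoch_inf_neq_0; [exact Hq|apply (gen_Mk q0 a b c d Hq Hg)]).
  (* Undoing the change of base from [a] to [b] replaces [b * d] by [a * d], which gives the shape
     of [gst]. *)
  assert (Ek : awkap q a b c d m * ((- (b * d)) ^ m * q ^ (m * (m - 1) / 2) * qpoch q (a * c) m / qpoch q (b * d) m) =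
     qpoch q (b * c) m * ((- (a * d)) ^ m * q ^ (m * (m - 1) / 2)) / qpoch q (a * d) m).
  { unfold awkap. replace (- (a * d)) with (a / b * - (b * d)) by (field; exact Hb). rewrite Cpow_mult_l.
    field. repeat split; assumption. }
  set (X := awE q ta tb tc td n (ta * q ^ m)).
  transitivity (awkap q a b c d m * ((- (b * d)) ^ m * q ^ (m * (m - 1) / 2) * qpoch q (a * c) m / qpoch q (b * d) m) *
    ((- (a * (q / d))) ^ n * q ^ (n * (n - 1) / 2) * qpoch q (b * c) n / qpoch q (a * (q / d)) n) * X *
    (qpoch_inf q (a * d) * qpoch_inf q (b * d) * qpoch_inf q (c * d) / qpoch_inf q (a * b * c * d))).
  - unfold Cdiv. ring.
  - rewrite Ek. clear Ek. set (z := (- (a * (q / d))) ^ n). clearbody z X. unfold al. field. repeat split; assumption.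
Qed.

End FFormula.

(** * Growth estimates *)

Definition bounded_seq (u : nat -> C) : Prop := exists B : R, (0 < B)%R /\ forall m, (Cmod (u m) <= B)%R.

Definition exp_bounded (u : nat -> C) : Prop := exists B R0 : R, (0 < B)%R /\ (0 < R0)%R /\ forall m, (Cmod (u m) <= B * R0 ^ m)%R.

(** The size of the Gaussian on the spectrum. Exponential factors are absorbed into [R0], so the
    class of sequences bounded by it is stable under the growth of polynomials and dual weights. *)
Definition gw (q0 R0 : R) (m : nat) : R := (R0 ^ m * q0 ^ (m * (m - 1) / 2))%R.

Definition gauss_bounded (q0 : R) (u : nat -> C) : Prop :=
  exists B R0 : R, (0 < B)%R /\ (0 < R0)%R /\ forall m, (Cmod (u m) <= B * gw q0 R0 m)%R.

Lemma bd_mult u v : bounded_seq u -> bounded_seq v -> bounded_seq (fun m => u m * v m).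
Proof.
  intros (B & HB & Hu) (B' & HB' & Hv). exists (B * B')%R. split; [now apply Rmult_lt_0_compat|].
  intros m. rewrite Cmod_mult. apply Rmult_le_compat; auto using Cmod_ge_0.
Qed.

Lemma bd_plus u v : bounded_seq u -> bounded_seq v -> bounded_seq (fun m => u m + v m).
Proof.
  intros (B & HB & Hu) (B' & HB' & Hv). exists (B + B')%R. split; [lra|].
  intros m. eapply Rle_trans; [apply Cmod_triangle|]. apply Rplus_le_compat; auto.
Qed.

Lemma bd_const c : bounded_seq (fun _ => c).
Proof. exists (Cmod c + 1)%R. pose proof (Cmod_ge_0 c). split; [lra|]. intros; lra. Qed.

Lemma bd_ext u v : (forall m, u m = v m) -> bounded_seq u -> bounded_seq v.
Proof. intros E (B & HB & H). exists B. split; [exact HB|]. intros m. rewrite <- E. auto. Qed.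

Lemma bd_opp u : bounded_seq u -> bounded_seq (fun m => - u m).
Proof. intros (B & HB & H). exists B. split; [exact HB|]. intros m. rewrite Cmod_opp. auto. Qed.

Lemma eb_bd u : bounded_seq u -> exp_bounded u.
Proof. intros (B & HB & H). exists B, 1%R. split; [exact HB|]. split; [lra|]. intros m. rewrite pow1, Rmult_1_r. auto. Qed.

Lemma eb_mult u v : exp_bounded u -> exp_bounded v -> exp_bounded (fun m => u m * v m).
Proof.
  intros (B & R1 & HB & HR & Hu) (B' & R2 & HB' & HR' & Hv). exists (B * B')%R, (R1 * R2)%R.
  split; [now apply Rmult_lt_0_compat|]. split; [now apply Rmult_lt_0_compat|].
  intros m. rewrite Cmod_mult, Rpow_mult_distr.
  replace (B * B' * (R1 ^ m * R2 ^ m))%R with ((B * R1 ^ m) * (B' * R2 ^ m))%R by ring.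
  apply Rmult_le_compat; auto using Cmod_ge_0.
Qed.

Lemma eb_plus u v : exp_bounded u -> exp_bounded v -> exp_bounded (fun m => u m + v m).
Proof.
  intros (B & R1 & HB & HR & Hu) (B' & R2 & HB' & HR' & Hv). exists (B + B')%R, (R1 + R2)%R.
  split; [lra|]. split; [lra|].
  intros m. eapply Rle_trans; [apply Cmod_triangle|].
  rewrite Rmult_plus_distr_r. apply Rplus_le_compat; eapply Rle_trans; eauto;
  (apply Rmult_le_compat_l; [lra|]; apply pow_incr; lra).
Qed.

Lemma eb_pow c : exp_bounded (fun m => c ^ m).
Proof.
  exists 1%R, (Cmod c + 1)%R. pose proof (Cmod_ge_0 c). split; [lra|]. split; [lra|].
  intros m. rewrite Cmod_pow, Rmult_1_l. apply pow_incr. lra.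
Qed.

Lemma eb_ext u v : (forall m, u m = v m) -> exp_bounded u -> exp_bounded v.
Proof. intros E (B & R1 & HB & HR & H). exists B, R1. split; [exact HB|]. split; [exact HR|]. intros m. rewrite <- E. auto. Qed.

Lemma sd_ext q0 u v : (forall m, u m = v m) -> gauss_bounded q0 u -> gauss_bounded q0 v.
Proof. intros E (B & R1 & HB & HR & H). exists B, R1. split; [exact HB|]. split; [exact HR|]. intros m. rewrite <- E. auto. Qed.

Section Bounds.

Variable q0 : R.
Hypothesis Hq : (0 < q0 < 1)%R.
Let q := RtoC q0.

Lemma sd_gauss : gauss_bounded q0 (fun m => q ^ (m * (m - 1) / 2)).
Proof.
  exists 1%R, 1%R. split; [lra|]. split; [lra|]. intros m. unfold q. rewrite Cmod_q by exact Hq.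
  unfold gw. rewrite pow1. lra.
Qed.

Lemma sd_eb u v : gauss_bounded q0 u -> exp_bounded v -> gauss_bounded q0 (fun m => u m * v m).
Proof.
  intros (B & R1 & HB & HR & Hu) (B' & R2 & HB' & HR' & Hv). exists (B * B')%R, (R1 * R2)%R.
  split; [now apply Rmult_lt_0_compat|]. split; [now apply Rmult_lt_0_compat|].
  intros m. rewrite Cmod_mult. unfold gw in *. rewrite Rpow_mult_distr.
  replace (B * B' * (R1 ^ m * R2 ^ m * q0 ^ (m * (m - 1) / 2)))%R with
    ((B * (R1 ^ m * q0 ^ (m * (m - 1) / 2))) * (B' * R2 ^ m))%R by ring.
  apply Rmult_le_compat; auto using Cmod_ge_0.
Qed.

Lemma gw_pos R0 m : (0 < R0)%R -> (0 < gw q0 R0 m)%R.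
Proof. intros H. apply Rmult_lt_0_compat; apply pow_lt; lra. Qed.

Lemma gw_S R0 m : gw q0 R0 (S m) = (gw q0 R0 m * (R0 * q0 ^ m))%R.
Proof.
  unfold gw. replace (S m * (S m - 1) / 2)%nat with (m * (m - 1) / 2 + m)%nat.
  - rewrite pow_add. simpl. ring.
  - replace (S m * (S m - 1))%nat with (m * (m - 1) + m * 2)%nat by (destruct m; simpl; lia).
    rewrite Nat.div_add by lia. reflexivity.
Qed.

Lemma gw_summable R0 : (0 < R0)%R -> ex_series (gw q0 R0).
Proof.
  intros HR. apply ex_series_Rabs, ex_series_DAlembert with 0%R; [lra| |].
  - intros n. pose proof (gw_pos R0 n HR). lra.
  - apply is_lim_seq_ext with (fun n => (R0 * q0 ^ n)%R).
    + intros n. rewrite gw_S. pose proof (gw_pos R0 n HR).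
      replace (gw q0 R0 n * (R0 * q0 ^ n) / gw q0 R0 n)%R with (R0 * q0 ^ n)%R by (field; lra).
      rewrite Rabs_pos_eq; [reflexivity|]. apply Rmult_le_pos; [lra|apply pow_le; lra].
    + replace (Finite 0) with (Rbar_mult R0 0) by (simpl; f_equal; ring).
      apply is_lim_seq_scal_l. apply is_lim_seq_geom. rewrite Rabs_pos_eq; lra.
Qed.

Lemma gw_tails R0 : (0 < R0)%R -> forall eps : R, (0 < eps)%R -> exists N, forall n m, (N <= n)%nat ->
  (sum_n_m (gw q0 R0) n m < eps)%R.
Proof.
  intros HR eps He. destruct (Cauchy_ex_series _ (gw_summable R0 HR) (mkposreal eps He)) as [N HN].
  exists N. intros n m Hn. destruct (le_lt_dec n m) as [L|L].
  - specialize (HN n m Hn ltac:(lia)). apply Rle_lt_trans with (2 := HN). apply Rle_abs.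
  - rewrite sum_n_m_zero by exact L. exact He.
Qed.

Lemma sd_0 u : gauss_bounded q0 u -> cvg u 0.
Proof.
  intros (B & R1 & HB & HR & Hu) eps He.
  destruct (gw_tails R1 HR (eps / B)%R) as [N HN]; [now apply Rdiv_lt_0_compat|].
  exists N. intros n Hn. replace (u n - 0) with (u n) by ring.
  apply Rle_lt_trans with (1 := Hu n). specialize (HN n n Hn). rewrite sum_n_n in HN.
  apply Rmult_lt_compat_l with (r := B) in HN; [|exact HB].
  replace (B * (eps / B))%R with eps in HN by (field; lra). exact HN.
Qed.

Lemma csum_diff_le (u : nat -> C) (B R0 : R) n k : (0 < B)%R -> (forall m, (Cmod (u m) <= B * gw q0 R0 m)%R) -> (n <= k)%nat ->
  (Cmod (csum u (S k) - csum u (S n)) <= B * sum_n_m (gw q0 R0) (S n) k)%R.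
Proof.
  intros HB Hu Hk. induction Hk.
  - rewrite sum_n_m_zero by lia. replace (csum u (S n) - csum u (S n)) with (RtoC 0) by ring.
    rewrite Cmod_0. unfold zero; simpl. lra.
  - rewrite sum_n_Sm by lia. unfold plus; simpl AbelianMonoid.plus.
    replace (csum u (S (S m)) - csum u (S n)) with (csum u (S m) - csum u (S n) + u (S m)) by (simpl; ring).
    eapply Rle_trans; [apply Cmod_triangle|].
    replace (B * (sum_n_m (gw q0 R0) (S n) m + gw q0 R0 (S m)))%R with
      (B * sum_n_m (gw q0 R0) (S n) m + B * gw q0 R0 (S m))%R by ring.
    apply Rplus_le_compat; auto.
Qed.

(** The summable majorant makes the tail beyond [n] small uniformly in [K], and for fixed [n] the
    finite sums converge term by term. *)
Lemma tannery (f : nat -> nat -> C) (g : nat -> C) (B R0 : R) (s : nat -> C) l : (0 < B)%R -> (0 < R0)%R ->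
  (forall K m, (Cmod (f K m) <= B * gw q0 R0 m)%R) -> (forall m, cvg (fun K => f K m) (g m)) ->
  (forall K, s K = csum (f K) (S K)) -> cvg s l -> cvg (fun n => csum g (S n)) l.
Proof.
  intros HB HR Hf Hg Hs Hl eps He.
  destruct (gw_tails R0 HR (eps / 2 / B)%R) as [N HN]; [apply Rdiv_lt_0_compat; lra|].
  exists N. intros n Hn. apply Rle_lt_trans with (eps / 2)%R; [|lra].
  assert (Hc : forall k, cvg (fun K => csum (f K) k) (csum g k)).
  { induction k; simpl; [apply cvg_const|]. apply (cvg_plus (fun K => csum (f K) k)); auto. }
  replace (csum g (S n) - l) with (csum g (S n) + - (1) * l) by ring.
  apply cvg_le with (u := fun K => csum (f K) (S n) + - (1) * s K) (N := n).
  - apply (cvg_plus (fun K => csum (f K) (S n)) (fun K => - (1) * s K)); [apply Hc|now apply cvg_scal].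
  - intros K HK. rewrite Hs.
    replace (csum (f K) (S n) + - (1) * csum (f K) (S K)) with (- (csum (f K) (S K) - csum (f K) (S n))) by ring.
    rewrite Cmod_opp. apply Rle_trans with (1 := csum_diff_le (f K) B R0 n K HB (Hf K) HK).
    specialize (HN (S n) K ltac:(lia)). apply Rmult_lt_compat_l with (r := B) in HN; [|exact HB].
    replace (B * (eps / 2 / B))%R with (eps / 2)%R in HN by (field; lra). apply Rlt_le. exact HN.
Qed.

Lemma bd_qpow (c : C) : bounded_seq (fun m => c * q ^ m).
Proof.
  exists (Cmod c + 1)%R. pose proof (Cmod_ge_0 c). split; [lra|]. intros m. rewrite Cmod_mult.
  unfold q. rewrite Cmod_q by exact Hq.
  assert (0 < q0 ^ m <= 1)%R; [|nra]. split; [apply pow_lt; lra|]. rewrite <- (pow1 m). apply pow_incr. lra.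
Qed.

Lemma bd_factor (y : C) : bounded_seq (fun m => 1 - y * q ^ m).
Proof. apply (bd_plus (fun _ => 1) (fun m => - (y * q ^ m))); [apply bd_const|apply bd_opp, bd_qpow]. Qed.

Lemma bd_qpoch (y : C) : bounded_seq (fun m => qpoch q y m).
Proof.
  exists (qbound q0 (Cmod y)). split; [apply exp_pos|]. intros m. apply qpoch_bound; [exact Hq|lra].
Qed.

Lemma bd_inv_qpoch (y : C) : (forall k, 1 - y * q ^ k <> 0) -> bounded_seq (fun m => / qpoch q y m).
Proof.
  intros H. destruct (qpoch_lower q0 y Hq H) as (d & Hd & Hk). exists (/ d)%R.
  split; [now apply Rinv_0_lt_compat|]. intros m. specialize (Hk m).
  assert (qpoch q y m <> 0) by (apply Cmod_gt_0; unfold q; lra).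
  rewrite Cmod_inv by assumption. apply Rinv_le_contravar; assumption.
Qed.

(** The inverse factor is a quotient of two consecutive shifted factorials, which are bounded above
    and away from 0. *)
Lemma bd_inv_factor (y : C) : (forall k, 1 - y * q ^ k <> 0) -> bounded_seq (fun m => / (1 - y * q ^ m)).
Proof.
  intros H. destruct (bd_inv_qpoch y H) as (B & HB & Hb).
  apply bd_ext with (fun m => qpoch q y m * / qpoch q y (S m)).
  - intros m. simpl. assert (qpoch q y m <> 0) by (apply qpoch_neq_0; auto). specialize (H m). field. split; assumption.
  - apply bd_mult; [apply bd_qpoch|]. exists B. split; [exact HB|]. intros m. apply Hb.
Qed.

Lemma bd_even u : bounded_seq u -> bounded_seq (fun m => u (2 * m)%nat).
Proof. intros (B & HB & H). exists B. split; [exact HB|]. intros; apply H. Qed.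

Lemma bd_shift u : bounded_seq u -> bounded_seq (fun m => u (S m)).
Proof. intros (B & HB & H). exists B. split; [exact HB|]. intros; apply H. Qed.

End Bounds.

Lemma bd_unshift u : bounded_seq (fun m => u (S m)) -> bounded_seq u.
Proof.
  intros (B & HB & H). exists (B + Cmod (u O))%R. pose proof (Cmod_ge_0 (u O)). split; [lra|].
  intros [|m]; [lra|]. specialize (H m). lra.
Qed.

Lemma bd_minus u v : bounded_seq u -> bounded_seq v -> bounded_seq (fun m => u m - v m).
Proof. intros Hu Hv. apply (bd_plus u (fun m => - v m)); [exact Hu|now apply bd_opp]. Qed.

(** * Bounds for the recurrence coefficients, the polynomials and the dual weight *)

Section AWBounds.

Variables (q0 : R) (a b c d : C).
Hypothesis Hq : (0 < q0 < 1)%R.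
Let q := RtoC q0.
Hypothesis H' : awok' q a b c d.

Let H : awok q a b c d := ok'_ok _ _ _ _ _ H'.

Lemma awMq k : 1 - (/ q * a * b * c * d) * q ^ k <> 0.
Proof. replace (/ q * a * b * c * d * q ^ k) with (q ^ k / q * a * b * c * d) by (unfold Cdiv; ring). apply (ok_M _ _ _ _ _ H). Qed.

Lemma bd_awA : bounded_seq (awA q a b c d).
Proof.
  pose proof (ok_a _ _ _ _ _ H) as Ha. pose proof (ok_q _ _ _ _ _ H) as Hq0.
  apply bd_ext with (fun m => (1 - a * b * q ^ m) * (1 - a * c * q ^ m) * (1 - a * d * q ^ m) *
     (1 - (/ q * a * b * c * d) * q ^ m) * (/ a * / (1 - (/ q * a * b * c * d) * q ^ (2 * m)) * / (1 - a * b * c * d * q ^ (2 * m)))).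
  - intros m. unfold awA.
    replace (/ q * a * b * c * d * q ^ m) with (q ^ m / q * a * b * c * d) by (unfold Cdiv; ring).
    replace (/ q * a * b * c * d * q ^ (2 * m)) with (q ^ (2 * m) / q * a * b * c * d) by (unfold Cdiv; ring).
    replace (a * b * c * d * q ^ (2 * m)) with (q ^ (2 * m) * a * b * c * d) by ring.
    pose proof (awok_even _ _ _ _ _ H m) as [E1 E2]. rewrite <- Cpow_double in E1, E2.
    set (y1 := 1 - q ^ (2 * m) / q * a * b * c * d) in *. set (y2 := 1 - q ^ (2 * m) * a * b * c * d) in *.

    clearbody y1 y2. field. repeat split; assumption.
  - repeat apply bd_mult; try apply bd_factor; try exact Hq; [apply bd_const| |].
    + apply (bd_even (fun m => / (1 - / q * a * b * c * d * q ^ m))). apply bd_inv_factor; [exact Hq|apply awMq].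
    + apply (bd_even (fun m => / (1 - a * b * c * d * q ^ m))). apply bd_inv_factor; [exact Hq|apply (awok_M' _ _ _ _ _ H)].
Qed.
Hypothesis Hbc : forall k, 1 - b * c * q ^ k <> 0.

Let h := htilde q (Params a b c d).

Lemma bd_awC : bounded_seq (awC q a b c d).
Proof.
  pose proof (ok_q _ _ _ _ _ H) as Hq0.
  (* At index 0 the denominator of [awC] contains [1 - a * b * c * d / q ^ 2], which the hypotheses
     do not control; the formula is bounded from index 1 on. *)
  apply bd_unshift.
  apply bd_ext with (fun m => a * (1 - q * q ^ m) * (1 - b * c * q ^ m) * (1 - b * d * q ^ m) * (1 - c * d * q ^ m) *
     (/ (1 - a * b * c * d * q ^ (2 * m)) * / (1 - (/ q * a * b * c * d) * q ^ (2 * S m)))).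
  - intros m. unfold awC.
    replace (/ q * a * b * c * d * q ^ (2 * S m)) with (q ^ (2 * S m) / q * a * b * c * d) by (unfold Cdiv; ring).
    replace (a * b * c * d * q ^ (2 * m)) with (q ^ (2 * S m) / q / q * a * b * c * d)
      by (rewrite !Cpow_double, Cpow_S; field; exact Hq0).
    pose proof (awok_even _ _ _ _ _ H (S m)) as [E1 _]. rewrite <- Cpow_double in E1.
    pose proof (awok_even' _ _ _ _ _ H m) as E2. rewrite <- Cpow_double in E2.
    replace (b * c * q ^ S m / q) with (b * c * q ^ m) by (simpl; field; exact Hq0).
    replace (b * d * q ^ S m / q) with (b * d * q ^ m) by (simpl; field; exact Hq0).
    replace (c * d * q ^ S m / q) with (c * d * q ^ m) by (simpl; field; exact Hq0).
    rewrite (Cpow_S q m).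
    set (y1 := 1 - q ^ (2 * S m) / q * a * b * c * d) in *. set (y2 := 1 - q ^ (2 * S m) / q / q * a * b * c * d) in *.
    clearbody y1 y2. field. split; assumption.
  - apply bd_mult; [apply bd_mult; [apply bd_mult; [apply bd_mult; [apply bd_mult|]|]|]|apply bd_mult].
    + apply bd_const.
    + apply bd_factor, Hq.
    + apply bd_factor, Hq.
    + apply bd_factor, Hq.
    + apply bd_factor, Hq.
    + apply (bd_even (fun m => / (1 - a * b * c * d * q ^ m))). apply bd_inv_factor; [exact Hq|apply (awok_M' _ _ _ _ _ H)].
    + apply (bd_shift (fun m => / (1 - / q * a * b * c * d * q ^ (2 * m)))).
      apply (bd_even (fun m => / (1 - / q * a * b * c * d * q ^ m))). apply bd_inv_factor; [exact Hq|]. apply (awMq).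
Qed.

Lemma bd_awB : bounded_seq (awB q a b c d).
Proof.
  apply bd_minus; [apply bd_minus; [apply bd_const|]|apply bd_awC].
  now apply bd_awA.
Qed.

Lemma bd_inv_awA : bounded_seq (fun m => / awA q a b c d m).
Proof.
  pose proof (ok_a _ _ _ _ _ H) as Ha. pose proof (ok_q _ _ _ _ _ H) as Hq0.
  apply bd_ext with (fun m => / (1 - a * b * q ^ m) * / (1 - a * c * q ^ m) * / (1 - a * d * q ^ m) *
     / (1 - (/ q * a * b * c * d) * q ^ m) * (a * (1 - (/ q * a * b * c * d) * q ^ (2 * m)) * (1 - a * b * c * d * q ^ (2 * m)))).
  - intros m. unfold awA.
    replace (q ^ m / q * a * b * c * d) with (/ q * a * b * c * d * q ^ m) by (unfold Cdiv; ring).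
    replace (q ^ (2 * m) / q * a * b * c * d) with (/ q * a * b * c * d * q ^ (2 * m)) by (unfold Cdiv; ring).
    replace (q ^ (2 * m) * a * b * c * d) with (a * b * c * d * q ^ (2 * m)) by ring.
    pose proof (awMq m) as E1. pose proof (awMq (2 * m)) as E2. fold q in E1, E2.
    pose proof (awok_M' _ _ _ _ _ H (2 * m)) as E3.
    pose proof (ok_ab _ _ _ _ _ H m) as E4. pose proof (ok_ac _ _ _ _ _ H m) as E5. pose proof (ok_ad _ _ _ _ _ H m) as E6.
    set (y1 := 1 - a * b * q ^ m) in *. set (y2 := 1 - a * c * q ^ m) in *. set (y3 := 1 - a * d * q ^ m) in *.
    set (y4 := 1 - / q * a * b * c * d * q ^ m) in *. set (y5 := 1 - / q * a * b * c * d * q ^ (2 * m)) in *.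
    set (y6 := 1 - a * b * c * d * q ^ (2 * m)) in *. clearbody y1 y2 y3 y4 y5 y6.
    field. repeat split; assumption.
  - apply bd_mult; [apply bd_mult; [apply bd_mult; [apply bd_mult|]|]|apply bd_mult; [apply bd_mult|]];
      try (apply bd_inv_factor; [exact Hq|]).
    + apply H.
    + apply H.
    + apply H.
    + apply (awMq).
    + apply bd_const.
    + apply (bd_even (fun m => 1 - / q * a * b * c * d * q ^ m)). apply bd_factor, Hq.
    + apply (bd_even (fun m => 1 - a * b * c * d * q ^ m)). apply bd_factor, Hq.
Qed.

(** The three-term recurrence has bounded coefficients, so the polynomials grow at most geometrically. *)
Lemma awE_growth (X : R) : (0 <= X)%R -> exists R0 : R, (1 <= R0)%R /\ forall x : C, x <> 0 ->
  (Cmod (x + / x) <= X)%R -> forall m, (Cmod (awE q a b c d m x) <= R0 ^ m)%R.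
Proof.
  intros HX. destruct bd_inv_awA as (B1 & HB1 & H1). destruct bd_awB as (B2 & HB2 & H2). destruct bd_awC as (B3 & HB3 & H3).
  exists (1 + B1 * (X + B2 + B3))%R.
  assert (HR : (1 <= 1 + B1 * (X + B2 + B3))%R) by nra. split; [exact HR|].
  set (R0 := (1 + B1 * (X + B2 + B3))%R) in *. intros x Hx HXx.
  cut (forall m, (Cmod (awE q a b c d m x) <= R0 ^ m)%R /\ (Cmod (awE q a b c d (pred m) x) <= R0 ^ m)%R).
  { intros G m. apply G. }
  induction m as [|m [IH1 IH2]].
  - simpl pred. rewrite awE_0, Cmod_1. simpl. lra.
  - assert (Hp : (0 < R0 ^ m)%R) by (apply pow_lt; lra).
    split; [|simpl; apply Rle_trans with (1 := IH1); nra].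
    replace (awE q a b c d (S m) x) with (/ awA q a b c d m *
      ((x + / x) * awE q a b c d m x + (- (awB q a b c d m * awE q a b c d m x) + - (awC q a b c d m * awE q a b c d (pred m) x)))).
    + rewrite Cmod_mult. simpl.
      assert (T : (Cmod ((x + / x) * awE q a b c d m x + (- (awB q a b c d m * awE q a b c d m x) + - (awC q a b c d m * awE q a b c d (pred m) x)))
         <= (X + B2 + B3) * R0 ^ m)%R).
      { eapply Rle_trans; [apply Cmod_triangle|].
        replace ((X + B2 + B3) * R0 ^ m)%R with (X * R0 ^ m + (B2 * R0 ^ m + B3 * R0 ^ m))%R by ring.
        apply Rplus_le_compat; [rewrite Cmod_mult; apply Rmult_le_compat; auto using Cmod_ge_0|].
        eapply Rle_trans; [apply Cmod_triangle|]. rewrite !Cmod_opp, !Cmod_mult.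
        apply Rplus_le_compat; apply Rmult_le_compat; auto using Cmod_ge_0. }
      apply Rle_trans with (B1 * ((X + B2 + B3) * R0 ^ m))%R.
      * apply Rmult_le_compat; auto using Cmod_ge_0.
      * unfold R0 at 2. nra.
    + rewrite (awE_recurrence _ _ _ _ _ m x H Hx). field. now apply awA_neq_0.
Qed.

Lemma htilde_bd : bounded_seq (fun m => h m * a ^ (2 * m)).
Proof.
  pose proof (ok_a _ _ _ _ _ H) as Ha. pose proof (ok_q _ _ _ _ _ H) as Hq0.
  pose proof (awMq) as HM. fold q in HM.
  pose proof H' as [_ Hbd Hcd].
  apply bd_ext with (fun m => (1 - (/ q * a * b * c * d) * q ^ (2 * m)) *
    (qpoch q (/ q * a * b * c * d) m * (qpoch q (a * b) m * (qpoch q (a * c) m * qpoch q (a * d) m))) *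
    (/ (1 - / q * a * b * c * d) * (/ qpoch q q m * (/ qpoch q (b * c) m * (/ qpoch q (b * d) m * / qpoch q (c * d) m))))).
  - intros m. unfold h, htilde, qpochs. cbv beta iota delta [fold_right].
    replace (/ q * a * b * c * d * q ^ (2 * m)) with (q ^ (2 * m) / q * a * b * c * d) by (unfold Cdiv; ring).
    pose proof (HM O) as E0. simpl in E0. rewrite Cmult_1_r in E0.
    assert (qpoch q q m <> 0) by (apply qpoch_q_neq_0, H).
    assert (qpoch q (b * c) m <> 0) by (apply qpoch_neq_0; auto).
    assert (qpoch q (b * d) m <> 0) by (apply qpoch_neq_0; auto).
    assert (qpoch q (c * d) m <> 0) by (apply qpoch_neq_0; auto).
    pose proof (Cpow_nz a (2 * m) Ha).
    set (y := 1 - / q * a * b * c * d) in *. clearbody y. field. repeat split; assumption.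
  - repeat apply bd_mult; try (apply bd_qpoch, Hq); try (apply bd_inv_qpoch; [exact Hq|]); try apply bd_const; try assumption.
    + apply (bd_even (fun m => 1 - / q * a * b * c * d * q ^ m)). apply bd_factor, Hq.
    + intros k. replace (q * q ^ k) with (q ^ S k) by reflexivity. apply H.
Qed.

Lemma htilde_eb : exp_bounded h.
Proof.
  pose proof (ok_a _ _ _ _ _ H) as Ha.
  apply eb_ext with (fun m => (h m * a ^ (2 * m)) * (/ (a * a)) ^ m).
  - intros m. rewrite Cpow_double, Cpow_inv, Cpow_mult_l by (apply Cmult_neq_0; exact Ha).
    pose proof (Cpow_nz a m Ha). field. assumption.
  - apply eb_mult; [apply eb_bd, htilde_bd|apply eb_pow].
Qed.

Lemma htilde_recurrence m : awA q a b c d m * h m = awC q a b c d (S m) * h (S m).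
Proof.
  pose proof (ok_a _ _ _ _ _ H) as Ha. pose proof (ok_q _ _ _ _ _ H) as Hq0.
  pose proof (awMq) as HM. fold q in HM.
  pose proof H' as [_ Hbd Hcd]. pose proof (ok_qn _ _ _ _ _ H) as Hqn.
  unfold h, htilde, awA, awC, qpochs. cbv beta iota delta [fold_right].
  rewrite !qpoch_S, !Cpow_double, !(Cpow_S q m), !(Cpow_S a m).
  pose proof (HM O) as E0. simpl in E0. rewrite Cmult_1_r in E0.
  destruct (awok_even _ _ _ _ _ H m) as [E1 E2]. destruct (awok_even _ _ _ _ _ H (S m)) as [E3 E4].
  rewrite !(Cpow_S q m) in E3, E4. pose proof (awok_even' _ _ _ _ _ H m) as E5. rewrite !(Cpow_S q m) in E5.
  assert (qpoch q q m <> 0) by (apply qpoch_q_neq_0, Hqn).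
  assert (qpoch q (b * c) m <> 0) by (apply qpoch_neq_0; auto).
  assert (qpoch q (b * d) m <> 0) by (apply qpoch_neq_0; auto).
  assert (qpoch q (c * d) m <> 0) by (apply qpoch_neq_0; auto).
  pose proof (Cpow_nz a m Ha). pose proof (Hqn m) as E6. rewrite Cpow_S in E6.
  pose proof (Hbc m). pose proof (Hbd m). pose proof (Hcd m).
  field. nzero.
Qed.

End AWBounds.

(** * Inversion *)

Lemma newton_bound (q0 : R) K m : (0 < q0 < 1)%R ->
  (Cmod (newton q0 (RtoC q0 ^ K) m) <= q0 ^ (m * (m - 1) / 2))%R.
Proof.
  intros Hq. induction m as [|m IH].
  - simpl. rewrite Cmod_1. lra.
  - replace (S m * (S m - 1) / 2)%nat with (m * (m - 1) / 2 + m)%nat.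
    2:{ replace (S m * (S m - 1))%nat with (m * (m - 1) + m * 2)%nat by (destruct m; simpl; lia).
        rewrite Nat.div_add by lia. reflexivity. }
    destruct (le_lt_dec m K) as [L|L].
    + simpl newton. rewrite Cmod_mult, pow_add. apply Rmult_le_compat; try apply Cmod_ge_0; [exact IH|].
      rewrite <- !RtoC_pow, <- RtoC_minus, Cmod_R.
      replace K with (m + (K - m))%nat by lia. rewrite pow_add.
      assert (0 < q0 ^ m)%R by (apply pow_lt; lra).
      assert (0 < q0 ^ (K - m) <= 1)%R.
      { split; [apply pow_lt; lra|]. rewrite <- (pow1 (K - m)). apply pow_incr. lra. }
      rewrite Rabs_left1 by nra. nra.
    + rewrite newton_eq_0 by lia. rewrite Cmod_0. apply pow_le. lra.
Qed.

Lemma newton_0 (q : C) m : newton q 0 m = (- (1)) ^ m * q ^ (m * (m - 1) / 2).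
Proof.
  induction m as [|m IH]; [simpl; ring|].
  replace (S m * (S m - 1) / 2)%nat with (m * (m - 1) / 2 + m)%nat.
  - rewrite Cpow_add_r. simpl newton. rewrite IH. simpl. ring.
  - replace (S m * (S m - 1))%nat with (m * (m - 1) + m * 2)%nat by (destruct m; simpl; lia).
    rewrite Nat.div_add by lia. reflexivity.
Qed.

Lemma newton_cvg (q0 : R) m : (0 < q0 < 1)%R -> cvg (fun K => newton q0 (RtoC q0 ^ K) m) (newton q0 0 m).
Proof.
  intros Hq. assert (H0 : cvg (fun K => RtoC q0 ^ K) 0).
  { intros eps He. destruct (pow_q_small q0 Hq 1 eps) as [N HN]; [lra|exact He|].
    exists N. intros n Hn. specialize (HN n Hn). replace (RtoC q0 ^ n - 0) with (RtoC q0 ^ n) by ring.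
    rewrite Cmod_q by exact Hq. lra. }
  induction m as [|m IH]; simpl; [apply cvg_const|].
  apply (cvg_mult (fun K => newton q0 (RtoC q0 ^ K) m) (fun K => RtoC q0 ^ K - RtoC q0 ^ m)); [exact IH|].
  apply (cvg_plus (fun K => RtoC q0 ^ K) (fun _ => - RtoC q0 ^ m)); [exact H0|apply cvg_const].
Qed.

Lemma sd_shift (q0 : R) u : (0 < q0 < 1)%R -> gauss_bounded q0 u -> gauss_bounded q0 (fun m => u (S m)).
Proof.
  intros Hq (B & R0 & HB & HR & Hu). exists (B * R0)%R, R0. split; [now apply Rmult_lt_0_compat|]. split; [exact HR|].
  intros m. apply Rle_trans with (1 := Hu (S m)). rewrite gw_S.
  pose proof (gw_pos q0 Hq R0 m HR).
  assert (0 < q0 ^ m <= 1)%R.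
  { split; [apply pow_lt; lra|]. rewrite <- (pow1 m). apply pow_incr. lra. }
  replace (B * R0 * gw q0 R0 m)%R with (B * gw q0 R0 m * (R0 * 1))%R by ring.
  rewrite <- Rmult_assoc. apply Rmult_le_compat_l; [apply Rmult_le_pos; lra|]. apply Rmult_le_compat_l; lra.
Qed.

Lemma eb_shift u : exp_bounded u -> exp_bounded (fun m => u (S m)).
Proof.
  intros (B & R0 & HB & HR & H). exists (B * R0)%R, R0. split; [now apply Rmult_lt_0_compat|]. split; [exact HR|].
  intros m. specialize (H (S m)). simpl in H. lra.
Qed.

Section Series.

Variables (q0 : R) (a b c d : C) (T : contour).
Let q := RtoC q0.
Let al := Params a b c d.
Hypothesis Hq : (0 < q0 < 1)%R.
Hypothesis Hg : generic q al.
Hypothesis HT : AWcontour q al T.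

Let ta := ptilde q al.
Let tb := a * b / ta.
Let tc := a * c / ta.
Let td := q / (a * d / ta).
Let h := htilde q al.
Let gs := gst q0 a b c d.
Let gt := gtst q0 a b c d.

Lemma gen_bc k : 1 - b * c * q ^ k <> 0.
Proof. apply (gen_pair q0 a b c d Hg); simpl; auto. Qed.

Lemma gen_qad k : 1 - q / (a * d) * q ^ k <> 0.
Proof.
  destruct (gen_nz q0 a b c d Hg) as (Ha & _ & _ & Hd).
  intros E. apply (gen_ad _ _ Hg k). simpl.
  replace (q * q ^ k) with (a * d * (1 - (1 - q / (a * d) * q ^ k))) by (field; split; assumption).
  rewrite E. ring.
Qed.

Lemma gtst_neq_0 n : gt n <> 0.
Proof.
  destruct (gen_nz q0 a b c d Hg) as (Ha & _ & _ & Hd).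
  pose proof (q_neq_0 q0 Hq) as Hq0. fold q in Hq0.
  unfold gt. rewrite (gtst_value q0 a b c d Hq Hg). fold q. unfold Cdiv at 1.
  apply Cmult_neq_0; [apply Cmult_neq_0|apply Cinv_neq_0; repeat apply Cmult_neq_0].
  - apply qpoch_neq_0. intros; apply gen_bc.
  - apply Cmult_neq_0; apply Cpow_nz; [|exact Hq0].
    intro E. apply (Cmult_neq_0 a (q / d) Ha (Cmult_neq_0 _ _ Hq0 (Cinv_neq_0 _ Hd))).
    replace (a * (q / d)) with (- - (a * (q / d))) by ring. rewrite E. ring.
  - apply qpoch_neq_0. intros; apply (gen_aqd q0 a b c d Hg).
  - apply qpoch_inf_neq_0; [exact Hq|apply gen_bc].
  - apply qpoch_inf_neq_0; [exact Hq|apply (gen_dqa q0 a b c d Hg)].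
Qed.

Lemma AWconst_neq_0 : AWconst q al <> 0.
Proof.
  pose proof (gen_pair q0 a b c d Hg) as GP. fold q in GP.
  unfold AWconst, al, qpochs_inf. cbv beta iota delta [fold_right]. unfold Cdiv at 1.
  apply Cmult_neq_0; [|apply Cinv_neq_0]; repeat apply Cmult_neq_0; try apply C1_nz;
    (apply qpoch_inf_neq_0; [exact Hq|]); try (apply GP; simpl; auto; fail).
  - apply (gen_dqa q0 a b c d Hg).
  - apply gen_qad.
  - apply (gen_Mk q0 a b c d Hq Hg).
Qed.

Lemma spec_neq_0 m : ta * q ^ m <> 0.
Proof. apply Cmult_neq_0; [apply (ta_neq_0 q0 a b c d Hq Hg)|apply Cpow_nz, (q_neq_0 q0 Hq)]. Qed.

Lemma spaceA_spec_eb p : spaceA p -> exp_bounded (fun m => p (ta * q ^ m)).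
Proof.
  revert p. apply (spaceA_ind (fun p => exp_bounded (fun m => p (ta * q ^ m)))).
  - intros f g E Hf. apply eb_ext with (2 := Hf). intros m. apply E, spec_neq_0.
  - apply eb_bd, bd_const.
  - intros k1 k2 f g Hf Hg'. apply eb_plus; (apply eb_mult; [apply eb_bd, bd_const|assumption]).
  - intros f Hf. apply (eb_mult (fun m => ta * q ^ m + / (ta * q ^ m))); [|exact Hf].
    apply eb_plus.
    + apply eb_mult; [apply eb_bd, bd_const|apply eb_pow].
    + apply eb_ext with (fun m => / ta * (/ q) ^ m).
      * intros m. rewrite Cpow_inv by (apply (q_neq_0 q0 Hq)).
        pose proof (ta_neq_0 q0 a b c d Hq Hg) as H1. fold q al ta in H1.
        pose proof (Cpow_nz q m (q_neq_0 q0 Hq)). field. split; assumption.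
      * apply eb_mult; [apply eb_bd, bd_const|apply eb_pow].
Qed.

Lemma gs_sd : gauss_bounded q0 gs.
Proof.
  apply sd_ext with (fun m => q ^ (m * (m - 1) / 2) * (qpoch q (b * c) m * (/ qpoch q (a * d) m *
    / (qpoch_inf q (b * c) * qpoch_inf q (q / (a * d)))) * (- (a * d)) ^ m)).
  - intros m. unfold gs. rewrite (gst_value q0 a b c d Hq Hg). fold q.
    assert (qpoch q (a * d) m <> 0) by (apply qpoch_neq_0; intros; apply (gen_pair q0 a b c d Hg); simpl; auto).
    assert (qpoch_inf q (b * c) <> 0) by (apply qpoch_inf_neq_0; [exact Hq|apply gen_bc]).
    assert (qpoch_inf q (q / (a * d)) <> 0) by (apply qpoch_inf_neq_0; [exact Hq|apply gen_qad]).
    set (y := qpoch_inf q (q / (a * d))) in *. clearbody y. field. repeat split; assumption.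
  - apply sd_eb; [now apply sd_gauss|]. apply eb_mult; [|apply eb_pow].
    apply eb_bd. apply bd_mult; [now apply bd_qpoch|]. apply bd_mult; [|apply bd_const].
    apply bd_inv_qpoch; [exact Hq|]. apply (gen_pair q0 a b c d Hg); simpl; auto.
Qed.

Lemma spaceA_gst_sd p : spaceA p -> gauss_bounded q0 (fun m => p (ta * q ^ m) * gs m * h m).
Proof.
  intros Hp. apply sd_ext with (fun m => gs m * (p (ta * q ^ m) * h m)); [intros; ring|].
  apply sd_eb; [apply gs_sd|]. apply eb_mult; [now apply spaceA_spec_eb|].
  apply (htilde_eb q0 a b c d Hq (gen_awok' q0 a b c d Hq Hg) gen_bc).
Qed.

Definition Fc (p : C -> C) (m : nat) : C :=
  AWF q al T (fun x => p x * / gauss q al x) (spec_pt q al m).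

Lemma ginv_form p : eq_on Cstar (fun x => p x * / gauss q al x) (fun x => p x * ginv q d x).
Proof. intros x _. unfold al. rewrite gauss_ginv. reflexivity. Qed.

(** One normalisation [v] serves all [p] and [m], so linearity and the recurrence in [m] are
    inherited from the integrals [L3]. *)
Lemma Fc_value : exists v : C, v <> 0 /\ (forall p, spaceA p -> forall m, exists u, L3 q0 a b c d T p m u) /\
  (forall p m (u : C), L3 q0 a b c d T p m u -> Fc p m = u / v).
Proof.
  destruct (integrals_exist q0 a b c d T Hq Hg HT) as (v & w & Hv & Hw & Nv & _).
  exists v. split; [exact Nv|]. split.
  - intros p' Hp' m. now apply L3_exists.
  - intros p' m u Hu. apply (AWF_value q0 a b c d T Hq Hg HT _ p' m u v (ginv_form p') Hv Nv Hu).
Qed.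

Lemma Fc_ext p p' m : spaceA p -> eq_on Cstar p p' -> Fc p m = Fc p' m.
Proof.
  intros Hp E. destruct Fc_value as (v & Nv & Hex & Hval).
  destruct (Hex p Hp m) as [u Hu]. rewrite (Hval p m u Hu). symmetry. apply Hval.
  now apply (L3_ext q0 a b c d T HT p p' m u E).
Qed.

Lemma Fc_lin k1 k2 f g m : spaceA f -> spaceA g -> Fc (fun x => k1 * f x + k2 * g x) m = k1 * Fc f m + k2 * Fc g m.
Proof.
  intros Hf Hg'. destruct Fc_value as (v & Nv & Hex & Hval).
  destruct (Hex f Hf m) as [u Hu]. destruct (Hex g Hg' m) as [u' Hu'].
  rewrite (Hval f m u Hu), (Hval g m u' Hu').
  rewrite (Hval _ m _ (L3_lin q0 a b c d T k1 k2 f g m u u' Hu Hu')). field. exact Nv.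
Qed.

Lemma Fc_X f m : spaceA f -> Fc (fun x => (x + / x) * f x) m =
  awA q a b c d m * Fc f (S m) + awB q a b c d m * Fc f m + awC q a b c d m * Fc f (pred m).
Proof.
  intros Hf. destruct Fc_value as (v & Nv & Hex & Hval).
  destruct (Hex f Hf m) as [u Hu]. destruct (Hex f Hf (S m)) as [u1 Hu1]. destruct (Hex f Hf (pred m)) as [u2 Hu2].
  rewrite (Hval f m u Hu), (Hval f _ u1 Hu1), (Hval f _ u2 Hu2).
  rewrite (Hval (fun x => (x + / x) * f x) m (awA q a b c d m * u1 + awB q a b c d m * u + awC q a b c d m * u2)).
  - field. exact Nv.
  - pose proof (CI_plus _ _ _ _ (CI_plus _ _ _ _ (CI_scal (awA q a b c d m) _ _ Hu1) (CI_scal (awB q a b c d m) _ _ Hu))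
      (CI_scal (awC q a b c d m) _ _ Hu2)) as Z.
    apply CI_ext with (2 := Z). intros t Ht. cbv beta.
    pose proof (awE_recurrence _ _ _ _ _ m (path T t) (gen_awok q0 a b c d Hq Hg) (x_neq_0 q0 a b c d T HT t Ht)) as E.
    fold q in E. fold q. set (w := wt _ _ _). set (e := dpath T t / path T t).
    transitivity (w * f (path T t) * e * ((path T t + / path T t) * awE q a b c d m (path T t))); [|ring].
    rewrite E. ring.
Qed.

Lemma Fc_tau n m : Fc (awE q a b c (q / d) n) m = AWconst q al * gt n * (awE q ta tb tc td n (ta * q ^ m) * gs m).
Proof. apply (AWF_tau q0 a b c d T Hq Hg HT). apply ginv_form. Qed.

(** The [tau] polynomials span the space, and for these the explicit formula exhibits [p']. *)
Lemma Fc_W p : spaceA p -> exists p', spaceA p' /\ forall m, Fc p m = p' (ta * q ^ m) * gs m.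
Proof.
  intros Hp. pose proof (spaceA_spanned _ _ _ _ _ p (gen_awok_tau q0 a b c d Hq Hg) Hp) as Sp.
  cut (spaceA p /\ exists p', spaceA p' /\ forall m, Fc p m = p' (ta * q ^ m) * gs m); [tauto|]. clear Hp.
  induction Sp as [n|k1 k2 f g Hf (Af & f' & Af' & Ef) Hg' (Ag & g' & Ag' & Eg)|f g E Hf (Af & f' & Af' & Ef)].
  - split; [apply spaceA_awE, (gen_awok_tau q0 a b c d Hq Hg)|].
    (* The summand with coefficient 0 only gives the witness the shape of [spaceA_lin]. *)
    exists (fun y => AWconst q al * gt n * awE q ta tb tc td n y + 0 * awE q ta tb tc td n y). split.
    + apply spaceA_lin; apply spaceA_awE, (gen_awok_st q0 a b c d Hq Hg).
    + intros m. fold q. rewrite Fc_tau. ring.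
  - split; [now apply spaceA_lin|]. exists (fun y => k1 * f' y + k2 * g' y). split; [now apply spaceA_lin|].
    intros m. rewrite Fc_lin, Ef, Eg by assumption. ring.
  - split; [now apply spaceA_ext with (1 := E)|]. exists f'. split; [exact Af'|].
    intros m. rewrite <- Ef. symmetry. now apply Fc_ext.
Qed.

(** Now the [sigma tau] polynomials are the spanning family; the explicit formula is divided by its
    constants, which genericity keeps nonzero. *)
Lemma Fc_surj p' : spaceA p' -> exists p, spaceA p /\ forall m, Fc p m = p' (ta * q ^ m) * gs m.
Proof.
  intros Hp. pose proof (spaceA_spanned _ _ _ _ _ p' (gen_awok_st q0 a b c d Hq Hg) Hp) as Sp. clear Hp.
  induction Sp as [n|k1 k2 f g Hf (f' & Af' & Ef) Hg' (g' & Ag' & Eg)|f g E Hf (f' & Af' & Ef)].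
  - assert (At : spaceA (awE q a b c (q / d) n)) by apply spaceA_awE, (gen_awok_tau q0 a b c d Hq Hg).
    exists (fun y => / (AWconst q al * gt n) * awE q a b c (q / d) n y + 0 * awE q a b c (q / d) n y). split.
    + now apply spaceA_lin.
    + intros m. rewrite Fc_lin, Fc_tau by assumption. fold q al ta tb tc td.
      pose proof AWconst_neq_0. pose proof (gtst_neq_0 n). field. split; assumption.
  - exists (fun y => k1 * f' y + k2 * g' y). split; [now apply spaceA_lin|].
    intros m. rewrite Fc_lin, Ef, Eg by assumption. ring.
  - exists f'. split; [exact Af'|]. intros m. rewrite Ef, E; [reflexivity|apply spec_neq_0].
Qed.

Lemma Fc_sd p : spaceA p -> gauss_bounded q0 (fun m => Fc p m * h m).
Proof.
  intros Hp. destruct (Fc_W p Hp) as (p' & Hp' & E).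
  apply sd_ext with (2 := spaceA_gst_sd p' Hp'). intros m. now rewrite E.
Qed.

(** The right-hand side is known explicitly, because 1 is the [tau] polynomial of degree 0; the
    limits of the connection coefficients are matched with it factor by factor. *)
Lemma awgam_limit m : cvg (fun K => awgam q a b c d K m) (Fc (fun _ => 1) m * h m).
Proof.
  destruct (gen_nz q0 a b c d Hg) as (Ha & Hb & Hc & Hd).
  pose proof (gen_pair q0 a b c d Hg) as GP. fold q in GP.
  pose proof (gen_Mk q0 a b c d Hq Hg) as HM. fold q in HM.
  assert (N1 : qpoch_inf q (a * b * c * d) <> 0) by (apply qpoch_inf_neq_0; [exact Hq|exact HM]).
  assert (Pn : forall y, (forall k, 1 - y * q ^ k <> 0) -> forall k, qpoch q y k <> 0)
    by (intros; apply qpoch_neq_0; auto).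
  assert (EF : Fc (fun _ => 1) m = AWconst q al * gt 0 * gs m).
  { rewrite (Fc_ext _ (awE q a b c (q / d) 0) m spaceA_1); [|intros x _; symmetry; apply awE_0].
    rewrite Fc_tau, awE_0. ring. }
  replace (Fc (fun _ => 1) m * h m) with
    (qpoch_inf q (a * d) * qpoch_inf q (b * d) * qpoch_inf q (c * d) * / qpoch_inf q (a * b * c * d) *
     ((1 - q ^ (2 * m) / q * a * b * c * d) *
     (qpoch q (/ q * a * b * c * d) m * qpoch q (a * b) m * qpoch q (a * c) m) /
     ((1 - / q * a * b * c * d) * (qpoch q q m * qpoch q (b * d) m * qpoch q (c * d) m)) * (d / a) ^ m) *
     (newton q 0 m * / (/ qpoch_inf q (a * b * c * d) * qpoch_inf q (a * b * c * d)))).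
  - unfold awgam. unfold Cdiv at 1. unfold Cdiv at 4.
    apply (cvg_mult (fun K => qpoch q (a * d) K * qpoch q (b * d) K * qpoch q (c * d) K * / qpoch q (a * b * c * d) K * _)).
    + apply cvg_mult; [|apply cvg_const].
      apply cvg_mult; [apply cvg_mult; [apply cvg_mult|]|]; try (now apply qpoch_cvg).
      apply cvg_inv; [exact N1|now apply qpoch_cvg].
    + apply cvg_mult; [now apply newton_cvg|].
      apply cvg_inv; [rewrite Cinv_l by exact N1; apply C1_nz|].
      (* The shifted factorial with base [a * b * c * d * q ^ K] is a quotient of two with the fixed
         base [a * b * c * d], so it tends to 1. *)
      apply cvg_ext with (fun K => / qpoch q (a * b * c * d) K * qpoch q (a * b * c * d) (m + K)).
      * intros K. rewrite Nat.add_comm, qpoch_add. field. apply Pn, HM.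
      * apply cvg_mult; [apply cvg_inv; [exact N1|now apply qpoch_cvg]|].
        apply cvg_shift. now apply qpoch_cvg.
  - rewrite EF. unfold gs, gt. rewrite (gst_value q0 a b c d Hq Hg), (gtst_value q0 a b c d Hq Hg). fold q.
    rewrite newton_0. unfold h, htilde, al, AWconst, qpochs_inf, qpochs. cbv beta iota delta [fold_right]. simpl (qpoch q _ 0).
    replace (- (a * d)) with (- (1) * (d / a) * (a * a)) by (field; exact Ha). rewrite !Cpow_mult_l, Cpow_double.
    change (0 * (0 - 1) / 2)%nat with O. simpl (Cpow _ 0).
    assert (N2 : qpoch_inf q (b * c) <> 0) by (apply qpoch_inf_neq_0; [exact Hq|apply gen_bc]).
    assert (N3 : qpoch_inf q (d / a) <> 0) by (apply qpoch_inf_neq_0; [exact Hq|apply (gen_dqa q0 a b c d Hg)]).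
    assert (N4 : qpoch_inf q (q / (a * d)) <> 0) by (apply qpoch_inf_neq_0; [exact Hq|apply gen_qad]).
    assert (N5 : qpoch q (a * d) m <> 0) by (apply Pn, GP; simpl; auto).
    assert (N6 : qpoch q (b * d) m <> 0) by (apply Pn, GP; simpl; auto).
    assert (N7 : qpoch q (c * d) m <> 0) by (apply Pn, GP; simpl; auto).
    assert (N8 : qpoch q (b * c) m <> 0) by (apply Pn, GP; simpl; auto).
    assert (N9 : qpoch q q m <> 0) by (apply qpoch_q_neq_0; now apply one_sub_qpow).
    pose proof (gen_M q0 a b c d Hg 0) as N10. fold q in N10. simpl in N10.
    assert (N10' : 1 - / q * a * b * c * d <> 0).
    { intro E. apply N10. rewrite <- E. unfold Cdiv. ring. }
    pose proof (Cpow_nz a m Ha) as N11.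
    set (y1 := qpoch_inf q (b * c)) in *. set (y2 := qpoch_inf q (d / a)) in *. set (y3 := qpoch_inf q (q / (a * d))) in *.
    set (y4 := 1 - / q * a * b * c * d) in *. set (y5 := 1 - q ^ (2 * m) / q * a * b * c * d) in *.
    set (y6 := (d / a) ^ m). set (y7 := qpoch q (/ q * a * b * c * d) m).
    clearbody y1 y2 y3 y4 y5 y6 y7. rewrite ?Cpow_double. field. repeat split; try assumption; apply (q_neq_0 q0 Hq).
Qed.
(** The majorant must not depend on [K]. The denominator with base [a * b * c * d * q ^ K] is
    rewritten as a quotient of shifted factorials with a fixed base, and [newton_bound] is uniform
    in [K]. *)
Lemma awgam_bound : exists B R0 : R, (0 < B)%R /\ (0 < R0)%R /\
  forall K m, (Cmod (awgam q a b c d K m) <= B * gw q0 R0 m)%R.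
Proof.
  pose proof (gen_pair q0 a b c d Hg) as GP. fold q in GP.
  pose proof (gen_Mk q0 a b c d Hq Hg) as HM. fold q in HM.
  assert (H1 : bounded_seq (fun K => qpoch q (a * d) K * (qpoch q (b * d) K * (qpoch q (c * d) K * / qpoch q (a * b * c * d) K)))).
  { repeat apply bd_mult; try (now apply bd_qpoch). now apply bd_inv_qpoch. }
  assert (H2 : exp_bounded (fun m => (1 - / q * a * b * c * d * q ^ (2 * m)) *
     (qpoch q (/ q * a * b * c * d) m * (qpoch q (a * b) m * qpoch q (a * c) m)) *
     (/ (1 - / q * a * b * c * d) * (/ qpoch q q m * (/ qpoch q (b * d) m * / qpoch q (c * d) m))) * (d / a) ^ m)).
  { apply eb_mult; [apply eb_bd|apply eb_pow]. repeat apply bd_mult; try (now apply bd_qpoch); try apply bd_const.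
    - apply (bd_even (fun m => 1 - / q * a * b * c * d * q ^ m)). now apply bd_factor.
    - apply bd_inv_qpoch; [exact Hq|]. now apply one_sub_qpow.
    - apply bd_inv_qpoch; [exact Hq|]. apply GP; simpl; auto.
    - apply bd_inv_qpoch; [exact Hq|]. apply GP; simpl; auto. }
  destruct H1 as (B1 & P1 & H1). destruct H2 as (B2 & R0 & P2 & PR & H2).
  destruct (bd_qpoch q0 Hq (a * b * c * d)) as (B3 & P3 & H3).
  destruct (bd_inv_qpoch q0 Hq (a * b * c * d) HM) as (B4 & P4 & H4).
  exists (B1 * B2 * (B3 * B4))%R, R0. split; [repeat apply Rmult_lt_0_compat; assumption|]. split; [exact PR|].
  intros K m.
  assert (Pn : forall y, (forall k, 1 - y * q ^ k <> 0) -> forall k, qpoch q y k <> 0)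
    by (intros; apply qpoch_neq_0; auto).
  assert (N1 : qpoch q (a * b * c * d) K <> 0) by (apply Pn, HM).
  assert (N2 : qpoch q (a * b * c * d * q ^ K) m <> 0).
  { apply Pn. intros k. rewrite <- Cmult_assoc, <- Cpow_add_r. apply HM. }
  replace (awgam q a b c d K m) with
    (qpoch q (a * d) K * (qpoch q (b * d) K * (qpoch q (c * d) K * / qpoch q (a * b * c * d) K)) *
     ((1 - / q * a * b * c * d * q ^ (2 * m)) *
     (qpoch q (/ q * a * b * c * d) m * (qpoch q (a * b) m * qpoch q (a * c) m)) *
     (/ (1 - / q * a * b * c * d) * (/ qpoch q q m * (/ qpoch q (b * d) m * / qpoch q (c * d) m))) * (d / a) ^ m) *
     (newton q (q ^ K) m * (qpoch q (a * b * c * d) K * / qpoch q (a * b * c * d) (K + m)))).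
  - set (z := newton q (q ^ K) m * _). rewrite (Cmod_mult _ z). unfold z.
    unfold gw.
    replace (B1 * B2 * (B3 * B4) * (R0 ^ m * q0 ^ (m * (m - 1) / 2)))%R with
      ((B1 * (B2 * R0 ^ m)) * (q0 ^ (m * (m - 1) / 2) * (B3 * B4)))%R by ring.
    apply Rmult_le_compat; try apply Cmod_ge_0.
    + rewrite Cmod_mult. apply Rmult_le_compat; try apply Cmod_ge_0; [apply (H1 K)|apply H2].
    + rewrite Cmod_mult. apply Rmult_le_compat; try apply Cmod_ge_0; [now apply newton_bound|].
      rewrite Cmod_mult. apply Rmult_le_compat; try apply Cmod_ge_0; [apply H3|apply H4].
  - unfold awgam. rewrite qpoch_add.
    replace (q ^ (2 * m) / q * a * b * c * d) with (/ q * a * b * c * d * q ^ (2 * m)) by (unfold Cdiv; ring).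
    assert (N6 : qpoch q (b * d) m <> 0) by (apply Pn, GP; simpl; auto).
    assert (N7 : qpoch q (c * d) m <> 0) by (apply Pn, GP; simpl; auto).
    assert (N9 : qpoch q q m <> 0) by (apply qpoch_q_neq_0; now apply one_sub_qpow).
    pose proof (gen_M q0 a b c d Hg 0) as N10. fold q in N10. simpl in N10.
    assert (N10' : 1 - / q * a * b * c * d <> 0).
    { intro E. apply N10. rewrite <- E. unfold Cdiv. ring. }
    set (z1 := 1 - / q * a * b * c * d) in *. set (z2 := 1 - / q * a * b * c * d * q ^ (2 * m)).
    set (z3 := qpoch q (/ q * a * b * c * d) m). set (z4 := (d / a) ^ m). set (z5 := newton q (q ^ K) m).
    clearbody z1 z2 z3 z4 z5. field. repeat split; assumption.
Qed.

Lemma awE_eb (x : C) : x <> 0 -> exp_bounded (fun m => awE q a b c d m x).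
Proof.
  intros Hx. destruct (awE_growth q0 a b c d Hq (gen_awok' q0 a b c d Hq Hg) (Cmod (x + / x)) (Cmod_ge_0 _))
    as (R0 & HR & HE).
  exists 1%R, R0. split; [lra|]. split; [lra|]. intros m. rewrite Rmult_1_l. apply (HE x Hx (Rle_refl _)).
Qed.

(** The inversion formula for [p], stated with partial sums so that Green's identity, which is exact
    for finite sums, can be applied before the limit. *)
Definition expands (p : C -> C) : Prop := forall x : C, x <> 0 ->
  cvg (fun n => csum (fun m => Fc p m * h m * awE q a b c d m x) (S n)) (p x * ginv q d x).

Lemma expands_1 : expands (fun _ => 1).
Proof.
  intros x Hx. rewrite Cmult_1_l.
  destruct awgam_bound as (B & R0 & HB & HR & Hb). destruct (awE_eb x Hx) as (B' & R1 & HB' & HR' & Hb').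
  apply tannery with q0 (fun K m => awgam q a b c d K m * awE q a b c d m x) (B * B')%R (R0 * R1)%R (awphi q d x).
  - exact Hq.
  - now apply Rmult_lt_0_compat.
  - now apply Rmult_lt_0_compat.
  - intros K m. rewrite Cmod_mult. unfold gw in *. rewrite Rpow_mult_distr.
    replace (B * B' * (R0 ^ m * R1 ^ m * q0 ^ (m * (m - 1) / 2)))%R with
      ((B * (R0 ^ m * q0 ^ (m * (m - 1) / 2))) * (B' * R1 ^ m))%R by ring.
    apply Rmult_le_compat; auto using Cmod_ge_0.
  - intros m. apply (cvg_mult (fun K => awgam q a b c d K m) (fun _ => awE q a b c d m x)); [|apply cvg_const].
    apply awgam_limit.
  - intros K. apply awphi_expansion; [apply (gen_awok' q0 a b c d Hq Hg)|exact Hx].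
  - apply (cvg_mult (qpoch q (d * x)) (qpoch q (d / x))); now apply qpoch_cvg.
Qed.

(** Green's identity: both sequences satisfy the same three-term recurrence, for which [h] is a
    symmetrizing weight. *)
Lemma Fc_green p (x : C) n : spaceA p -> x <> 0 ->
  csum (fun m => Fc (fun y => (y + / y) * p y) m * h m * awE q a b c d m x) (S n) =
  (x + / x) * csum (fun m => Fc p m * h m * awE q a b c d m x) (S n) +
  - (awA q a b c d n * h n * (Fc p n * awE q a b c d (S n) x - Fc p (S n) * awE q a b c d n x)).
Proof.
  intros Hp Hx. pose proof (gen_awok q0 a b c d Hq Hg) as H. fold q in H.
  induction n as [|n IH].
  - simpl csum. rewrite Fc_X by exact Hp. simpl pred.
    pose proof (awE_recurrence _ _ _ _ _ 0 x H Hx) as E. simpl pred in E. rewrite awC_0 in *.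
    rewrite (awE_0 q a b c d x) in *.
    transitivity (Fc p 0 * h 0%nat * ((x + / x) * 1) +
      - (awA q a b c d 0 * h 0%nat * (Fc p 0 * awE q a b c d 1 x - Fc p 1 * 1))); [|ring].
    rewrite E. ring.
  - change (csum ?f (S (S n))) with (csum f (S n) + f (S n)). rewrite IH. cbv beta.
    rewrite Fc_X by exact Hp. simpl pred.
    pose proof (awE_recurrence _ _ _ _ _ (S n) x H Hx) as E. simpl pred in E.
    pose proof (htilde_recurrence q0 a b c d (gen_awok' q0 a b c d Hq Hg) gen_bc n) as Eh. fold q al in Eh. fold h in Eh.
    rewrite Eh.
    set (s := csum _ _).
    transitivity ((x + / x) * s + Fc p (S n) * h (S n) * ((x + / x) * awE q a b c d (S n) x) +
      - (awA q a b c d (S n) * h (S n) * (Fc p (S n) * awE q a b c d (S (S n)) x - Fc p (S (S n)) * awE q a b c d (S n) x)));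
      [|ring].
    rewrite E. ring.
Qed.

Lemma expands_X p : spaceA p -> expands p -> expands (fun x => (x + / x) * p x).
Proof.
  intros Hp HQ x Hx.
  apply cvg_ext with (fun n => (x + / x) * csum (fun m => Fc p m * h m * awE q a b c d m x) (S n) +
    - (awA q a b c d n * h n * (Fc p n * awE q a b c d (S n) x - Fc p (S n) * awE q a b c d n x))).
  { intros n. symmetry. now apply Fc_green. }
  replace ((x + / x) * p x * ginv q d x) with ((x + / x) * (p x * ginv q d x) + 0) by ring.
  apply (cvg_plus (fun n => (x + / x) * csum (fun m => Fc p m * h m * awE q a b c d m x) (S n))
    (fun n => - (awA q a b c d n * h n * (Fc p n * awE q a b c d (S n) x - Fc p (S n) * awE q a b c d n x)))).
  { apply (cvg_scal (x + / x)). apply (HQ x Hx). }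
  pose proof (gen_awok' q0 a b c d Hq Hg) as H'. fold q in H'.
  pose proof (Fc_sd p Hp) as Sd. pose proof (sd_shift q0 _ Hq Sd) as Sd'. cbv beta in Sd'.
  pose proof (awE_eb x Hx) as Eb.
  replace (RtoC 0) with (0 + - (1) * 0) by ring.
  (* [htilde_recurrence] turns [awA n * h n] into [awC (S n) * h (S n)] in one term, so that [Fc]
     and [h] carry the same index in both and [Fc_sd] applies. *)
  apply cvg_ext with (fun n => Fc p (S n) * h (S n) * (awC q a b c d (S n) * awE q a b c d n x) +
    - (1) * (Fc p n * h n * (awA q a b c d n * awE q a b c d (S n) x))).
  { intros n.
    pose proof (htilde_recurrence q0 a b c d H' gen_bc n) as Eh. fold q al in Eh. fold h in Eh.
    transitivity (Fc p (S n) * awE q a b c d n x * (awC q a b c d (S n) * h (S n)) +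
      - (1) * (Fc p n * h n * (awA q a b c d n * awE q a b c d (S n) x))); [ring|]. rewrite <- Eh. ring. }
  apply (cvg_plus (fun n => Fc p (S n) * h (S n) * (awC q a b c d (S n) * awE q a b c d n x))
    (fun n => - (1) * (Fc p n * h n * (awA q a b c d n * awE q a b c d (S n) x)))); [|apply cvg_scal].
  - apply sd_0 with q0; [exact Hq|]. apply (sd_eb q0 (fun n => Fc p (S n) * h (S n))); [exact Sd'|].
    apply eb_mult; [|exact Eb]. apply eb_bd, bd_shift. apply (bd_awC q0 a b c d Hq H').
  - apply sd_0 with q0; [exact Hq|]. apply (sd_eb q0 (fun n => Fc p n * h n)); [exact Sd|].
    apply eb_mult; [|now apply (eb_shift (fun n => awE q a b c d n x))]. apply eb_bd. apply (bd_awA q0 a b c d Hq H').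
Qed.

Lemma spaceA_expands p : spaceA p -> expands p.
Proof.
  intros Hp. cut (spaceA p /\ expands p); [tauto|]. revert p Hp.
  apply (spaceA_ind (fun p => spaceA p /\ expands p)).
  - intros f g E [Af Hf]. split; [now apply spaceA_ext with (1 := E)|].
    intros x Hx. rewrite <- (E x Hx).
    apply cvg_ext with (2 := Hf x Hx). intros n. apply csum_ext. intros m _. now rewrite (Fc_ext f g m Af E).
  - split; [apply spaceA_1|apply expands_1].
  - intros k1 k2 f g [Af Hf] [Ag Hg']. split; [now apply spaceA_lin|]. intros x Hx.
    apply cvg_ext with (fun n => k1 * csum (fun m => Fc f m * h m * awE q a b c d m x) (S n) +
      k2 * csum (fun m => Fc g m * h m * awE q a b c d m x) (S n)).
    + intros n. rewrite <- !csum_scal, <- csum_plus. apply csum_ext. intros m _. rewrite Fc_lin by assumption. ring.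
    + replace ((k1 * f x + k2 * g x) * ginv q d x) with (k1 * (f x * ginv q d x) + k2 * (g x * ginv q d x)) by ring.
      apply (cvg_plus (fun n => k1 * csum _ (S n)) (fun n => k2 * csum _ (S n))); apply cvg_scal; [apply (Hf x Hx)|apply (Hg' x Hx)].
  - intros f [Af Hf]. split; [now apply spaceA_X|now apply expands_X].
Qed.

End Series.

(** * The bijection *)

(** The growth rate of the polynomials depends on [x] only through a bound on [x + / x], and a
    closed set without 0 stays outside a disc about 0. *)
Lemma closed_away_from_0 (K : C -> Prop) : compact_in_Cstar K ->
  exists X : R, (0 <= X)%R /\ forall x, K x -> x <> 0 /\ (Cmod (x + / x) <= X)%R.
Proof.
  intros (Hc & (M & HM) & H0).
  assert (Hl : exists e : posreal, forall y : C, @ball C_UniformSpace (RtoC 0) e y -> ~ K y).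
  { apply NNPP. intros N. apply (H0 (RtoC 0)); [|reflexivity]. apply Hc. intros L. apply N. exact L. }
  destruct Hl as [e He]. exists (Rabs M + / e)%R. pose proof (cond_pos e) as Pe.
  pose proof (Rabs_pos M). pose proof (Rinv_0_lt_compat e Pe). split; [lra|].
  intros x Kx. pose proof (H0 x Kx) as Nx. split; [exact Nx|].
  assert (Lx : (e <= Cmod x)%R).
  { apply Rnot_lt_le. intros L. apply (He x); [|exact Kx].
    split; unfold ball; simpl; unfold AbsRing_ball, abs, minus, plus, opp; simpl.
    - change (fst x) with (Re x). replace (Re x + - 0)%R with (Re x) by ring.
      apply Rle_lt_trans with (1 := re_le_Cmod x) (2 := L).
    - change (snd x) with (Im x). replace (Im x + - 0)%R with (Im x) by ring.
      apply Rle_lt_trans with (1 := im_le_Cmod x) (2 := L). }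
  eapply Rle_trans; [apply Cmod_triangle|]. apply Rplus_le_compat.
  - apply Rle_trans with (1 := HM x Kx), Rle_abs.
  - rewrite Cmod_inv by exact Nx. now apply Rinv_le_contravar.
Qed.

Section Transforms.

Variables (q0 : R) (a b c d : C) (T : contour).
Let q := RtoC q0.
Let al := Params a b c d.
Hypothesis Hq : (0 < q0 < 1)%R.
Hypothesis Hg : generic q al.
Hypothesis HT : AWcontour q al T.

Let al_t := alpha_tau q al.
Let al_st := alpha_tau q (alpha_sigma q al).
Let al_tst := alpha_tau q (alpha_sigma q (alpha_tau q al)).
Let ta := ptilde q al.

Lemma AWI_term_awE g m x :
  AWI_term q al g m x = g (spec_pt q al m) * awE q a b c d m x * htilde q al m.
Proof.
  unfold AWI_term. unfold q. rewrite (AWE_awE q0 al m x Hq (ta_neq_0 q0 a b c d Hq Hg)). reflexivity.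
Qed.

Lemma AWI_term_convergent g : spaceAGst q al g -> abs_unif_convergent (AWI_term q al g).
Proof.
  intros (p & Hp & Eg) K HK eps.
  destruct (closed_away_from_0 K HK) as (X & HX & HKX).
  destruct (awE_growth q0 a b c d Hq (gen_awok' q0 a b c d Hq Hg) X HX) as (R1 & HR1 & HE).
  destruct (spaceA_gst_sd q0 a b c d Hq Hg p Hp) as (B & R0 & HB & HR & Hs).
  assert (HRR : (0 < R0 * R1)%R) by (apply Rmult_lt_0_compat; lra).
  destruct (gw_tails q0 Hq (R0 * R1) HRR (eps / B)%R) as [N HN].
  { apply Rdiv_lt_0_compat; [apply cond_pos|exact HB]. }
  exists N. intros n m Hn x Kx. destruct (HKX x Kx) as [Nx Lx].
  apply Rle_lt_trans with (sum_n_m (fun k => B * gw q0 (R0 * R1) k)%R n m).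
  - apply sum_n_m_le. intros k. rewrite AWI_term_awE.
    rewrite (Eg (spec_pt q al k)) by (now exists k).
    replace (p (spec_pt q al k) * gauss q (alpha_tau q (alpha_sigma q al)) (spec_pt q al k) *
      awE q a b c d k x * htilde q al k) with
      (p (ta * q ^ k) * gst q0 a b c d k * htilde q al k * awE q a b c d k x)
      by (unfold gst, spec_pt; fold q al ta; ring).
    rewrite Cmod_mult. unfold gw. rewrite Rpow_mult_distr.
    replace (B * (R0 ^ k * R1 ^ k * q0 ^ (k * (k - 1) / 2)))%R with
      (B * (R0 ^ k * q0 ^ (k * (k - 1) / 2)) * R1 ^ k)%R by ring.
    apply Rmult_le_compat; try apply Cmod_ge_0; [apply Hs|now apply HE].
  - replace (pos eps) with (B * (eps / B))%R by (field; lra).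
    rewrite (sum_n_m_mult_l (B : R_Ring) (gw q0 (R0 * R1)) n m : sum_n_m (fun k => B * gw q0 (R0 * R1) k)%R n m = _).
    apply Rmult_lt_compat_l; [exact HB|]. now apply HN.
Qed.

Lemma AWF_Fc f p m : spaceA p -> eq_on Cstar f (fun x => p x * / gauss q al x) ->
  AWF q al T f (spec_pt q al m) = Fc q0 a b c d T p m.
Proof.
  intros Hp E. destruct (integrals_exist q0 a b c d T Hq Hg HT) as (v & w & Hv & Hw & Nv & _).
  destruct (L3_exists q0 a b c d T Hq Hg HT p m Hp) as [u Hu].
  transitivity (u / v).
  - apply AWF_value with (p := p); try assumption.
    intros x Hx. rewrite (E x Hx). apply ginv_form, Hx.
  - symmetry. apply AWF_value with (p := p); try assumption. apply ginv_form.
Qed.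

Lemma AWI_value g p : spaceA p -> (forall m, g (spec_pt q al m) = Fc q0 a b c d T p m) ->
  eq_on Cstar (AWI q al g) (fun x => p x * / gauss q al x).
Proof.
  intros Hp E x Hx. unfold al at 2. rewrite gauss_ginv. apply cvg_CSeries.
  apply cvg_ext with (2 := spaceA_expands q0 a b c d T Hq Hg HT p Hp x Hx).
  intros n. apply csum_ext. intros m _. rewrite AWI_term_awE, E. fold q al. ring.
Qed.

Lemma AWF_spaceAGst f : spaceAGinv q al f -> spaceAGst q al (AWF q al T f).
Proof.
  intros (p & Hp & E). destruct (Fc_W q0 a b c d T Hq Hg HT p Hp) as (p' & Hp' & E').
  exists p'. split; [exact Hp'|]. intros s [m ->]. rewrite (AWF_Fc f p m Hp E). apply E'.
Qed.

Lemma spaceAGst_Fc g : spaceAGst q al g ->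
  exists p, spaceA p /\ forall m, g (spec_pt q al m) = Fc q0 a b c d T p m.
Proof.
  intros (p' & Hp' & E). destruct (Fc_surj q0 a b c d T Hq Hg HT p' Hp') as (p & Hp & E').
  exists p. split; [exact Hp|]. intros m. rewrite E' . apply E. now exists m.
Qed.

Lemma AW_bijection : linear_bijection_with_inverse
  Cstar (spaceAGinv q al) (spectrum q al) (spaceAGst q al) (AWF q al T) (AWI q al).
Proof.
  constructor.
  - intros f1 f2 (p & Hp & E) _ E12 s [m ->]. rewrite (AWF_Fc f1 p m Hp E). symmetry.
    apply (AWF_Fc f2 p m Hp). intros x Hx. rewrite <- (E12 x Hx). now apply E.
  - intros g1 g2 _ _ E x _. apply CSeries_ext. intros m. unfold AWI_term. rewrite E; [reflexivity|]. now exists m.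
  - apply AWF_spaceAGst.
  - intros g Hg'. destruct (spaceAGst_Fc g Hg') as (p & Hp & E). exists p. split; [exact Hp|]. now apply AWI_value.
  - intros k1 k2 f1 f2 (p1 & Hp1 & E1) (p2 & Hp2 & E2) s [m ->].
    rewrite (AWF_Fc f1 p1 m Hp1 E1), (AWF_Fc f2 p2 m Hp2 E2).
    rewrite <- (Fc_lin q0 a b c d T Hq Hg HT) by assumption.
    apply AWF_Fc; [now apply spaceA_lin|]. intros x Hx. rewrite (E1 x Hx), (E2 x Hx). ring.
  - intros f (p & Hp & E) x Hx. rewrite (AWI_value _ p Hp); [symmetry; now apply E| |exact Hx].
    intros m. now apply AWF_Fc.
  (* By surjectivity [g] is the transform of some [p * G^{-1}], which [I] recovers; applying [F] to
     it returns [g]. *)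
  - intros g Hg' s [m ->]. destruct (spaceAGst_Fc g Hg') as (p & Hp & E). rewrite E.
    apply AWF_Fc; [exact Hp|]. now apply AWI_value.
Qed.

(** Both radicands reduce to [a * b * c / d], so the two square roots are literally the same
    value. *)
Lemma ptilde_tau_sigma_tau : ptilde q al_t = ptilde q al_st.
Proof.
  destruct (gen_nz q0 a b c d Hg) as (Ha & Hb & Hc & Hd).
  pose proof (q_neq_0 q0 Hq) as Hq0. fold q in Hq0.
  pose proof (ta_neq_0 q0 a b c d Hq Hg) as H1. fold q al ta in H1.
  unfold ptilde at 1 2. f_equal. unfold al_t, al_st, alpha_sigma, alpha_tau. simpl. fold al ta.
  field. repeat split; assumption.
Qed.

Lemma AWE_tau n x : AWE q al_t (spec_pt q al_t n) x = awE q a b c (q / d) n x.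
Proof. apply (AWE_awE q0 al_t n x Hq). apply (ptilde_tau_neq_0 q0 a b c d Hq Hg). Qed.

Lemma AWE_sigma_tau n x : AWE q al_st (spec_pt q al_t n) x =
  awE q ta (a * b / ta) (a * c / ta) (q / (a * d / ta)) n x.
Proof.
  unfold spec_pt. rewrite ptilde_tau_sigma_tau. apply (AWE_awE q0 al_st n x Hq).
  fold q. rewrite <- ptilde_tau_sigma_tau. apply (ptilde_tau_neq_0 q0 a b c d Hq Hg).
Qed.

Lemma AWF_AWE n : eq_on (spectrum q al)
  (AWF q al T (fun x => AWE q al_t (spec_pt q al_t n) x * / gauss q al x))
  (fun r => AWconst q al * gauss q al_tst (spec_pt q al_t n) *
     (AWE q al_st (spec_pt q al_t n) r * gauss q al_st r)).
Proof.
  intros s [m ->]. rewrite AWE_sigma_tau.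
  apply (AWF_tau q0 a b c d T Hq Hg HT). intros x _. rewrite AWE_tau. unfold al. now rewrite gauss_ginv.
Qed.

Lemma AWI_AWE n : eq_on Cstar
  (AWI q al (fun r => AWE q al_st (spec_pt q al_t n) r * gauss q al_st r))
  (fun x => / AWconst q al * / gauss q al_tst (spec_pt q al_t n) *
     (AWE q al_t (spec_pt q al_t n) x * / gauss q al x)).
Proof.
  pose proof (AWconst_neq_0 q0 a b c d Hq Hg) as N1. fold q al in N1.
  pose proof (gtst_neq_0 q0 a b c d Hq Hg n) as N2. unfold gtst in N2. fold q al al_t al_tst in N2.
  assert (At : spaceA (awE q a b c (q / d) n)) by apply spaceA_awE, (gen_awok_tau q0 a b c d Hq Hg).
  set (k := / AWconst q al * / gauss q al_tst (spec_pt q al_t n)).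
  (* Dividing the formula for [F] by its constant [/ k] exhibits the given function as a transform,
     and [AWI_value] inverts it. *)
  intros x Hx. rewrite (AWI_value _ (fun x => k * awE q a b c (q / d) n x + 0 * awE q a b c (q / d) n x)).
  - rewrite AWE_tau. ring.
  - now apply spaceA_lin.
  - intros m. rewrite (Fc_lin q0 a b c d T Hq Hg HT) by assumption.
    fold q. rewrite <- (AWF_Fc (fun x => AWE q al_t (spec_pt q al_t n) x * / gauss q al x) _ m At).
    + rewrite AWF_AWE by (now exists m). unfold k. field. split; assumption.
    + intros y _. now rewrite AWE_tau.
  - exact Hx.
Qed.

End Transforms.

Theorem theorem4p6 :
  forall (q0 : R) (al : params) (T : contour),
  let q := RtoC q0 in
  let F := AWF q al T in
  let I := AWI q al in
  let al_t := alpha_tau q al in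
  let al_st := alpha_tau q (alpha_sigma q al) in
  let al_tst := alpha_tau q (alpha_sigma q (alpha_tau q al)) in
  (0 < q0 < 1)%R ->
  generic q al ->
  (0 < Re (pa al))%R ->
  AWcontour q al T ->
  (forall g, spaceAGst q al g -> abs_unif_convergent (AWI_term q al g)) /\
  linear_bijection_with_inverse
    Cstar (spaceAGinv q al) (spectrum q al) (spaceAGst q al) F I /\
  (forall s, spectrum q al_t s <-> spectrum q al_st s) /\
  (forall s, spectrum q al_t s ->
    eq_on (spectrum q al)
      (F (fun x => AWE q al_t s x * / gauss q al x))
      (fun r => AWconst q al * gauss q al_tst s *
                (AWE q al_st s r * gauss q al_st r)) /\
    eq_on Cstar
      (I (fun r => AWE q al_st s r * gauss q al_st r))
      (fun x => / AWconst q al * / gauss q al_tst s *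
                (AWE q al_t s x * / gauss q al x))).
Proof.
  intros q0 [a b c d] T q F I al_t al_st al_tst Hq Hg _ HT. split; [|split; [|split]].
  - now apply AWI_term_convergent.
  - now apply AW_bijection.
  - intros s. unfold spectrum, spec_pt, al_t, al_st, q. rewrite (ptilde_tau_sigma_tau q0 a b c d Hq Hg). tauto.
  - intros s [n ->]. split.
    + now apply AWF_AWE.
    (* The formula for [I] does not mention a contour, but its proof passes through [F], so the
       given one is supplied. *)
    + now apply AWI_AWE with (T := T).
Qed.
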